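(* Let $\rho_s\in C^\infty(\mathbb{T}^2)$ be any horizontal stratified state (i.e. $\rho_s(x)=g(x_2)$ for some function $g$) that is odd in $x_2$. For any $\epsilon>0$ and any $k>0$, there exists an initial data $\rho_0\in C^\infty(\mathbb{T}^2)$ satisfying $$\|\rho_0-\rho_s\|_{H^k(\mathbb{T}^2)}\le\epsilon,$$ such that the solution $\rho(\cdot,t)$ to the IPM equation in $\mathbb{T}^2$ with initial data $\rho_0$, provided it remains smooth for all times, satisfies $$\limsup_{t\to\infty} t^{-\frac{s}{2}}\|\rho(t)-\rho_s\|_{\dot H^{s+1}(\mathbb{T}^2)}=\infty\quad\text{for all } s>0.$$
   Context: $\mathbb{T}^2=[-\pi,\pi)^2$ is the 2D torus. The IPM equation in $\mathbb{T}^2$ is $\partial_t\rho+(u\cdot\nabla)\rho=0$, $\nabla\cdot u=0$, $u+\nabla p=-(0,\rho)$, where the velocity is given by the Biot-Savart law $u=\nabla^\perp(-\Delta)^{-1}\partial_{x_1}\rho$, $\nabla^\perp=(-\partial_{x_2},\partial_{x_1})$. For mean-zero $f$, $(-\Delta)^{-1}f=\sum_{k\in\mathbb{Z}^2\setminus\{(0,0)\}}|k|^{-2}\hat f(k)e^{ik\cdot x}$, where $\hat f(k)=\frac{1}{(2\pi)^2}\int_{\mathbb{T}^2}e^{-ik\cdot x}f(x)\,dx$. Every horizontal stratified state is a stationary solution. Homogeneous Sobolev norm: $\|f\|_{\dot H^s(\mathbb{T}^2)}^2=(2\pi)^2\sum_{k\in\mathbb{Z}^2\setminus\{(0,0)\}}|k|^{2s}|\hat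 f(k)|^2$. $H^k(\mathbb{T}^2)$ is the usual inhomogeneous Sobolev space. *)

(* Defs.v *)
(* Stdlib reals with Coquelicot. *)
From Stdlib Require Export Reals ZArith.
From Coquelicot Require Export Coquelicot.
#[global] Open Scope R_scope.

(** * Functions on the torus *)

(* A function on the torus [-PI, PI)^2 is a function of two real variables
   that is 2 PI-periodic in each of them. *)
Definition periodic (f : R -> R -> R) : Prop :=
  forall x1 x2, f (x1 + 2 * PI) x2 = f x1 x2 /\ f x1 (x2 + 2 * PI) = f x1 x2.

Definition d1 (f : R -> R -> R) : R -> R -> R :=
  fun x1 x2 => Derive (fun y => f y x2) x1.
Definition d2 (f : R -> R -> R) : R -> R -> R :=
  fun x1 x2 => Derive (fun y => f x1 y) x2.

Definition has_partials (f : R -> R -> R) : Prop :=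
  forall x1 x2,
    ex_derive (fun y => f y x2) x1 /\ ex_derive (fun y => f x1 y) x2.

Fixpoint Cn (n : nat) (f : R -> R -> R) : Prop :=
  (forall x1 x2, continuity_2d_pt f x1 x2) /\
  match n with
  | O => True
  | S m => has_partials f /\ Cn m (d1 f) /\ Cn m (d2 f)
  end.

Definition smooth_torus (f : R -> R -> R) : Prop :=
  periodic f /\ forall n, Cn n f.

(** * Fourier series and Sobolev norms *)

(* Sum of [a k1 k2] over the square |k1|, |k2| <= N. *)
Definition box_sum {G : AbelianMonoid} (a : Z -> Z -> G) (N : nat) : G :=
  sum_n (fun i => sum_n (fun j =>
    a (Z.of_nat i - Z.of_nat N)%Z (Z.of_nat j - Z.of_nat N)%Z) (2 * N)) (2 * N).

Definition omit0 {G : AbelianMonoid} (a : Z -> Z -> G) (k1 k2 : Z) : G :=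
  if andb (Z.eqb k1 0) (Z.eqb k2 0) then zero else a k1 k2.

(* e^{i theta} *)
Definition cis (theta : R) : C := (cos theta, sin theta).

Definition dotk (k1 k2 : Z) (x1 x2 : R) : R := IZR k1 * x1 + IZR k2 * x2.

(* |k|^2 *)
Definition normk2 (k1 k2 : Z) : R := IZR k1 ^ 2 + IZR k2 ^ 2.

Definition fourier (f : R -> R -> R) (k1 k2 : Z) : C :=
  Cmult (RtoC (/ (2 * PI) ^ 2))
    (RInt (V := C_R_CompleteNormedModule) (fun x1 =>
       RInt (V := C_R_CompleteNormedModule) (fun x2 =>
         Cmult (cis (- dotk k1 k2 x1 x2)) (RtoC (f x1 x2)))
       (- PI) PI) (- PI) PI).

(* (-Delta)^{-1} f.  For real f the k and -k terms are conjugate, so the square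
   partial sums are real and [Re] discards nothing; for smooth f the series
   converges absolutely, so the order of summation is immaterial. *)
Definition inv_laplacian (f : R -> R -> R) (x1 x2 : R) : R :=
  real (Lim_seq (fun N => Re (box_sum (G := C_AbelianMonoid)
    (omit0 (G := C_AbelianMonoid) (fun k1 k2 =>
       Cmult (RtoC (/ normk2 k1 k2))
         (Cmult (fourier f k1 k2) (cis (dotk k1 k2 x1 x2))))) N))).

Definition Rbar_sqrt (x : Rbar) : Rbar :=
  match x with
  | Finite r => Finite (sqrt r)
  | p_infty => p_infty
  | m_infty => Finite 0
  end.

(* The partial sums in both norms are nondecreasing, so [Lim_seq] is their sum
   in [0, +oo].  Since |k|^{2s} = (|k|^2)^s, the exponent below is s. *)
Definition Hdot_norm (s : R) (f : R -> R -> R) : Rbar :=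
  Rbar_sqrt (Lim_seq (fun N => (2 * PI) ^ 2 *
    box_sum (omit0 (fun k1 k2 =>
      Rpower (normk2 k1 k2) s * Cmod (fourier f k1 k2) ^ 2)) N)).

Definition H_norm (s : R) (f : R -> R -> R) : Rbar :=
  Rbar_sqrt (Lim_seq (fun N => (2 * PI) ^ 2 *
    box_sum (fun k1 k2 =>
      Rpower (1 + normk2 k1 k2) s * Cmod (fourier f k1 k2) ^ 2) N)).

Definition sub2 (f g : R -> R -> R) : R -> R -> R :=
  fun x1 x2 => f x1 x2 - g x1 x2.

(** * The IPM equation *)

(* u = nabla^perp (-Delta)^{-1} d1 rho, with nabla^perp = (- d2, d1). *)
Definition velocity1 (rho : R -> R -> R) : R -> R -> R :=
  fun x1 x2 => - d2 (inv_laplacian (d1 rho)) x1 x2.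
Definition velocity2 (rho : R -> R -> R) : R -> R -> R :=
  d1 (inv_laplacian (d1 rho)).

(* [rho t x1 x2] and its spatial derivatives of order at most n exist and are
   jointly continuous on [0, +oo) x R^2. *)
Fixpoint Cn_time (n : nat) (rho : R -> R -> R -> R) : Prop :=
  (forall t x1 x2, 0 <= t ->
     filterlim (fun p : R * (R * R) => rho (fst p) (fst (snd p)) (snd (snd p)))
       (within (fun p => 0 <= fst p) (locally (t, (x1, x2))))
       (locally (rho t x1 x2))) /\
  match n with
  | O => True
  | S m => (forall t, 0 <= t -> has_partials (rho t)) /\
           Cn_time m (fun t => d1 (rho t)) /\ Cn_time m (fun t => d2 (rho t))
  end.

(* Solution in the class C([0, +oo); C^oo(T^2)).  Smoothness in time follows
   from the equation, which also extends by continuity to t = 0 with a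
   one-sided time derivative.  Values at t < 0 are unconstrained. *)
Definition global_smooth_IPM_solution
    (rho0 : R -> R -> R) (rho : R -> R -> R -> R) : Prop :=
  (forall t, 0 <= t -> periodic (rho t)) /\
  (forall n, Cn_time n rho) /\
  (forall x1 x2, rho 0 x1 x2 = rho0 x1 x2) /\
  (forall t x1 x2, 0 < t ->
     is_derive (fun tau => rho tau x1 x2) t
       (- (velocity1 (rho t) x1 x2 * d1 (rho t) x1 x2 +
           velocity2 (rho t) x1 x2 * d2 (rho t) x1 x2))).

Definition stratified (f : R -> R -> R) : Prop :=
  exists g : R -> R, forall x1 x2, f x1 x2 = g x2.

Definition odd_x2 (f : R -> R -> R) : Prop :=
  forall x1 x2, f x1 (- x2) = - f x1 x2.

(** * Upper limit as t -> +oo *)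

Definition limsup_infty (F : R -> Rbar) : Rbar :=
  Rbar_glb (fun y => exists T : R,
    y = Rbar_lub (fun z => exists t : R, T <= t /\ z = F t)).

(* Main.v *)
(** Perturb [rho_s] by a small multiple of [(1 + cos x1) sin x2], with the sign
that raises its maximum strictly above [M = max rho_s].  The perturbed datum is
even in [x1] and odd in [x2]; uniqueness propagates both symmetries, so the
lines [x1 = PI] and [x2 = +-PI] stay invariant.

The datum equals [rho_s <= M] on [x1 = PI], and this bound persists there, while
the integral of the square of the positive part [(rho - M)_+] over the torus is
conserved and positive.  Integrating horizontally from [x1 = PI] hence bounds the
L^2 norm of [d1 rho] below by a constant, for all time.

The potential energy, the integral of [x2 rho], is bounded and decreases at rate
[delta], the squared H^{-1} norm of [d1 rho].  For every [r > 0],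
[||d1 rho||^2 <= r delta + r^{-s} ||d1 rho||_{H^s}^2], where [d1 rho] is also
[d1 (rho - rho_s)].  If the H^{s+1} norm of [rho - rho_s] were [O(t^{s/2})],
taking [r] a large multiple of [t] would give [delta >= c / t], which is not
integrable.  All Sobolev norms here are homogeneous. *)

From Stdlib Require Import Lra Lia Classical ClassicalEpsilon FunctionalExtensionality.
Require Import Defs.

(** The two symmetries do separate jobs. Evenness in x1 removes the normal velocity on x1 = PI,
    where the factor 1 + cos x1 of the perturbation vanishes. Oddness in x2 is there for the
    potential energy: its weight x2 is not periodic, and the flux through x2 = +-PI must vanish for
    the decay identity to hold. The positive part is squared because the transport identities ask
    for a C^1 function of the density.

    In the interpolation, r is a cut-off on |k|^2: low frequencies are paid by the dissipation, high
    ones by the Sobolev norm. With r proportional to t the powers of t cancel in the second term,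
    which is the origin of the exponent s/2.

    The analytic burden is the stream function, given by a lattice series. It rests on one estimate:
    the coefficients of a smooth function are at most K / ((1 + k1^2)(1 + k2^2)), so square partial
    sums converge at rate 1/(N + 1), uniformly in space, with a constant continuous in time. This
    rate yields joint continuity, termwise differentiation and Parseval identities; Fejer's theorem
    identifies the limit of a Fourier series. *)

Definition cont1 (f : R -> R) : Prop := forall x, continuous f x.
Definition cont2 (f : R -> R -> R) : Prop :=
  forall p : R * R, continuous (fun q : R * R => f (fst q) (snd q)) p.
Definition cont3 (f : R -> R -> R -> R) : Prop :=
  forall p : R * (R * R),
    continuous (fun q : R * (R * R) => f (fst q) (fst (snd q)) (snd (snd q))) p.

Definition I1 (f : R -> R) : R := RInt f (- PI) PI.
Definition I2 (f : R -> R -> R) : R := I1 (fun x1 => I1 (fun x2 => f x1 x2)).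

Lemma PI_pos : 0 < PI. Proof. exact PI_RGT_0. Qed.

(** * Continuity and compactness *)

Section Continuity.
Context {U : UniformSpace}.
Implicit Types (a b c : U -> R) (u : U).

Lemma cont_plus a b u :
  continuous a u -> continuous b u -> continuous (fun v => a v + b v) u.
Proof. exact (continuous_plus (V := R_NormedModule) a b u). Qed.

Lemma cont_opp a u : continuous a u -> continuous (fun v => - a v) u.
Proof. exact (continuous_opp (V := R_NormedModule) a u). Qed.

Lemma cont_minus a b u :
  continuous a u -> continuous b u -> continuous (fun v => a v - b v) u.
Proof. exact (continuous_minus (V := R_NormedModule) a b u). Qed.

Lemma cont_mult a b u :
  continuous a u -> continuous b u -> continuous (fun v => a v * b v) u.
Proof. exact (continuous_mult (K := R_AbsRing) a b u). Qed.

Lemma cont_app1 f a u : cont1 f -> continuous a u -> continuous (fun v => f (a v)) u.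
Proof. intros Hf Ha. apply continuous_comp; [exact Ha | apply Hf]. Qed.

Lemma cont_pow a n u : continuous a u -> continuous (fun v => a v ^ n) u.
Proof.
  intros Ha; induction n as [|n IH]; simpl.
  - apply continuous_const.
  - apply cont_mult; assumption.
Qed.

Lemma cont_app2 f a b u :
  cont2 f -> continuous a u -> continuous b u -> continuous (fun v => f (a v) (b v)) u.
Proof. intros Hf Ha Hb. apply continuous_comp_2; auto. Qed.

Lemma cont_app3 f a b c u :
  cont3 f -> continuous a u -> continuous b u -> continuous c u ->
  continuous (fun v => f (a v) (b v) (c v)) u.
Proof.
  intros Hf Ha Hb Hc.
  apply (continuous_comp_2 a (fun v => (b v, c v))
    (fun t q => f t (fst q) (snd q)) u Ha).
  - apply (continuous_comp_2 b c (fun x y => (x, y)) u Hb Hc).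
    apply continuous_ext with (fun z : R * R => z); [now intros []|].
    apply continuous_id.
  - apply (Hf (a u, (b u, c u))).
Qed.

(** The tube lemma for the compact interval [[lo, hi]]; carrying the constant [K] along makes it
    yield local boundedness as well as uniform smallness. *)
Lemma tube_bound (P : R -> U -> R -> Prop) (u0 : U) (lo hi : R) :
  (forall K K' u y, K <= K' -> P K u y -> P K' u y) ->
  (forall y, lo <= y <= hi -> exists K,
     locally (u0, y) (fun p : U * R => P K (fst p) (snd p))) ->
  exists K, locally u0 (fun u => forall y, lo <= y <= hi -> P K u y).
Proof.
  intros mono H.
  assert (H' : forall y, exists dK : posreal * R, lo <= y <= hi ->
     forall p : U * R, ball (u0, y) (fst dK) p -> P (snd dK) (fst p) (snd p)).
  { intros y. destruct (classic (lo <= y <= hi)) as [Hy|Hy].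
    - destruct (H y Hy) as [K [d Hd]]. exists (d, K); intros _ p Hp; exact (Hd p Hp).
    - exists (mkposreal 1 Rlt_0_1, 0); tauto. }
  set (dK := fun y => proj1_sig (constructive_indefinite_description _ (H' y))).
  assert (HdK : forall y, lo <= y <= hi -> forall p : U * R,
     ball (u0, y) (fst (dK y)) p -> P (snd (dK y)) (fst p) (snd p)).
  { intros y. unfold dK. destruct (constructive_indefinite_description _ (H' y)) as [z Hz].
    exact Hz. }
  (* The gauge includes [/ (1 + |K|)], so a positive lower bound [d] on it controls both the radius,
     from below, and the constant [K], from above by [/ d]. *)
  assert (pos : forall y, 0 < Rmin (fst (dK y)) (/ (1 + Rabs (snd (dK y))))).
  { intros y. apply Rmin_glb_lt; [apply cond_pos|].
    apply Rinv_0_lt_compat. pose proof (Rabs_pos (snd (dK y))). lra. }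
  destruct (compactness_value_1d lo hi (fun y => mkposreal _ (pos y))) as [d Hd].
  exists (/ d), d. intros u Hu y Hy.
  apply NNPP; intros nP. apply (Hd y Hy). intros [t [Ht [Hyt Hdt]]]. apply nP.
  simpl in Hyt, Hdt.
  pose proof (Rmin_l (fst (dK t)) (/ (1 + Rabs (snd (dK t))))) as m1.
  pose proof (Rmin_r (fst (dK t)) (/ (1 + Rabs (snd (dK t))))) as m2.
  apply mono with (snd (dK t)).
  - pose proof (Rabs_pos (snd (dK t))) as p0. pose proof (Rle_abs (snd (dK t))) as p1.
    assert (/ (/ (1 + Rabs (snd (dK t)))) <= / d).
    { apply Rinv_le_contravar; [apply cond_pos | lra]. }
    rewrite Rinv_inv in H0. lra.
  - apply (HdK t Ht (u, y)). split; simpl.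
    + apply ball_le with d; [lra | exact Hu].
    + unfold ball; simpl; unfold AbsRing_ball, abs, minus, plus, opp; simpl.
      apply Rlt_le_trans with (2 := m1). exact Hyt.
Qed.

Lemma tube (P : U -> R -> Prop) (u0 : U) (lo hi : R) :
  (forall y, lo <= y <= hi -> locally (u0, y) (fun p : U * R => P (fst p) (snd p))) ->
  locally u0 (fun u => forall y, lo <= y <= hi -> P u y).
Proof.
  intros H. destruct (tube_bound (fun _ => P) u0 lo hi) as [_ H0]; auto.
  intros y Hy; exists 0; auto.
Qed.
End Continuity.

Lemma cont1_cos : cont1 cos. Proof. intros x; apply continuous_cos. Qed.
Lemma cont1_sin : cont1 sin. Proof. intros x; apply continuous_sin. Qed.
Lemma cont1_abs : cont1 Rabs. Proof. intros x; apply continuous_Rabs. Qed.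

Lemma continuous_lt {U : UniformSpace} (f : U -> R) (u : U) (eps : R) :
  continuous f u -> 0 < eps -> locally u (fun v => Rabs (f v - f u) < eps).
Proof.
  intros Hf He. exact (proj1 (filterlim_locally f (f u)) Hf (mkposreal eps He)).
Qed.

Lemma le_of_close a b e : Rabs (a - b) < e -> a <= b + e.
Proof. intros H; apply Rabs_def2 in H; lra. Qed.

Ltac cont_step :=
  match goal with
  | |- continuous (fun _ => ?c) _ => apply continuous_const
  | |- continuous (fun u => u) _ => apply continuous_id
  | |- continuous (fun u => fst (@?a u)) _ =>
      apply (continuous_comp a fst); [| apply continuous_fst]
  | |- continuous (fun u => snd (@?a u)) _ =>
      apply (continuous_comp a snd); [| apply continuous_snd]
  | |- continuous (fun u => @?a u + @?b u) _ => apply (cont_plus a b)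
  | |- continuous (fun u => @?a u - @?b u) _ => apply (cont_minus a b)
  | |- continuous (fun u => @?a u / ?b) _ => apply (cont_mult a (fun _ => / b))
  | |- continuous (fun u => @?a u * @?b u) _ => apply (cont_mult a b)
  | |- continuous (fun u => - @?a u) _ => apply (cont_opp a)
  | |- continuous (fun u => @?a u ^ ?n) _ => apply (cont_pow a n)
  | |- continuous (fun u => cos (@?a u)) _ => apply (cont_app1 cos a _ cont1_cos)
  | |- continuous (fun u => sin (@?a u)) _ => apply (cont_app1 sin a _ cont1_sin)
  | |- continuous (fun u => Rabs (@?a u)) _ => apply (cont_app1 Rabs a _ cont1_abs)
  | H : cont3 ?f |- continuous (fun u => ?f (@?a u) (@?b u) (@?c u)) _ =>
      apply (cont_app3 f a b c _ H)
  | H : cont2 ?f |- continuous (fun u => ?f (@?a u) (@?b u)) _ =>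
      apply (cont_app2 f a b _ H)
  | H : cont2 (?f ?t) |- continuous (fun u => ?f ?t (@?a u) (@?b u)) _ =>
      apply (cont_app2 (f t) a b _ H)
  | H : cont1 ?f |- continuous (fun u => ?f (@?a u)) _ => apply (cont_app1 f a _ H)
  | H : cont2 ?f |- continuous (fun u => ?f ?t (@?a u)) _ =>
      apply (cont_app2 f (fun _ => t) a _ H)
  | H : cont3 ?f |- continuous (?f ?t ?x) _ =>
      apply (cont_app3 f (fun _ => t) (fun _ => x) (fun z => z) _ H)
  | H : cont2 ?f |- continuous (?f ?x) _ =>
      apply (cont_app2 f (fun _ => x) (fun z => z) _ H)
  | H : cont1 ?f |- continuous ?f ?x => apply H
  end.
Ltac cont := intros; unfold Rsqr; cbv beta; repeat (cont_step; cbv beta); auto.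

Lemma cont3_cont2 f t : cont3 f -> cont2 (f t).
Proof. intros H p. cont. Qed.

Lemma cont2_continuity f : cont2 f <-> forall x1 x2, continuity_2d_pt f x1 x2.
Proof.
  split.
  - intros H x1 x2. apply continuity_2d_pt_filterlim. exact (H (x1, x2)).
  - intros H [x1 x2]. apply (proj1 (continuity_2d_pt_filterlim f x1 x2)). apply H.
Qed.

Lemma bounded_on_box f (T : R) : cont3 f ->
  exists K, forall t x1 x2, - T <= t <= T -> - PI <= x1 <= PI -> - PI <= x2 <= PI ->
    Rabs (f t x1 x2) <= K.
Proof.
  intros Hf.
  assert (S1 : forall t x1, exists K, locally (t, x1) (fun p : R * R =>
     forall x2, - PI <= x2 <= PI -> Rabs (f (fst p) (snd p) x2) <= K)).
  { intros t x1.
    apply (tube_bound (fun K (p : R * R) y => Rabs (f (fst p) (snd p) y) <= K)).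
    - intros; lra.
    - intros y _. exists (Rabs (f t x1 y) + 1).
      assert (C : continuous (fun p : R * R * R =>
         Rabs (f (fst (fst p)) (snd (fst p)) (snd p))) ((t, x1), y)) by cont.
      generalize (continuous_lt _ _ 1 C Rlt_0_1).
      apply filter_imp. intros p Hp. apply (le_of_close _ _ _ Hp). }
  assert (S2 : forall t, exists K, locally t (fun t' : R =>
     forall x1, - PI <= x1 <= PI ->
     forall x2, - PI <= x2 <= PI -> Rabs (f t' x1 x2) <= K)).
  { intros t.
    apply (tube_bound (fun K (t' : R) y =>
      forall x2, - PI <= x2 <= PI -> Rabs (f t' y x2) <= K)).
    - intros K K' t' y HK H x2 Hx2. specialize (H x2 Hx2). lra.
    - intros y _. apply S1. }
  (* Third use of compactness, one for each variable; here the parameter is a dummy, evaluated at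
     [0]. *)
  destruct (tube_bound (fun K (_ : R) t => forall x1, - PI <= x1 <= PI ->
     forall x2, - PI <= x2 <= PI -> Rabs (f t x1 x2) <= K) 0 (- T) T) as [K HK].
  - intros K K' t' y HK H x1 Hx1 x2 Hx2. specialize (H x1 Hx1 x2 Hx2). lra.
  - intros t _. destruct (S2 t) as [K HK]. exists K.
    destruct HK as [d Hd]. exists d. intros [z t'] [_ Ht']. simpl in *. apply Hd. exact Ht'.
  - exists K. apply locally_singleton in HK. intros t x1 x2 Ht Hx1 Hx2. now apply HK.
Qed.

(** * Integrals over the period *)

Lemma cont1_ex f a b : cont1 f -> ex_RInt f a b.
Proof. intros Hf. apply (ex_RInt_continuous (V := R_CompleteNormedModule)). intros; apply Hf. Qed.

Lemma pi_le : - PI <= PI. Proof. pose proof PI_pos; lra. Qed.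

Lemma I1_ext f g : (forall x, f x = g x) -> I1 f = I1 g.
Proof. intros H. apply RInt_ext. intros; apply H. Qed.

Lemma I1_plus f g : cont1 f -> cont1 g -> I1 (fun x => f x + g x) = I1 f + I1 g.
Proof. intros; apply (RInt_plus (V := R_CompleteNormedModule) f g); now apply cont1_ex. Qed.

Lemma I1_minus f g : cont1 f -> cont1 g -> I1 (fun x => f x - g x) = I1 f - I1 g.
Proof. intros; apply (RInt_minus (V := R_CompleteNormedModule) f g); now apply cont1_ex. Qed.

Lemma I1_scal k f : cont1 f -> I1 (fun x => k * f x) = k * I1 f.
Proof. intros; apply (RInt_scal (V := R_CompleteNormedModule) f); now apply cont1_ex. Qed.

Lemma I1_const k : I1 (fun _ => k) = 2 * PI * k.
Proof.
  unfold I1. rewrite RInt_const. unfold scal; simpl; unfold mult; simpl. ring.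
Qed.

Lemma I1_le f g : cont1 f -> cont1 g -> (forall x, - PI <= x <= PI -> f x <= g x) -> I1 f <= I1 g.
Proof.
  intros Hf Hg H. apply RInt_le; [apply pi_le | now apply cont1_ex | now apply cont1_ex |].
  intros; apply H; lra.
Qed.

Lemma I1_abs_le f K : cont1 f -> (forall x, - PI <= x <= PI -> Rabs (f x) <= K) ->
  Rabs (I1 f) <= 2 * PI * K.
Proof.
  intros Hf H. replace (2 * PI) with (PI - - PI) by ring.
  apply abs_RInt_le_const; [apply pi_le | now apply cont1_ex | exact H].
Qed.

(** Parameters range over any uniform space, so the lemma iterates: it serves inner and outer
    integrals, with or without time. *)
Lemma cont_I1 {U : UniformSpace} (F : U -> R -> R) (u : U) :
  (forall p : U * R, continuous (fun q : U * R => F (fst q) (snd q)) p) ->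
  continuous (fun v => I1 (fun y => F v y)) u.
Proof.
  intros HF. apply filterlim_locally. intros eps. pose proof PI_pos as HP.
  assert (cF : forall v, cont1 (F v)).
  { intros v y. apply (continuous_comp_2 (fun _ : R => v) (fun z : R => z) F y).
    apply continuous_const. apply continuous_id. apply HF. }
  assert (he : 0 < eps / (4 * PI)) by (apply Rdiv_lt_0_compat; [apply cond_pos | lra]).
  assert (H : locally u (fun v => forall y, - PI <= y <= PI ->
     Rabs (F v y - F u y) < eps / (4 * PI))).
  { apply tube. intros y _.
    assert (C : continuous (fun p : U * R => F (fst p) (snd p) - F u (snd p)) (u, y)).
    { apply cont_minus. apply HF. apply (cont_app1 (F u)); [apply cF | apply continuous_snd]. }
    generalize (continuous_lt _ _ _ C he).
    apply filter_imp. intros p Hp. simpl in Hp.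
    rewrite (Rminus_diag_eq (F u y) (F u y) eq_refl), Rminus_0_r in Hp. exact Hp. }
  revert H. apply filter_imp. intros v Hv.
  change (Rabs (I1 (F v) - I1 (F u)) < eps).
  rewrite <- I1_minus by auto.
  apply Rle_lt_trans with (2 * PI * (eps / (4 * PI))).
  - apply I1_abs_le; [intros y; apply cont_minus; apply cF |].
    intros y Hy. left; now apply Hv.
  - field_simplify; [|lra]. pose proof (cond_pos eps). lra.
Qed.

Ltac cont_step2 :=
  match goal with
  | |- continuous (fun u => I1 (fun y => @?F u y)) _ => apply (cont_I1 F)
  | |- continuous (fun u => I1 (@?F u)) _ => apply (cont_I1 F)
  | |- forall _, continuous _ _ => intro
  end.
Ltac cont ::= intros; unfold Rsqr, I2; cbv beta;
  repeat (first [cont_step | cont_step2]; cbv beta); auto.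
Ltac solve_cont := match goal with
  | |- cont1 _ => intros ?; cont
  | |- cont2 _ => intros ?; cont
  | |- cont3 _ => intros ?; cont
  | |- continuous _ _ => cont
  end.

Lemma cont2_row f x : cont2 f -> cont1 (f x).
Proof. intros H; solve_cont. Qed.

Lemma I2_ext f g : (forall x y, f x y = g x y) -> I2 f = I2 g.
Proof. intros H. apply I1_ext; intros; apply I1_ext; intros; apply H. Qed.

Lemma I2_plus f g : cont2 f -> cont2 g -> I2 (fun x y => f x y + g x y) = I2 f + I2 g.
Proof.
  intros Hf Hg. unfold I2. rewrite <- I1_plus; try solve_cont.
  apply I1_ext; intros x. apply I1_plus; solve_cont.
Qed.

Lemma I2_minus f g : cont2 f -> cont2 g -> I2 (fun x y => f x y - g x y) = I2 f - I2 g.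
Proof.
  intros Hf Hg. unfold I2. rewrite <- I1_minus; try solve_cont.
  apply I1_ext; intros x. apply I1_minus; solve_cont.
Qed.

Lemma I2_scal k f : cont2 f -> I2 (fun x y => k * f x y) = k * I2 f.
Proof.
  intros Hf. unfold I2. rewrite <- I1_scal; try solve_cont.
  apply I1_ext; intros x. apply I1_scal; solve_cont.
Qed.

Lemma I2_const k : I2 (fun _ _ => k) = (2 * PI) ^ 2 * k.
Proof.
  unfold I2. rewrite (I1_ext _ (fun _ => 2 * PI * k)).
  - rewrite I1_const. ring.
  - intros; apply I1_const.
Qed.

Lemma I2_le f g : cont2 f -> cont2 g ->
  (forall x y, - PI <= x <= PI -> - PI <= y <= PI -> f x y <= g x y) -> I2 f <= I2 g.
Proof.
  intros Hf Hg H. apply I1_le; try solve_cont. intros x Hx. apply I1_le; try solve_cont.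
  intros y Hy; now apply H.
Qed.

Lemma I2_ge0 f : cont2 f -> (forall x y, 0 <= f x y) -> 0 <= I2 f.
Proof.
  intros Hf H. replace 0 with (I2 (fun _ _ => 0)) by (rewrite I2_const; ring).
  apply I2_le; auto. solve_cont.
Qed.

Lemma I2_abs f : cont2 f -> Rabs (I2 f) <= I2 (fun x y => Rabs (f x y)).
Proof.
  intros Hf. apply Rabs_le. split.
  - replace (- I2 (fun x y => Rabs (f x y))) with (I2 (fun x y => - 1 * Rabs (f x y))).
    + apply I2_le; try solve_cont. intros x y _ _. pose proof (Rabs_maj2 (f x y)). lra.
    + rewrite I2_scal by solve_cont. ring.
  - apply I2_le; try solve_cont. intros; apply Rle_abs.
Qed.

(** The primitive of [f] is monotone with equal end values, hence constant, so [f] vanishes inside;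
    the end points follow by continuity. *)
Lemma I1_zero f : cont1 f -> (forall x, 0 <= f x) -> I1 f = 0 ->
  forall x, - PI <= x <= PI -> f x = 0.
Proof.
  intros Hf H0 HI.
  set (F := fun x => RInt f (- PI) x).
  assert (dF : forall x, is_derive F x (f x)).
  { intros x. apply (is_derive_RInt (V := R_NormedModule) f F (- PI)); [|apply Hf].
    apply filter_forall. intros y.
    apply (RInt_correct (V := R_CompleteNormedModule)). now apply cont1_ex. }
  assert (mono : forall a b, a <= b -> F a <= F b).
  { intros a b Hab. destruct (MVT_gen F a b f) as [z [_ Hz]].
    - intros; apply dF.
    - intros. apply derivable_continuous_pt. exists (f x).
      apply is_derive_Reals, dF.
    - specialize (H0 z). nra. }
  assert (F0 : forall x, - PI <= x <= PI -> F x = 0).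
  { intros x Hx. pose proof (mono _ _ (proj1 Hx)) as A. pose proof (mono _ _ (proj2 Hx)) as B.
    change (F PI = 0) in HI.
    assert (F (- PI) = 0) by apply (RInt_point (V := R_CompleteNormedModule)). lra. }
  assert (Z : forall x, - PI < x < PI -> f x = 0).
  { intros x Hx.     rewrite <- (is_derive_unique _ _ _ (dF x)).
    rewrite (Derive_ext_loc F (fun _ => 0)); [apply Derive_const|].
    assert (hd : 0 < Rmin (x + PI) (PI - x)) by (apply Rmin_glb_lt; lra).
    exists (mkposreal _ hd). intros y Hy. apply F0.
    unfold ball in Hy; simpl in Hy; unfold AbsRing_ball, abs, minus, plus, opp in Hy;
      simpl in Hy. apply Rabs_def2 in Hy.
    pose proof (Rmin_l (x + PI) (PI - x)). pose proof (Rmin_r (x + PI) (PI - x)). lra. }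
  intros x Hx. apply NNPP; intros nz.
  assert (hp : 0 < f x) by (specialize (H0 x); lra).
  destruct (continuous_lt _ _ _ (Hf x) hp) as [d Hd].
  (* A step of length [e] inwards from [x] stays within [d] of [x] and lands strictly inside the
     period. *)
  set (e := Rmin (d / 2) (PI / 2)).
  assert (e0 : 0 < e). { apply Rmin_glb_lt; pose proof (cond_pos d); pose proof PI_pos; lra. }
  assert (e1 : e <= d / 2) by apply Rmin_l. assert (e2 : e <= PI / 2) by apply Rmin_r.
  pose proof (cond_pos d) as d0. pose proof PI_pos as HP.
  assert (Hy : exists y, - PI < y < PI /\ Rabs (y - x) < d).
  { destruct (Rle_dec x 0).
    - exists (x + e). split; [lra|]. apply Rabs_def1; lra.
    - exists (x - e). split; [lra|]. apply Rabs_def1; lra. }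
  destruct Hy as [y [Hy1 Hy2]]. specialize (Hd y Hy2). simpl in Hd.
  rewrite (Z y Hy1) in Hd. apply Rabs_def2 in Hd. lra.
Qed.

Lemma I2_zero f : cont2 f -> (forall x y, 0 <= f x y) -> I2 f = 0 ->
  forall x y, - PI <= x <= PI -> - PI <= y <= PI -> f x y = 0.
Proof.
  intros Hf H0 HI x y Hx Hy.
  assert (pos : forall x, 0 <= I1 (fun x2 => f x x2)).
  { intros z. replace 0 with (I1 (fun _ => 0)) by (rewrite I1_const; ring).
    apply I1_le; try solve_cont. intros; apply H0. }
  apply (I1_zero (f x)); [solve_cont | auto | | auto].
  apply (I1_zero (fun x1 => I1 (fun x2 => f x1 x2))); auto. solve_cont.
Qed.

Lemma I1_derive f df : (forall x, is_derive f x (df x)) -> cont1 df ->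
  I1 df = f PI - f (- PI).
Proof.
  intros H1 H2. apply (is_RInt_unique (V := R_CompleteNormedModule)).
  apply (is_RInt_derive (V := R_CompleteNormedModule)); intros; auto.
Qed.

Lemma I1_derive_param (F G : R -> R -> R) (t0 : R) :
  locally t0 (fun t => forall y, is_derive (fun s => F s y) t (G t y)) ->
  (forall y, continuity_2d_pt G t0 y) ->
  (forall t, cont1 (F t)) ->
  is_derive (fun t => I1 (F t)) t0 (I1 (G t0)).
Proof.
  intros HD HG HF. unfold I1.
  rewrite (RInt_ext (G t0) (fun y => Derive (fun s => F s y) t0)).
  2:{ intros y _. symmetry; apply is_derive_unique.
      apply locally_singleton in HD. apply HD. }
  apply is_derive_RInt_param.
  - revert HD; apply filter_imp. intros t Ht y _. eexists; apply Ht.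
  - intros y _. apply continuity_2d_pt_ext_loc with G; [|apply HG].
    destruct HD as [d Hd]. exists d. intros u v Hu _. symmetry; apply is_derive_unique.
    apply Hd. exact Hu.
  - apply filter_forall. intros t. now apply cont1_ex.
Qed.

Lemma I2_derive_param (F G : R -> R -> R -> R) (t0 : R) : 0 < t0 ->
  (forall t x y, 0 < t -> is_derive (fun s => F s x y) t (G t x y)) ->
  cont3 F -> cont3 G -> is_derive (fun t => I2 (F t)) t0 (I2 (G t0)).
Proof.
  intros H0 HD HF HG.
  assert (L : forall t, 0 < t -> locally t (fun s => 0 < s)).
  { intros t Ht. apply (open_gt 0). exact Ht. }
  unfold I2. apply (I1_derive_param (fun t x => I1 (F t x)) (fun t x => I1 (G t x))).
  - generalize (L t0 H0). apply filter_imp. intros t Ht x.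
    apply (I1_derive_param (fun t y => F t x y) (fun t y => G t x y)).
    + generalize (L t Ht). apply filter_imp. intros s Hs y. now apply HD.
    + apply cont2_continuity. solve_cont.
    + intros; solve_cont.
  - apply cont2_continuity. solve_cont.
  - intros; solve_cont.
Qed.

Lemma I2_d2 f : (forall x y, ex_derive (f x) y) -> cont2 (d2 f) ->
  (forall x, f x PI = f x (- PI)) -> I2 (d2 f) = 0.
Proof.
  intros H1 H2 H3. unfold I2. rewrite (I1_ext _ (fun _ => 0)).
  - rewrite I1_const; ring.
  - intros x. rewrite (I1_derive (f x)); [rewrite H3; ring | |solve_cont].
    intros y. apply Derive_correct, H1.
Qed.

(** Unlike for [d2], the derivative is in the outer variable, so the inner integral is
    differentiated under the integral sign. *)
Lemma I2_d1 f : cont2 f -> (forall x y, ex_derive (fun z => f z y) x) -> cont2 (d1 f) ->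
  (forall y, f PI y = f (- PI) y) -> I2 (d1 f) = 0.
Proof.
  intros H0 H1 H2 H3. unfold I2.
  transitivity (I1 (f PI) - I1 (f (- PI))).
  2:{ rewrite (I1_ext (f PI) (f (- PI))) by auto. ring. }
  apply (I1_derive (fun x : R => I1 (f x)) (fun x : R => I1 (d1 f x))).
  - intros x. apply (I1_derive_param f (d1 f)).
    + apply filter_forall. intros t y. apply Derive_correct, H1.
    + now apply cont2_continuity.
    + intros; solve_cont.
  - solve_cont.
Qed.

(** * Symmetric sums over Z *)

(** Raising [N] only appends the terms at [N] and [- N], whereas the shifted indices of [box_sum]
    move every term and obstruct induction. *)
Fixpoint zsum (N : nat) (a : Z -> R) : R :=
  match N with
  | O => a 0%Z
  | S n => zsum n a + (a (Z.of_nat N) + a (- Z.of_nat N)%Z)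
  end.

(** The cut-offs are separate because Fourier inversion sends the first to infinity before the
    second. *)
Definition rect (a : Z -> Z -> R) (N1 N2 : nat) : R := zsum N1 (fun k1 => zsum N2 (a k1)).

Lemma sum_n_zsum (a : Z -> R) N :
  sum_n (G := R_AbelianMonoid) (fun i => a (Z.of_nat i - Z.of_nat N)%Z) (2 * N) = zsum N a.
Proof.
  revert a. induction N as [|N IH]; intros a.
  - simpl. rewrite sum_O. reflexivity.
  - replace (2 * S N)%nat with (S (S (2 * N))) by lia.
    rewrite sum_Sn. unfold sum_n. rewrite sum_Sn_m by lia. rewrite <- sum_n_m_S.
    rewrite (sum_n_m_ext _ (fun i => a (Z.of_nat i - Z.of_nat N)%Z)).
    2:{ intros i. f_equal. lia. }
    specialize (IH a). unfold sum_n in IH. rewrite IH. cbn [zsum].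
    replace (Z.of_nat 0 - Z.of_nat (S N))%Z with (- Z.of_nat (S N))%Z by lia.
    replace (Z.of_nat (S (S (2 * N))) - Z.of_nat (S N))%Z with (Z.of_nat (S N)) by lia.
    change (a (- Z.of_nat (S N))%Z + zsum N a + a (Z.of_nat (S N)) =
      zsum N a + (a (Z.of_nat (S N)) + a (- Z.of_nat (S N))%Z)).
    ring.
Qed.

Lemma zsum_ext N a b : (forall k, a k = b k) -> zsum N a = zsum N b.
Proof. intros H; induction N; simpl; rewrite ?IHN, ?H; reflexivity. Qed.

Lemma box_sum_rect (a : Z -> Z -> R) N :
  box_sum (G := R_AbelianMonoid) a N = rect a N N.
Proof.
  unfold box_sum, rect. rewrite <- sum_n_zsum. apply sum_n_ext. intros i.
  rewrite <- sum_n_zsum. reflexivity.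
Qed.

Lemma Re_sum_n (a : nat -> C) n :
  Re (sum_n (G := C_AbelianMonoid) a n) = sum_n (G := R_AbelianMonoid) (fun i => Re (a i)) n.
Proof.
  induction n as [|n IH]; [rewrite !sum_O | rewrite !sum_Sn, <- IH]; reflexivity.
Qed.

Lemma Re_box_sum (a : Z -> Z -> C) N :
  Re (box_sum (G := C_AbelianMonoid) a N) = rect (fun k1 k2 => Re (a k1 k2)) N N.
Proof.
  rewrite <- box_sum_rect. unfold box_sum. rewrite Re_sum_n.
  apply sum_n_ext; intros i. apply Re_sum_n.
Qed.

Lemma zsum_plus N a b : zsum N (fun k => a k + b k) = zsum N a + zsum N b.
Proof. induction N; simpl; rewrite ?IHN; ring. Qed.

Lemma zsum_minus N a b : zsum N (fun k => a k - b k) = zsum N a - zsum N b.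
Proof. induction N; simpl; rewrite ?IHN; ring. Qed.

Lemma zsum_scal N c a : zsum N (fun k => c * a k) = c * zsum N a.
Proof. induction N; simpl; rewrite ?IHN; ring. Qed.

Lemma zsum_le N a b : (forall k, a k <= b k) -> zsum N a <= zsum N b.
Proof.
  intros H; induction N; simpl; [apply H|].
  pose proof (H (Z.pos (Pos.of_succ_nat N))). pose proof (H (Z.neg (Pos.of_succ_nat N))).
  lra.
Qed.

Lemma zsum_abs_diff N M a b : (forall k, Rabs (a k) <= b k) -> (N <= M)%nat ->
  Rabs (zsum M a - zsum N a) <= zsum M b - zsum N b.
Proof.
  intros H HNM. induction HNM as [|M HNM IH].
  - rewrite !Rminus_diag, Rabs_R0. lra.
  - cbn [zsum].
    pose proof (H (Z.of_nat (S M))) as H1. pose proof (H (- Z.of_nat (S M))%Z) as H2.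
    replace (zsum M a + (a (Z.of_nat (S M)) + a (- Z.of_nat (S M))%Z) - zsum N a)
      with (zsum M a - zsum N a + (a (Z.of_nat (S M)) + a (- Z.of_nat (S M))%Z)) by ring.
    eapply Rle_trans; [apply Rabs_triang|].
    pose proof (Rabs_triang (a (Z.of_nat (S M))) (a (- Z.of_nat (S M))%Z)). lra.
Qed.

Lemma zsum_abs N a b : (forall k, Rabs (a k) <= b k) -> Rabs (zsum N a) <= zsum N b.
Proof.
  intros H. apply Rabs_le. split.
  - replace (- zsum N b) with (-1 * zsum N b) by ring. rewrite <- zsum_scal.
    apply zsum_le. intros k. specialize (H k). apply Rabs_le_between in H. lra.
  - apply zsum_le. intros k. specialize (H k). apply Rabs_le_between in H. lra.
Qed.

Lemma cont_zsum {U : UniformSpace} N (a : Z -> U -> R) u :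
  (forall k, continuous (a k) u) -> continuous (fun v => zsum N (fun k => a k v)) u.
Proof.
  intros H; induction N; simpl; [apply H|].
  apply cont_plus; [exact IHN | apply cont_plus; apply H].
Qed.

Lemma is_derive_zsum N (a da : Z -> R -> R) x :
  (forall k, is_derive (a k) x (da k x)) ->
  is_derive (fun y => zsum N (fun k => a k y)) x (zsum N (fun k => da k x)).
Proof.
  intros H; induction N; simpl; [apply H|].
  apply (is_derive_plus (V := R_NormedModule)); [exact IHN|].
  apply (is_derive_plus (V := R_NormedModule)); apply H.
Qed.

(** * Summable weights *)

Definition wt (k : Z) : R := / (1 + IZR k ^ 2).

Lemma wt_pos k : 0 < wt k.
Proof. apply Rinv_0_lt_compat. nra. Qed.

Lemma wt_le1 k : wt k <= 1.
Proof. rewrite <- Rinv_1. apply Rinv_le_contravar; nra. Qed.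

(** For [m >= 1], [1 / (1 + m^2) <= 2 (1/m - 1/(m+1))], which telescopes; the two signs of the
    frequency double the constant. *)
Lemma zsum_wt_tail N M : (N <= M)%nat -> zsum M wt - zsum N wt <= 4 * (/ INR (S N) - / INR (S M)).
Proof.
  intros H. induction H as [|M H IH]; [lra|].
  cbn [zsum].
  assert (E : wt (Z.of_nat (S M)) <= 2 * (/ INR (S M) - / INR (S (S M)))).
  { unfold wt. rewrite <- INR_IZR_INZ. rewrite (S_INR (S M)).
    assert (1 <= INR (S M)) by (rewrite S_INR; pose proof (pos_INR M); lra).
    set (m := INR (S M)) in *.
    replace (2 * (/ m - / (m + 1))) with (2 * / (m * (m + 1))) by (field; lra).
    apply Rmult_le_reg_r with ((1 + m ^ 2) * (m * (m + 1))); [nra|].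
    replace (/ (1 + m ^ 2) * ((1 + m ^ 2) * (m * (m + 1)))) with (m * (m + 1)) by (field; nra).
    replace (2 * / (m * (m + 1)) * ((1 + m ^ 2) * (m * (m + 1)))) with (2 * (1 + m ^ 2))
      by (field; nra). nra. }
  assert (E' : wt (- Z.of_nat (S M)) = wt (Z.of_nat (S M))).
  { unfold wt. rewrite opp_IZR. f_equal. ring. }
  rewrite E'. lra.
Qed.

Lemma zsum_wt_bound N : 0 <= zsum N wt <= 5.
Proof.
  split.
  - apply Rle_trans with (zsum N (fun _ => 0)).
    + induction N; simpl; lra.
    + apply zsum_le; intros; left; apply wt_pos.
  - pose proof (zsum_wt_tail 0 N (Nat.le_0_l N)) as H. cbn [zsum] in H.
    assert (wt 0 = 1) by (unfold wt; simpl; field).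
    assert (0 < / INR (S N)) by (apply Rinv_0_lt_compat, lt_0_INR; lia).
    replace (INR 1) with 1 in H by reflexivity. lra.
Qed.

Definition decay (K : R) (a : Z -> Z -> R) : Prop :=
  forall k1 k2, Rabs (a k1 k2) <= K * (wt k1 * wt k2).

(** The new frequencies form two strips, one beyond each cut-off. Each costs a tail of weights, at
    most [4 / (N + 1)], times a full sum of weights, at most [5]; hence the constant [20]. *)
Lemma rect_tail K a N1 N2 M1 M2 : 0 <= K -> decay K a -> (N1 <= M1)%nat -> (N2 <= M2)%nat ->
  Rabs (rect a M1 M2 - rect a N1 N2) <= 20 * K * (/ INR (S N1) + / INR (S N2)).
Proof.
  intros HK Ha H1 H2. unfold rect.
  assert (ip : forall n, 0 < / INR (S n)) by (intros; apply Rinv_0_lt_compat, lt_0_INR; lia).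
  assert (row : forall k, Rabs (zsum M2 (a k)) <= (K * zsum M2 wt) * wt k).
  { intros k. replace (K * zsum M2 wt * wt k) with (K * wt k * zsum M2 wt) by ring.
    rewrite <- zsum_scal.
    apply zsum_abs. intros k2. eapply Rle_trans; [apply Ha|]. right; ring. }
  assert (row2 : forall k, Rabs (zsum M2 (a k) - zsum N2 (a k)) <=
     (K * (4 * / INR (S N2))) * wt k).
  { intros k. eapply Rle_trans.
    apply (zsum_abs_diff _ _ _ (fun k2 => (K * wt k) * wt k2)); auto.
    { intros k2. eapply Rle_trans; [apply Ha|]. right; ring. }
    rewrite !zsum_scal.
    pose proof (zsum_wt_tail _ _ H2). specialize (ip M2). pose proof (wt_pos k).
    replace (K * wt k * zsum M2 wt - K * wt k * zsum N2 wt)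
      with (K * wt k * (zsum M2 wt - zsum N2 wt)) by ring.
    replace (K * (4 * / INR (S N2)) * wt k) with (K * wt k * (4 * / INR (S N2))) by ring.
    apply Rmult_le_compat_l; [apply Rmult_le_pos; lra | lra]. }
  replace (zsum M1 (fun k1 => zsum M2 (a k1)) - zsum N1 (fun k1 => zsum N2 (a k1)))
    with (zsum M1 (fun k1 => zsum M2 (a k1)) - zsum N1 (fun k1 => zsum M2 (a k1)) +
          zsum N1 (fun k1 => zsum M2 (a k1) - zsum N2 (a k1))) by (rewrite zsum_minus; ring).
  eapply Rle_trans; [apply Rabs_triang|].
  replace (20 * K * (/ INR (S N1) + / INR (S N2)))
    with (20 * K * / INR (S N1) + 20 * K * / INR (S N2)) by ring.
  apply Rplus_le_compat.
  - eapply Rle_trans. apply (zsum_abs_diff _ _ _ _ row H1).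
    rewrite !zsum_scal. rewrite <- Rmult_minus_distr_l.
    pose proof (zsum_wt_tail _ _ H1). specialize (ip M1) as ip1. specialize (ip N1).
    pose proof (zsum_wt_bound M2).
    apply Rle_trans with (K * zsum M2 wt * (4 * / INR (S N1))).
    + apply Rmult_le_compat_l; [apply Rmult_le_pos; lra | lra].
    + replace (20 * K * / INR (S N1)) with (K * 5 * (4 * / INR (S N1))) by ring.
      apply Rmult_le_compat_r; [lra|]. apply Rmult_le_compat_l; lra.
  - eapply Rle_trans. apply (zsum_abs _ _ _ row2). rewrite zsum_scal.
    replace (20 * K * / INR (S N2)) with (K * (4 * / INR (S N2)) * 5) by ring.
    pose proof (zsum_wt_bound N1). specialize (ip N2).
    apply Rmult_le_compat_l; [apply Rmult_le_pos; lra | lra].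
Qed.

Lemma inv_INR_small e : 0 < e -> exists N, forall n, (N <= n)%nat -> / INR (S n) < e.
Proof.
  intros He. destruct (nfloor_ex (/ e)) as [N [_ HN]].
  { left; now apply Rinv_0_lt_compat. }
  exists N. intros n Hn. rewrite <- (Rinv_inv e). apply Rinv_lt_contravar.
  - apply Rmult_lt_0_compat; [now apply Rinv_0_lt_compat | apply lt_0_INR; lia].
  - apply Rlt_le_trans with (1 := HN). rewrite S_INR. apply Rplus_le_compat_r, le_INR, Hn.
Qed.

Lemma lim_of_rate (u : nat -> R) (l K : R) :
  (forall n, Rabs (u n - l) <= K * / INR (S n)) -> is_lim_seq u l.
Proof.
  intros H. apply is_lim_seq_spec. intros eps.
  destruct (inv_INR_small (eps / (Rabs K + 1))) as [N HN].
  { apply Rdiv_lt_0_compat; [apply cond_pos | pose proof (Rabs_pos K); lra]. }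
  exists N. intros n Hn. specialize (HN n Hn). specialize (H n).
  pose proof (Rabs_pos K). pose proof (Rle_abs K).
  assert (0 < / INR (S n)) by (apply Rinv_0_lt_compat, lt_0_INR; lia).
  apply Rle_lt_trans with (1 := H).
  apply Rle_lt_trans with ((Rabs K + 1) * / INR (S n)); [nra|].
  apply Rlt_le_trans with ((Rabs K + 1) * (eps / (Rabs K + 1))).
  - apply Rmult_lt_compat_l; lra.
  - right; field; lra.
Qed.

Definition Ssum (a : Z -> Z -> R) : R := real (Lim_seq (fun N => rect a N N)).

Lemma Ssum_spec K a : 0 <= K -> decay K a ->
  is_lim_seq (fun N => rect a N N) (Ssum a) /\
  forall N, Rabs (Ssum a - rect a N N) <= 40 * K * / INR (S N).
Proof.
  intros HK Ha.
  assert (T : forall N M, (N <= M)%nat -> Rabs (rect a M M - rect a N N) <= 40 * K * / INR (S N)).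
  { intros N M H. eapply Rle_trans; [apply (rect_tail K) ; eauto|]. right; ring. }
  assert (E : ex_finite_lim_seq (fun N => rect a N N)).
  { apply ex_lim_seq_cauchy_corr. intros eps.
    destruct (inv_INR_small (eps / (80 * K + 1))) as [N HN].
    (* Two tails of size [40 K / (N + 1)] are compared; the [+ 1] keeps the denominator positive
       when [K = 0]. *)
    { apply Rdiv_lt_0_compat; [apply cond_pos | lra]. }
    exists N. intros n m Hn Hm. specialize (HN N (Nat.le_refl N)).
    pose proof (T N n Hn) as T1. pose proof (T N m Hm) as T2.
    replace (rect a n n - rect a m m)
      with ((rect a n n - rect a N N) - (rect a m m - rect a N N)) by ring.
    eapply Rle_lt_trans; [apply Rabs_triang|]. rewrite Rabs_Ropp.
    assert (0 < / INR (S N)) by (apply Rinv_0_lt_compat, lt_0_INR; lia).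
    apply Rle_lt_trans with ((80 * K + 1) * / INR (S N)); [nra|].
    apply Rlt_le_trans with ((80 * K + 1) * (eps / (80 * K + 1))).
    - apply Rmult_lt_compat_l; lra.
    - right; field; lra. }
  destruct E as [l Hl].
  assert (L : Ssum a = l) by (unfold Ssum; now rewrite (is_lim_seq_unique _ _ Hl)).
  rewrite L. split; [exact Hl|]. intros N.
  (* The tail bound is uniform in the larger cut-off, so it survives the limit in [M]. *)
  assert (H : is_lim_seq (fun M => Rabs (rect a (M + N) (M + N) - rect a N N))
     (Rabs (l - rect a N N))).
  { apply (is_lim_seq_abs _ (Finite (l - rect a N N))). apply is_lim_seq_minus'.
    - apply (is_lim_seq_incr_n (fun M => rect a M M) N). exact Hl.
    - apply is_lim_seq_const. }
  apply (is_lim_seq_le (fun M => Rabs (rect a (M + N) (M + N) - rect a N N))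
    (fun _ => 40 * K * / INR (S N)) (Finite _) (Finite _)).
  - intros M. apply T. lia.
  - exact H.
  - apply is_lim_seq_const.
Qed.

(** * Smooth families of periodic functions *)

Definition D1 (f : R -> R -> R -> R) (t : R) := d1 (f t).
Definition D2 (f : R -> R -> R -> R) (t : R) := d2 (f t).

(** Continuity is asked for all real times, which spares later arguments the one-sided limits at
    [t = 0]. In time only continuity is required, and a function of space alone enters as a constant
    family. *)
Fixpoint Cn_family (n : nat) (f : R -> R -> R -> R) : Prop :=
  cont3 f /\
  match n with
  | O => True
  | S m => (forall t, has_partials (f t)) /\ Cn_family m (D1 f) /\ Cn_family m (D2 f)
  end.

Definition smooth_family (f : R -> R -> R -> R) : Prop :=
  (forall t, periodic (f t)) /\ forall n, Cn_family n f.

Definition flin (c : R) (f g : R -> R -> R -> R) : R -> R -> R -> R :=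
  fun t x y => f t x y + c * g t x y.

Lemma smooth_family_cont3 f : smooth_family f -> cont3 f.
Proof. intros [_ H]. apply (H O). Qed.

Lemma smooth_family_cont2 f t : smooth_family f -> cont2 (f t).
Proof. intros H. apply cont3_cont2, smooth_family_cont3, H. Qed.

Lemma smooth_family_partials f t : smooth_family f -> has_partials (f t).
Proof. intros [_ H]. apply (H 1%nat). Qed.

Lemma Derive_shift (g : R -> R) c x :
  (forall y, g (y + c) = g y) -> ex_derive g (x + c) -> Derive g (x + c) = Derive g x.
Proof.
  intros Hg E. transitivity (Derive (fun y => g (y + c)) x).
  - symmetry. apply is_derive_unique.
    evar_last.
    + apply (is_derive_comp g (fun y => y + c)); [apply Derive_correct, E|].
      auto_derive; auto.
    + unfold scal; simpl; unfold mult; simpl. ring.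
  - apply Derive_ext, Hg.
Qed.

Lemma smooth_family_D1 f : smooth_family f -> smooth_family (D1 f).
Proof.
  intros [Hp H]. split.
  - intros t x1 x2. split; unfold D1, d1.
    + apply (Derive_shift (fun y => f t y x2) (2 * PI) x1);
        [intros y; exact (proj1 (Hp t y x2)) |
         exact (proj1 (proj1 (proj2 (H 1%nat)) t (x1 + 2 * PI) x2))].
    + apply Derive_ext. intros y; exact (proj2 (Hp t y x2)).
  - intros n. apply (H (S n)).
Qed.

Lemma smooth_family_D2 f : smooth_family f -> smooth_family (D2 f).
Proof.
  intros [Hp H]. split.
  - intros t x1 x2. split; unfold D2, d2.
    + apply Derive_ext. intros y; exact (proj1 (Hp t x1 y)).
    + apply (Derive_shift (fun y => f t x1 y) (2 * PI) x2);
        [intros y; exact (proj2 (Hp t x1 y)) |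
         exact (proj2 (proj1 (proj2 (H 1%nat)) t x1 (x2 + 2 * PI)))].
  - intros n. apply (H (S n)).
Qed.

Lemma D1_flin c f g : (forall t, has_partials (f t)) -> (forall t, has_partials (g t)) ->
  D1 (flin c f g) = flin c (D1 f) (D1 g).
Proof.
  intros Hf Hg. extensionality t; extensionality x; extensionality y.
  unfold D1, d1, flin. destruct (Hf t x y) as [E1 _], (Hg t x y) as [E2 _].
  rewrite Derive_plus, Derive_scal; auto. now apply ex_derive_scal.
Qed.

Lemma D2_flin c f g : (forall t, has_partials (f t)) -> (forall t, has_partials (g t)) ->
  D2 (flin c f g) = flin c (D2 f) (D2 g).
Proof.
  intros Hf Hg. extensionality t; extensionality x; extensionality y.
  unfold D2, d2, flin. destruct (Hf t x y) as [_ E1], (Hg t x y) as [_ E2].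
  rewrite Derive_plus, Derive_scal; auto. now apply ex_derive_scal.
Qed.

Lemma Cn_family_flin n c f g : Cn_family n f -> Cn_family n g -> Cn_family n (flin c f g).
Proof.
  revert f g; induction n as [|n IH]; intros f g [Cf Hf] [Cg Hg].
  - split; auto. unfold flin; solve_cont.
  - destruct Hf as [Pf [Hf1 Hf2]], Hg as [Pg [Hg1 Hg2]].
    split; [unfold flin; solve_cont|]. split; [|split].
    + intros t x y. destruct (Pf t x y), (Pg t x y). unfold flin.
      split; apply (ex_derive_plus (V := R_NormedModule)); auto;
        now apply ex_derive_scal.
    + rewrite D1_flin by auto. auto.
    + rewrite D2_flin by auto. auto.
Qed.

Lemma smooth_family_flin c f g : smooth_family f -> smooth_family g -> smooth_family (flin c f g).
Proof.
  intros [Pf Hf] [Pg Hg]. split.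
  - intros t x y. unfold flin. destruct (Pf t x y) as [-> ->], (Pg t x y) as [-> ->]. auto.
  - intros n; now apply Cn_family_flin.
Qed.

Lemma smooth_family_D12 f t x y : smooth_family f -> D1 (D2 f) t x y = D2 (D1 f) t x y.
Proof.
  intros H. apply (Schwarz (f t) x y).
  - exists (mkposreal 1 Rlt_0_1). intros u v _ _. repeat split.
    + exact (proj1 (smooth_family_partials f t H u v)).
    + exact (proj2 (smooth_family_partials f t H u v)).
    + exact (proj1 (smooth_family_partials (D2 f) t (smooth_family_D2 f H) u v)).
    + exact (proj2 (smooth_family_partials (D1 f) t (smooth_family_D1 f H) u v)).
  - apply (cont2_continuity (D1 (D2 f) t)).
    apply smooth_family_cont2, smooth_family_D1, smooth_family_D2, H.
  - apply (cont2_continuity (D2 (D1 f) t)).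
    apply smooth_family_cont2, smooth_family_D2, smooth_family_D1, H.
Qed.

(** * Integration by parts *)

Lemma I2_ibp1 f g : cont2 f -> cont2 g -> cont2 (d1 f) -> cont2 (d1 g) ->
  (forall x y, ex_derive (fun z => f z y) x) -> (forall x y, ex_derive (fun z => g z y) x) ->
  (forall y, f PI y * g PI y = f (- PI) y * g (- PI) y) ->
  I2 (fun x y => d1 f x y * g x y) = - I2 (fun x y => f x y * d1 g x y).
Proof.
  intros Hf Hg Hdf Hdg Ef Eg Hb.
  assert (E : d1 (fun x y => f x y * g x y) = fun x y => d1 f x y * g x y + f x y * d1 g x y).
  { extensionality x; extensionality y. unfold d1. now rewrite Derive_mult. }
  assert (Z : I2 (d1 (fun x y => f x y * g x y)) = 0).
  { apply I2_d1; auto. solve_cont. intros; now apply ex_derive_mult. rewrite E; solve_cont. }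
  rewrite E, I2_plus in Z by solve_cont. lra.
Qed.

Lemma I2_ibp2 f g : cont2 f -> cont2 g -> cont2 (d2 f) -> cont2 (d2 g) ->
  (forall x y, ex_derive (f x) y) -> (forall x y, ex_derive (g x) y) ->
  (forall x, f x PI * g x PI = f x (- PI) * g x (- PI)) ->
  I2 (fun x y => d2 f x y * g x y) = - I2 (fun x y => f x y * d2 g x y).
Proof.
  intros Hf Hg Hdf Hdg Ef Eg Hb.
  assert (E : d2 (fun x y => f x y * g x y) = fun x y => d2 f x y * g x y + f x y * d2 g x y).
  { extensionality x; extensionality y. unfold d2.
    rewrite (Derive_mult (f x) (g x)); auto. }
  assert (Z : I2 (d2 (fun x y => f x y * g x y)) = 0).
  { apply I2_d2; auto. intros; apply (ex_derive_mult (f x) (g x)); auto. rewrite E; solve_cont. }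
  rewrite E, I2_plus in Z by solve_cont. lra.
Qed.

Lemma periodic_end f : periodic f ->
  (forall y, f PI y = f (- PI) y) /\ (forall x, f x PI = f x (- PI)).
Proof.
  intros H. split; intros z.
  - rewrite <- (proj1 (H (- PI) z)). f_equal; ring.
  - rewrite <- (proj2 (H z (- PI))). f_equal; ring.
Qed.

Lemma smooth_family_ibp1 f g t : smooth_family f -> smooth_family g ->
  I2 (fun x y => D1 f t x y * g t x y) = - I2 (fun x y => f t x y * D1 g t x y).
Proof.
  intros Hf Hg. apply (I2_ibp1 (f t) (g t) (smooth_family_cont2 f t Hf) (smooth_family_cont2 g t Hg)
    (smooth_family_cont2 (D1 f) t (smooth_family_D1 f Hf)) (smooth_family_cont2 (D1 g) t
      (smooth_family_D1 g Hg))).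
  - intros x y; exact (proj1 (smooth_family_partials f t Hf x y)).
  - intros x y; exact (proj1 (smooth_family_partials g t Hg x y)).
  - intros y. f_equal; apply periodic_end; [apply Hf | apply Hg].
Qed.

Lemma smooth_family_ibp2 f g t : smooth_family f -> smooth_family g ->
  I2 (fun x y => D2 f t x y * g t x y) = - I2 (fun x y => f t x y * D2 g t x y).
Proof.
  intros Hf Hg. apply (I2_ibp2 (f t) (g t) (smooth_family_cont2 f t Hf) (smooth_family_cont2 g t Hg)
    (smooth_family_cont2 (D2 f) t (smooth_family_D2 f Hf)) (smooth_family_cont2 (D2 g) t
      (smooth_family_D2 g Hg))).
  - intros x y; exact (proj2 (smooth_family_partials f t Hf x y)).
  - intros x y; exact (proj2 (smooth_family_partials g t Hg x y)).
  - intros x. f_equal; apply periodic_end; [apply Hf | apply Hg].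
Qed.

(** * Real Fourier coefficients *)

Definition cosk (k1 k2 : Z) (x y : R) : R := cos (dotk k1 k2 x y).
Definition sink (k1 k2 : Z) (x y : R) : R := sin (dotk k1 k2 x y).
Definition Ac (k1 k2 : Z) (f : R -> R -> R) : R :=
  / (2 * PI) ^ 2 * I2 (fun x y => f x y * cosk k1 k2 x y).
Definition Bc (k1 k2 : Z) (f : R -> R -> R) : R :=
  / (2 * PI) ^ 2 * I2 (fun x y => f x y * sink k1 k2 x y).
(** For continuous [f] the complex coefficient is [Ac - i Bc], so this is the real part of the
    Fourier term [fourier f k1 k2 * cis (dotk k1 k2 x y)]. *)
Definition mode (f : R -> R -> R) (x y : R) (k1 k2 : Z) : R :=
  Ac k1 k2 f * cosk k1 k2 x y + Bc k1 k2 f * sink k1 k2 x y.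

Lemma cont2_cosk k1 k2 : cont2 (cosk k1 k2).
Proof. unfold cosk, dotk; solve_cont. Qed.
Lemma cont2_sink k1 k2 : cont2 (sink k1 k2).
Proof. unfold sink, dotk; solve_cont. Qed.

Lemma is_derive_cosk1 k1 k2 x y :
  is_derive (fun z => cosk k1 k2 z y) x (- IZR k1 * sink k1 k2 x y).
Proof. unfold cosk, sink, dotk. auto_derive; auto. ring. Qed.
Lemma is_derive_sink1 k1 k2 x y :
  is_derive (fun z => sink k1 k2 z y) x (IZR k1 * cosk k1 k2 x y).
Proof. unfold cosk, sink, dotk. auto_derive; auto. ring. Qed.
Lemma is_derive_cosk2 k1 k2 x y :
  is_derive (fun z => cosk k1 k2 x z) y (- IZR k2 * sink k1 k2 x y).
Proof. unfold cosk, sink, dotk. auto_derive; auto. ring. Qed.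
Lemma is_derive_sink2 k1 k2 x y :
  is_derive (fun z => sink k1 k2 x z) y (IZR k2 * cosk k1 k2 x y).
Proof. unfold cosk, sink, dotk. auto_derive; auto. ring. Qed.

Lemma cos_sin_Zperiod (x : R) (k : Z) :
  cos (x + 2 * IZR k * PI) = cos x /\ sin (x + 2 * IZR k * PI) = sin x.
Proof.
  destruct (Z_le_gt_dec 0 k) as [H|H].
  - rewrite <- (Z2Nat.id k) by lia. rewrite <- INR_IZR_INZ.
    split; [apply cos_period | apply sin_period].
  - rewrite <- (cos_period (x + 2 * IZR k * PI) (Z.to_nat (- k))).
    rewrite <- (sin_period (x + 2 * IZR k * PI) (Z.to_nat (- k))).
    replace (x + 2 * IZR k * PI + 2 * INR (Z.to_nat (- k)) * PI) with x; auto.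
    rewrite INR_IZR_INZ, Z2Nat.id by lia. rewrite opp_IZR. ring.
Qed.

Lemma periodic_cosk k1 k2 : periodic (cosk k1 k2).
Proof.
  intros x y. unfold cosk, dotk. split.
  - rewrite <- (proj1 (cos_sin_Zperiod (IZR k1 * x + IZR k2 * y) k1)). f_equal; ring.
  - rewrite <- (proj1 (cos_sin_Zperiod (IZR k1 * x + IZR k2 * y) k2)). f_equal; ring.
Qed.
Lemma periodic_sink k1 k2 : periodic (sink k1 k2).
Proof.
  intros x y. unfold sink, dotk. split.
  - rewrite <- (proj2 (cos_sin_Zperiod (IZR k1 * x + IZR k2 * y) k1)). f_equal; ring.
  - rewrite <- (proj2 (cos_sin_Zperiod (IZR k1 * x + IZR k2 * y) k2)). f_equal; ring.
Qed.

Lemma d1_cosk k1 k2 : d1 (cosk k1 k2) = fun x y => - IZR k1 * sink k1 k2 x y.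
Proof. extensionality x; extensionality y. apply is_derive_unique, is_derive_cosk1. Qed.
Lemma d1_sink k1 k2 : d1 (sink k1 k2) = fun x y => IZR k1 * cosk k1 k2 x y.
Proof. extensionality x; extensionality y. apply is_derive_unique, is_derive_sink1. Qed.
Lemma d2_cosk k1 k2 : d2 (cosk k1 k2) = fun x y => - IZR k2 * sink k1 k2 x y.
Proof. extensionality x; extensionality y. apply is_derive_unique, is_derive_cosk2. Qed.
Lemma d2_sink k1 k2 : d2 (sink k1 k2) = fun x y => IZR k2 * cosk k1 k2 x y.
Proof. extensionality x; extensionality y. apply is_derive_unique, is_derive_sink2. Qed.

Section Coefficients.
Variables (k1 k2 : Z) (f : R -> R -> R -> R) (t : R).
Hypothesis Hf : smooth_family f.
Let C0 := smooth_family_cont2 f t Hf.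
Let C1 : cont2 (d1 (f t)) := smooth_family_cont2 (D1 f) t (smooth_family_D1 f Hf).
Let C2' : cont2 (d2 (f t)) := smooth_family_cont2 (D2 f) t (smooth_family_D2 f Hf).
Let cc := cont2_cosk k1 k2.
Let cs := cont2_sink k1 k2.

Lemma Ac_D1 : Ac k1 k2 (D1 f t) = IZR k1 * Bc k1 k2 (f t).
Proof.
  unfold Ac, Bc, D1. rewrite I2_ibp1; auto.
  - rewrite d1_cosk.
    rewrite (I2_ext _ (fun x y => - IZR k1 * (f t x y * sink k1 k2 x y))) by (intros; ring).
    rewrite I2_scal by solve_cont. ring.
  - rewrite d1_cosk. solve_cont.
  - intros x y; exact (proj1 (smooth_family_partials f t Hf x y)).
  - intros x y; eexists; apply is_derive_cosk1.
  - intros y. f_equal; apply periodic_end; [apply Hf | apply periodic_cosk].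
Qed.

Lemma Bc_D1 : Bc k1 k2 (D1 f t) = - (IZR k1 * Ac k1 k2 (f t)).
Proof.
  unfold Ac, Bc, D1. rewrite I2_ibp1; auto.
  - rewrite d1_sink.
    rewrite (I2_ext _ (fun x y => IZR k1 * (f t x y * cosk k1 k2 x y))) by (intros; ring).
    rewrite I2_scal by solve_cont. ring.
  - rewrite d1_sink. solve_cont.
  - intros x y; exact (proj1 (smooth_family_partials f t Hf x y)).
  - intros x y; eexists; apply is_derive_sink1.
  - intros y. f_equal; apply periodic_end; [apply Hf | apply periodic_sink].
Qed.

Lemma Ac_D2 : Ac k1 k2 (D2 f t) = IZR k2 * Bc k1 k2 (f t).
Proof.
  unfold Ac, Bc, D2. rewrite I2_ibp2; auto.
  - rewrite d2_cosk.
    rewrite (I2_ext _ (fun x y => - IZR k2 * (f t x y * sink k1 k2 x y))) by (intros; ring).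
    rewrite I2_scal by solve_cont. ring.
  - rewrite d2_cosk. solve_cont.
  - intros x y; exact (proj2 (smooth_family_partials f t Hf x y)).
  - intros x y; eexists; apply is_derive_cosk2.
  - intros y. f_equal; apply periodic_end; [apply Hf | apply periodic_cosk].
Qed.

Lemma Bc_D2 : Bc k1 k2 (D2 f t) = - (IZR k2 * Ac k1 k2 (f t)).
Proof.
  unfold Ac, Bc, D2. rewrite I2_ibp2; auto.
  - rewrite d2_sink.
    rewrite (I2_ext _ (fun x y => IZR k2 * (f t x y * cosk k1 k2 x y))) by (intros; ring).
    rewrite I2_scal by solve_cont. ring.
  - rewrite d2_sink. solve_cont.
  - intros x y; exact (proj2 (smooth_family_partials f t Hf x y)).
  - intros x y; eexists; apply is_derive_sink2.
  - intros y. f_equal; apply periodic_end; [apply Hf | apply periodic_sink].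
Qed.

Variable (g : R -> R -> R -> R).
Hypothesis Hg : smooth_family g.
Let G0 := smooth_family_cont2 g t Hg.

Lemma Ac_flin c : Ac k1 k2 (flin c f g t) = Ac k1 k2 (f t) + c * Ac k1 k2 (g t).
Proof.
  unfold Ac, flin.
  rewrite (I2_ext _ (fun x y => f t x y * cosk k1 k2 x y + c * (g t x y * cosk k1 k2 x y)))
    by (intros; ring).
  rewrite I2_plus, I2_scal by solve_cont. ring.
Qed.

Lemma Bc_flin c : Bc k1 k2 (flin c f g t) = Bc k1 k2 (f t) + c * Bc k1 k2 (g t).
Proof.
  unfold Bc, flin.
  rewrite (I2_ext _ (fun x y => f t x y * sink k1 k2 x y + c * (g t x y * sink k1 k2 x y)))
    by (intros; ring).
  rewrite I2_plus, I2_scal by solve_cont. ring.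
Qed.
End Coefficients.

(* (1 - d1^2)(1 - d2^2) multiplies the (k1, k2) coefficient by
   (1 + k1^2)(1 + k2^2). *)
Definition smoothing_inv (f : R -> R -> R -> R) : R -> R -> R -> R :=
  let g := flin (-1) f (D1 (D1 f)) in flin (-1) g (D2 (D2 g)).

Lemma smooth_family_smoothing_inv f : smooth_family f -> smooth_family (smoothing_inv f).
Proof.
  intros H. unfold smoothing_inv.
  repeat (apply smooth_family_flin || apply smooth_family_D1 || apply smooth_family_D2); auto.
Qed.

(** The factor [2] accounts for the cosine and sine parts of a mode, each bounded with half of this
    constant. An integral, rather than a supremum, makes continuity in time immediate. *)
Definition decay_const (f : R -> R -> R -> R) (t : R) : R :=
  2 * I2 (fun x y => Rabs (smoothing_inv f t x y)).

Lemma decay_const_pos f t : smooth_family f -> 0 <= decay_const f t.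
Proof.
  intros H. pose proof (smooth_family_cont2 _ t (smooth_family_smoothing_inv f H)).
  apply Rmult_le_pos; [lra|]. apply I2_ge0; [solve_cont|]. intros; apply Rabs_pos.
Qed.

Lemma decay_const_continuous f : smooth_family f -> cont1 (decay_const f).
Proof.
  intros H. pose proof (smooth_family_cont3 _ (smooth_family_smoothing_inv f H)).
  unfold decay_const. solve_cont.
Qed.

(** The coefficient times [(1 + k1^2)(1 + k2^2)] is a coefficient of [smoothing_inv f], hence at
    most its L^1 norm, since [1 / (2 PI)^2 <= 1]. *)
Lemma coefficient_decay k1 k2 f t : smooth_family f ->
  Rabs (Ac k1 k2 (f t)) <= decay_const f t / 2 * (wt k1 * wt k2) /\
  Rabs (Bc k1 k2 (f t)) <= decay_const f t / 2 * (wt k1 * wt k2).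
Proof.
  intros H. set (g := flin (-1) f (D1 (D1 f))).
  assert (Hg : smooth_family g) by (apply smooth_family_flin; auto using smooth_family_D1).
  pose proof (smooth_family_smoothing_inv f H) as HL.
  assert (EA : Ac k1 k2 (smoothing_inv f t)
     = (1 + IZR k1 ^ 2) * (1 + IZR k2 ^ 2) * Ac k1 k2 (f t)).
  { unfold smoothing_inv; fold g.
    rewrite Ac_flin, Ac_D2, Bc_D2 by auto using smooth_family_D2.
    unfold g. rewrite Ac_flin, Ac_D1, Bc_D1 by auto using smooth_family_D1. ring. }
  assert (EB : Bc k1 k2 (smoothing_inv f t)
     = (1 + IZR k1 ^ 2) * (1 + IZR k2 ^ 2) * Bc k1 k2 (f t)).
  { unfold smoothing_inv; fold g.
    rewrite Bc_flin, Bc_D2, Ac_D2 by auto using smooth_family_D2.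
    unfold g. rewrite Bc_flin, Bc_D1, Ac_D1 by auto using smooth_family_D1. ring. }
  pose proof (smooth_family_cont2 _ t HL) as cL.
  assert (P : 0 < (2 * PI) ^ 2 /\ / (2 * PI) ^ 2 <= 1).
  { pose proof PI2_1. split; [nra|]. rewrite <- Rinv_1. apply Rinv_le_contravar; nra. }
  assert (bnd : forall h, cont2 h -> (forall x y, Rabs (h x y) <= 1) ->
     Rabs (/ (2 * PI) ^ 2 * I2 (fun x y => smoothing_inv f t x y * h x y))
       <= decay_const f t / 2).
  { intros h ch hh. rewrite Rabs_mult, Rabs_pos_eq.
    2:{ left; apply Rinv_0_lt_compat; apply P. }
    apply Rle_trans with (1 * Rabs (I2 (fun x y => smoothing_inv f t x y * h x y))).
    { apply Rmult_le_compat_r; [apply Rabs_pos | apply P]. }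
    rewrite Rmult_1_l. eapply Rle_trans; [apply I2_abs; solve_cont|].
    unfold decay_const. replace (2 * I2 (fun x y => Rabs (smoothing_inv f t x y)) / 2)
      with (I2 (fun x y => Rabs (smoothing_inv f t x y))) by field.
    apply I2_le; try solve_cont. intros x y _ _. rewrite Rabs_mult.
    specialize (hh x y). pose proof (Rabs_pos (smoothing_inv f t x y)). nra. }
  assert (w : forall z, Rabs ((1 + IZR k1 ^ 2) * (1 + IZR k2 ^ 2) * z) <= decay_const f t / 2 ->
     Rabs z <= decay_const f t / 2 * (wt k1 * wt k2)).
  { intros z Hz. unfold wt.
    assert (p1 : 0 < 1 + IZR k1 ^ 2) by nra. assert (p2 : 0 < 1 + IZR k2 ^ 2) by nra.
    assert (p3 := Rmult_lt_0_compat _ _ p1 p2).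
    rewrite Rabs_mult, (Rabs_pos_eq ((1 + IZR k1 ^ 2) * (1 + IZR k2 ^ 2))) in Hz by lra.
    rewrite <- Rinv_mult. apply Rmult_le_reg_r with (1 := p3).
    rewrite Rmult_assoc, Rinv_l by lra. lra. }
  split; apply w; [rewrite <- EA | rewrite <- EB]; apply bnd.
  - apply cont2_cosk.
  - intros; apply Rabs_le, COS_bound.
  - apply cont2_sink.
  - intros; apply Rabs_le, SIN_bound.
Qed.

Lemma mode_decay f t x y : smooth_family f -> decay (decay_const f t) (mode (f t) x y).
Proof.
  intros H k1 k2. destruct (coefficient_decay k1 k2 f t H) as [a b]. unfold mode.
  eapply Rle_trans; [apply Rabs_triang|]. rewrite !Rabs_mult.
  assert (Rabs (cosk k1 k2 x y) <= 1) by apply Rabs_le, COS_bound.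
  assert (Rabs (sink k1 k2 x y) <= 1) by apply Rabs_le, SIN_bound.
  pose proof (Rabs_pos (Ac k1 k2 (f t))). pose proof (Rabs_pos (Bc k1 k2 (f t))).
  assert (Rabs (Ac k1 k2 (f t)) * Rabs (cosk k1 k2 x y) <= Rabs (Ac k1 k2 (f t))) by nra.
  assert (Rabs (Bc k1 k2 (f t)) * Rabs (sink k1 k2 x y) <= Rabs (Bc k1 k2 (f t))) by nra.
  lra.
Qed.

Lemma RInt_pair (u v : R -> R) a b : cont1 u -> cont1 v ->
  RInt (V := C_R_CompleteNormedModule) (fun x => (u x, v x)) a b = (RInt u a b, RInt v a b).
Proof.
  intros Hu Hv. apply (is_RInt_unique (V := C_R_CompleteNormedModule)).
  apply (is_RInt_fct_extend_pair (U := R_NormedModule) (V := R_NormedModule)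
    (fun x => (u x, v x))); apply (RInt_correct (V := R_CompleteNormedModule)); now apply cont1_ex.
Qed.

Lemma fourier_coefficients f k1 k2 : cont2 f -> fourier f k1 k2 = (Ac k1 k2 f, - Bc k1 k2 f).
Proof.
  intros Hf. pose proof (cont2_cosk k1 k2). pose proof (cont2_sink k1 k2).
  assert (E : RInt (V := C_R_CompleteNormedModule) (fun x1 =>
       RInt (V := C_R_CompleteNormedModule) (fun x2 =>
         Cmult (cis (- dotk k1 k2 x1 x2)) (RtoC (f x1 x2))) (- PI) PI) (- PI) PI
    = (I2 (fun x y => f x y * cosk k1 k2 x y), - I2 (fun x y => f x y * sink k1 k2 x y))).
  { rewrite (RInt_ext (V := C_R_CompleteNormedModule) _ (fun x1 =>
      (I1 (fun x2 => f x1 x2 * cosk k1 k2 x1 x2), I1 (fun x2 => -1 *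
        (f x1 x2 * sink k1 k2 x1 x2))))).
    - rewrite RInt_pair by solve_cont. apply (f_equal2 (@pair R R)); [reflexivity|].
      transitivity (I2 (fun x y => -1 * (f x y * sink k1 k2 x y))); [reflexivity|].
      rewrite I2_scal by solve_cont. ring.
    - intros x _. unfold I1. rewrite <- RInt_pair by solve_cont.
      apply RInt_ext. intros y _. unfold cis, Cmult, RtoC; simpl.
      rewrite cos_neg, sin_neg. unfold cosk, sink. apply (f_equal2 (@pair R R)); ring. }
  unfold fourier. rewrite E. unfold Cmult, RtoC, Ac, Bc; simpl. apply (f_equal2 (@pair R R)); ring.
Qed.

Lemma Cmod2_fourier f k1 k2 : cont2 f ->
  Cmod (fourier f k1 k2) ^ 2 = Ac k1 k2 f ^ 2 + Bc k1 k2 f ^ 2.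
Proof.
  intros Hf. rewrite fourier_coefficients by auto. unfold Cmod; simpl fst; simpl snd.
  rewrite pow2_sqrt by nra. ring.
Qed.

Definition inv_term (f : R -> R -> R) (x y : R) (k1 k2 : Z) : R :=
  omit0 (G := R_AbelianMonoid) (fun k1 k2 => / normk2 k1 k2 * mode f x y k1 k2) k1 k2.

Lemma inv_laplacian_Ssum f x y : cont2 f -> inv_laplacian f x y = Ssum (inv_term f x y).
Proof.
  intros Hf. unfold inv_laplacian, Ssum. f_equal. apply Lim_seq_ext. intros N.
  rewrite Re_box_sum. unfold rect. apply zsum_ext; intros k1; apply zsum_ext; intros k2.
  unfold inv_term, omit0. destruct (andb _ _); [reflexivity|].
  rewrite fourier_coefficients by auto. unfold Cmult, RtoC, cis, mode, cosk, sink; simpl. ring.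
Qed.

Lemma normk2_ge1 k1 k2 : andb (Z.eqb k1 0) (Z.eqb k2 0) = false -> 1 <= normk2 k1 k2.
Proof.
  intros H. unfold normk2. replace (IZR k1 ^ 2 + IZR k2 ^ 2) with (IZR (k1 * k1 + k2 * k2)).
  - apply IZR_le. apply Bool.andb_false_iff in H. rewrite !Z.eqb_neq in H. nia.
  - rewrite plus_IZR, !mult_IZR. ring.
Qed.

Lemma inv_term_decay f t x y : smooth_family f -> decay (decay_const f t) (inv_term (f t) x y).
Proof.
  intros H k1 k2. unfold inv_term, omit0.
  pose proof (decay_const_pos f t H). pose proof (wt_pos k1). pose proof (wt_pos k2).
  destruct (andb _ _) eqn:E.
  - change (@zero R_AbelianMonoid) with 0. rewrite Rabs_R0.
    apply Rmult_le_pos; [lra|]. apply Rmult_le_pos; lra.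
  - apply normk2_ge1 in E. rewrite Rabs_mult, Rabs_pos_eq.
    2:{ left; apply Rinv_0_lt_compat; lra. }
    apply Rle_trans with (2 := mode_decay f t x y H k1 k2).
    assert (/ normk2 k1 k2 <= 1) by (rewrite <- Rinv_1; apply Rinv_le_contravar; lra).
    pose proof (Rabs_pos (mode (f t) x y k1 k2)). nra.
Qed.

(** * Fourier inversion *)

(** The Dirichlet kernel. The sum [Dsum m] of the first [m + 1] of them is [m + 1] times the Fejer
    kernel. *)
Definition DN (N : nat) (z : R) : R := zsum N (fun k => cos (IZR k * z)).
Definition Dsum (m : nat) (z : R) : R := sum_f_R0 (fun j => DN j z) m.

Lemma cont1_DN N : cont1 (DN N).
Proof. intros z. unfold DN. apply (cont_zsum N (fun k z => cos (IZR k * z))). intros k. cont. Qed.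

Lemma cont1_Dsum m : cont1 (Dsum m).
Proof.
  unfold Dsum. induction m as [|m IH]; simpl; [apply (cont1_DN 0)|].
  intros z. apply cont_plus; [apply IH | apply (cont1_DN (S m))].
Qed.

Lemma DN_S n z : DN (S n) z = DN n z + 2 * cos (INR (S n) * z).
Proof.
  unfold DN. cbn [zsum]. rewrite opp_IZR, <- INR_IZR_INZ.
  replace (- INR (S n) * z) with (- (INR (S n) * z)) by ring. rewrite cos_neg. ring.
Qed.

Lemma DN_telescope n z : (1 - cos z) * DN n z = cos (INR n * z) - cos (INR (S n) * z).
Proof.
  induction n as [|n IH].
  - unfold DN; simpl. rewrite Rmult_0_l, Rmult_1_l, cos_0. ring.
  - rewrite DN_S, Rmult_plus_distr_l, IH. rewrite (S_INR (S n)).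
    set (a := INR (S n) * z).
    replace (INR n * z) with (a - z) by (unfold a; rewrite S_INR; ring).
    replace ((INR (S n) + 1) * z) with (a + z) by (unfold a; ring).
    rewrite cos_plus, cos_minus. ring.
Qed.

Lemma Dsum_telescope m z : (1 - cos z) * Dsum m z = 1 - cos (INR (S m) * z).
Proof.
  induction m as [|m IH].
  - unfold Dsum; simpl. rewrite DN_telescope. simpl. rewrite Rmult_0_l, cos_0. reflexivity.
  - unfold Dsum in *. cbn [sum_f_R0]. rewrite Rmult_plus_distr_l, IH, DN_telescope. ring.
Qed.

(** Where [cos z < 1] the telescoped identity gives the sign; at [cos z = 1] it degenerates, but
    there every cosine in the kernel equals [1]. *)
Lemma Dsum_nonneg m z : 0 <= Dsum m z.
Proof.
  destruct (COS_bound z) as [_ [H|H]].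
  - pose proof (Dsum_telescope m z). pose proof (COS_bound (INR (S m) * z)).
    apply Rmult_le_reg_l with (1 - cos z); lra.
  - assert (s0 : sin z = 0).
    { pose proof (sin2_cos2 z) as E. rewrite H in E. unfold Rsqr in E. nra. }
    assert (C : forall n, cos (INR n * z) = 1).
    { induction n; [simpl; now rewrite Rmult_0_l, cos_0|].
      rewrite S_INR, Rmult_plus_distr_r, Rmult_1_l, cos_plus, s0, H, IHn. ring. }
    assert (D : forall n, 0 <= DN n z).
    { induction n; [unfold DN; simpl; rewrite Rmult_0_l, cos_0; lra|].
      rewrite DN_S, C. lra. }
    unfold Dsum. apply cond_pos_sum. auto.
Qed.

Lemma I1_DN N x : I1 (fun y => DN N (x - y)) = 2 * PI.
Proof.
  induction N as [|N IH].
  - unfold DN; simpl. rewrite (I1_ext _ (fun _ => 1)).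
    + rewrite I1_const; ring.
    + intros y. now rewrite Rmult_0_l, cos_0.
  - pose proof (cont1_DN N). rewrite (I1_ext _ _ (fun y => DN_S N (x - y))).
    rewrite I1_plus, IH, I1_scal by solve_cont.
    set (c := INR (S N)).
    assert (Hc : c <> 0) by (apply not_0_INR; lia).
    rewrite (I1_derive (fun y => - sin (c * (x - y)) / c)).
    2:{ intros y. auto_derive; auto. unfold Rminus; field; auto. }
    2:{ solve_cont. }
    replace (sin (c * (x - - PI))) with (sin (c * (x - PI))); [field; auto|].
    rewrite <- (sin_period (c * (x - PI)) (S N)). f_equal. fold c. ring.
Qed.

Lemma I1_Dsum m x : I1 (fun y => Dsum m (x - y)) = 2 * PI * INR (S m).
Proof.
  induction m as [|m IH].
  - unfold Dsum; simpl. rewrite I1_DN. ring.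
  - pose proof (cont1_DN (S m)). pose proof (cont1_Dsum m).
    change (I1 (fun y => Dsum m (x - y) + DN (S m) (x - y)) = 2 * PI * INR (S (S m))).
    rewrite I1_plus, IH, I1_DN by solve_cont. rewrite (S_INR (S m)). ring.
Qed.

Lemma exists_shift z : exists n : Z, - PI <= z - 2 * IZR n * PI <= PI.
Proof.
  pose proof PI_pos as HP. destruct (archimed ((z + PI) / (2 * PI))) as [H1 H2].
  exists (up ((z + PI) / (2 * PI)) - 1)%Z. rewrite minus_IZR.
  set (u := IZR (up ((z + PI) / (2 * PI)))) in *.
  assert (E : (z + PI) / (2 * PI) * (2 * PI) = z + PI) by (field; lra).
  split; nra.
Qed.

Lemma periodZ (g : R -> R) : (forall y, g (y + 2 * PI) = g y) ->
  forall (n : Z) y, g (y + 2 * IZR n * PI) = g y.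
Proof.
  intros H.
  assert (P : forall (n : nat) y, g (y + 2 * INR n * PI) = g y).
  { induction n; intros y; [f_equal; simpl; ring|].
    rewrite <- (IHn y), <- (H (y + 2 * INR n * PI)). f_equal. rewrite S_INR; ring. }
  intros n y. destruct (Z_le_gt_dec 0 n).
  - rewrite <- (Z2Nat.id n) by lia. rewrite <- INR_IZR_INZ. apply P.
  - rewrite <- (P (Z.to_nat (- n)) (y + _)). f_equal.
    rewrite INR_IZR_INZ, Z2Nat.id by lia. rewrite opp_IZR. ring.
Qed.

(** The far part is measured by [1 - cos (x - y)], the very factor that cancels the denominator of
    the Fejer kernel. The integral in [fejer] therefore need not be split into near and far
    regions. *)
Lemma modulus_bound (g : R -> R) : cont1 g -> (forall y, g (y + 2 * PI) = g y) ->
  forall x e, 0 < e -> exists C, 0 <= C /\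
    forall y, Rabs (g y - g x) <= e + C * (1 - cos (x - y)).
Proof.
  intros Hg Hp x e He. pose proof PI_pos as HP.
  destruct (bounded_on_box (fun _ y _ => g y) 0) as [K HK]; [solve_cont|].
  assert (HK' : forall y, Rabs (g y) <= K).
  { intros y. destruct (exists_shift y) as [n Hn].
    rewrite <- (periodZ g Hp (- n) y).
    apply (HK 0 _ 0); [lra | | lra]. rewrite opp_IZR.
    replace (y + 2 * - IZR n * PI) with (y - 2 * IZR n * PI) by ring. exact Hn. }
  assert (K0 : 0 <= K) by (specialize (HK' 0); pose proof (Rabs_pos (g 0)); lra).
  destruct (continuous_lt _ _ _ (Hg x) He) as [d Hd].
  set (del := Rmin d PI).
  assert (d0 : 0 < del) by (apply Rmin_glb_lt; [apply cond_pos | lra]).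
  assert (d1 : del <= d) by apply Rmin_l. assert (d2 : del <= PI) by apply Rmin_r.
  assert (cd : cos del < 1). { rewrite <- cos_0. apply cos_decreasing_1; lra. }
  (* At distance at least [del], modulo the period, the difference is at most [2 K] and [1 - cos] is
     at least [1 - cos del]. *)
  exists (2 * K / (1 - cos del)). split.
  { apply Rmult_le_pos; [lra|]. left; apply Rinv_0_lt_compat; lra. }
  assert (main : forall z, - PI <= z <= PI ->
     Rabs (g (x + z) - g x) <= e + 2 * K / (1 - cos del) * (1 - cos z)).
  { intros z Hz. assert (0 <= 2 * K / (1 - cos del)).
    { apply Rmult_le_pos; [lra|]. left; apply Rinv_0_lt_compat; lra. }
    pose proof (COS_bound z).
    destruct (Rlt_dec (Rabs z) del) as [h|h].
    - assert (Rabs (g (x + z) - g x) < e).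
      { apply Hd. change (Rabs (x + z - x) < d). replace (x + z - x) with z by ring. lra. }
      assert (0 <= 2 * K / (1 - cos del) * (1 - cos z)) by (apply Rmult_le_pos; lra). lra.
    - assert (E : cos z = cos (Rabs z)) by (unfold Rabs; destruct
        (Rcase_abs z); rewrite ?cos_neg; auto).
      assert (hz : Rabs z <= PI) by (apply Rabs_le; lra).
      assert (cos (Rabs z) <= cos del) by (apply cos_decr_1; lra).
      assert (1 * (2 * K) <= 2 * K / (1 - cos del) * (1 - cos z)).
      { replace (1 * (2 * K)) with (2 * K / (1 - cos del) * (1 - cos del)) by (field; lra).
        apply Rmult_le_compat_l; lra. }
      pose proof (Rabs_triang (g (x + z)) (- g x)) as T. rewrite Rabs_Ropp in T.
      pose proof (HK' (x + z)). pose proof (HK' x). unfold Rminus at 1. lra. }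
  intros y. destruct (exists_shift (y - x)) as [n Hn].
  replace (g y) with (g (x + (y - x - 2 * IZR n * PI))).
  - replace (cos (x - y)) with (cos (y - x - 2 * IZR n * PI)); [apply main, Hn|].
    rewrite <- cos_neg. rewrite <- (proj1 (cos_sin_Zperiod (x - y) n)). f_equal; ring.
  - rewrite <- (periodZ g Hp n). f_equal; ring.
Qed.

Lemma fejer (g : R -> R) x : cont1 g -> (forall y, g (y + 2 * PI) = g y) ->
  is_lim_seq (fun m => I1 (fun y => g y * Dsum m (x - y)) / INR (S m)) (2 * PI * g x).
Proof.
  intros Hg Hp. pose proof PI_pos as HP. apply is_lim_seq_spec. intros eps.
  (* After division by [m + 1], [e] contributes [2 PI e = eps / 2]; the far part contributes
     [4 PI C / (m + 1)], which the choice of [N] makes less than [eps / 2]. *)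
  set (e := eps / (4 * PI)).
  assert (e0 : 0 < e) by (apply Rdiv_lt_0_compat; [apply cond_pos | lra]).
  destruct (modulus_bound g Hg Hp x e e0) as [C [C0 HC]].
  destruct (inv_INR_small (eps / (8 * PI * (C + 1)))) as [N HN].
  { apply Rdiv_lt_0_compat; [apply cond_pos | nra]. }
  exists N. intros m Hm. specialize (HN m Hm).
  assert (M0 : 0 < INR (S m)) by (apply lt_0_INR; lia).
  assert (I0 : 0 < / INR (S m)) by now apply Rinv_0_lt_compat.
  pose proof (cont1_Dsum m) as cD.
  assert (E : I1 (fun y => g y * Dsum m (x - y)) / INR (S m) - 2 * PI * g x =
     / INR (S m) * I1 (fun y => (g y - g x) * Dsum m (x - y))).
  { rewrite (I1_ext (fun y => (g y - g x) * Dsum m (x - y))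
      (fun y => g y * Dsum m (x - y) - g x * Dsum m (x - y))) by (intros; ring).
    rewrite I1_minus, I1_scal, I1_Dsum by solve_cont. field. lra. }
  rewrite E, Rabs_mult, (Rabs_pos_eq (/ INR (S m))) by lra.
  assert (B : Rabs (I1 (fun y => (g y - g x) * Dsum m (x - y))) <=
     e * (2 * PI * INR (S m)) + 2 * PI * (C * 2)).
  { rewrite <- (I1_Dsum m x), <- I1_scal by solve_cont. rewrite <- (I1_const (C * 2)).
    rewrite <- I1_plus by solve_cont.
    apply Rle_trans with (I1 (fun y => Rabs ((g y - g x) * Dsum m (x - y)))).
    - apply (abs_RInt_le (fun y => (g y - g x) * Dsum m (x - y))); [apply pi_le|].
      apply cont1_ex; solve_cont.
    - apply I1_le; try solve_cont. intros y _. rewrite Rabs_mult, (Rabs_pos_eq (Dsum m (x - y)))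
        by apply Dsum_nonneg.
      pose proof (Dsum_nonneg m (x - y)). pose proof (Dsum_telescope m (x - y)).
      pose proof (COS_bound (INR (S m) * (x - y))). specialize (HC y).
      apply Rle_trans with ((e + C * (1 - cos (x - y))) * Dsum m (x - y)).
      + apply Rmult_le_compat_r; auto.
      + rewrite Rmult_plus_distr_r, Rmult_assoc, H0.
        apply Rplus_le_compat_l, Rmult_le_compat_l; lra. }
  apply Rle_lt_trans with (/ INR (S m) * (e * (2 * PI * INR (S m)) + 2 * PI * (C * 2))).
  { apply Rmult_le_compat_l; [lra | exact B]. }
  replace (/ INR (S m) * (e * (2 * PI * INR (S m)) + 2 * PI * (C * 2)))
    with (eps / 2 + 4 * PI * C * / INR (S m)) by (unfold e; field; lra).
  assert (4 * PI * C * / INR (S m) <= 4 * PI * C * (eps / (8 * PI * (C + 1)))).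
  { apply Rmult_le_compat_l; [|lra]. apply Rmult_le_pos; lra. }
  assert (4 * PI * C * (eps / (8 * PI * (C + 1))) < eps / 2).
  { replace (4 * PI * C * (eps / (8 * PI * (C + 1)))) with (eps / 2 * (C / (C + 1))) by
      (field; lra).
    pose proof (cond_pos eps).
    assert (C / (C + 1) < 1) by (apply Rmult_lt_reg_r with (C + 1); [lra|]; field_simplify; lra).
    nra. }
  lra.
Qed.

(* If the Dirichlet partial sums converge, their limit is also the limit of the
   Fejer means. *)
Lemma fourier_series_limit (g : R -> R) x l : cont1 g -> (forall y, g (y + 2 * PI) = g y) ->
  is_lim_seq (fun N => I1 (fun y => g y * DN N (x - y))) (Finite l) -> l = 2 * PI * g x.
Proof.
  intros Hg Hp H. apply is_lim_seq_Reals in H. apply Cesaro_1 in H.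
  apply is_lim_seq_Reals in H. apply is_lim_seq_incr_1 in H.
  assert (E : forall m, sum_f_R0 (fun N => I1 (fun y => g y * DN N (x - y))) m =
     I1 (fun y => g y * Dsum m (x - y))).
  { induction m as [|m IH]; [reflexivity|]. cbn [sum_f_R0]. rewrite IH.
    pose proof (cont1_DN (S m)). pose proof (cont1_Dsum m).
    rewrite <- I1_plus by solve_cont. apply I1_ext. intros y. unfold Dsum; simpl. ring. }
  pose proof (fejer g x Hg Hp) as F.
  apply is_lim_seq_unique in H. apply is_lim_seq_unique in F.
  rewrite (Lim_seq_ext _ (fun m => I1 (fun y => g y * Dsum m (x - y)) / INR (S m))) in H.
  - rewrite H in F. now inversion F.
  - intros m. simpl pred. now rewrite E.
Qed.

Lemma I2_zsum N (F : Z -> R -> R -> R) : (forall k, cont2 (F k)) ->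
  cont2 (fun x y => zsum N (fun k => F k x y)) /\
  zsum N (fun k => I2 (F k)) = I2 (fun x y => zsum N (fun k => F k x y)).
Proof.
  intros H. assert (C : forall n, cont2 (fun x y => zsum n (fun k => F k x y))).
  { intros n p. apply (cont_zsum n (fun k (q : R * R) => F k (fst q) (snd q))). intros k; apply H. }
  split; [apply C|]. induction N as [|N IH]; [reflexivity|]. cbn [zsum]. rewrite IH.
  pose proof (C N) as CN. pose proof (H (Z.of_nat (S N))) as H1.
  pose proof (H (- Z.of_nat (S N))%Z) as H2.
  rewrite <- (I2_plus (F _) (F _)) by auto.
  rewrite <- (I2_plus (fun x y => zsum N (fun k => F k x y))).
  - reflexivity.
  - auto.
  - intros p. apply cont_plus; [apply H1 | apply H2].
Qed.

Lemma rect_dirichlet f x1 x2 N1 N2 : cont2 f ->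
  rect (mode f x1 x2) N1 N2 = / (2 * PI) ^ 2 *
    I1 (fun y1 => I1 (fun y2 => f y1 y2 * DN N2 (x2 - y2)) * DN N1 (x1 - y1)).
Proof.
  intros Hf. pose proof (cont1_DN N1) as cD1. pose proof (cont1_DN N2) as cD2.
  set (F := fun (k1 k2 : Z) y1 y2 =>
     f y1 y2 * cos (IZR k1 * (x1 - y1) + IZR k2 * (x2 - y2))).
  assert (CF : forall k1 k2, cont2 (F k1 k2)) by (intros k1 k2; unfold F; solve_cont).
  assert (M : forall k1 k2, mode f x1 x2 k1 k2 = / (2 * PI) ^ 2 * I2 (F k1 k2)).
  { intros k1 k2. pose proof (cont2_cosk k1 k2). pose proof (cont2_sink k1 k2).
    rewrite (I2_ext (F k1 k2) (fun y1 y2 => cosk k1 k2 x1 x2 * (f y1 y2 * cosk k1 k2 y1 y2)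
      + sink k1 k2 x1 x2 * (f y1 y2 * sink k1 k2 y1 y2))).
    - rewrite I2_plus, !I2_scal by solve_cont. unfold mode, Ac, Bc. ring.
    - intros y1 y2. unfold F, cosk, sink, dotk.
      replace (IZR k1 * (x1 - y1) + IZR k2 * (x2 - y2))
        with ((IZR k1 * x1 + IZR k2 * x2) - (IZR k1 * y1 + IZR k2 * y2)) by ring.
      rewrite cos_minus. ring. }
  unfold rect.
  rewrite (zsum_ext N1 _ (fun k1 => / (2 * PI) ^ 2 *
    I2 (fun y1 y2 => zsum N2 (fun k2 => F k1 k2 y1 y2)))).
  2:{ intros k1. rewrite (zsum_ext N2 _ _ (M k1)). rewrite zsum_scal. f_equal.
      apply I2_zsum. apply CF. }
  rewrite zsum_scal. f_equal.
  rewrite (proj2 (I2_zsum N1 (fun k1 y1 y2 => zsum N2 (fun k2 => F k1 k2 y1 y2))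
    (fun k1 => proj1 (I2_zsum N2 (F k1) (CF k1))))).
  apply I1_ext. intros y1. rewrite Rmult_comm, <- I1_scal by solve_cont.
  apply I1_ext. intros y2.
  (* Sines cancel in a symmetric sum, so the double sum of [cos (a + b)] factors into a product of
     two Dirichlet kernels. *)
  assert (S0 : forall N z, zsum N (fun k => sin (IZR k * z)) = 0).
  { intros N z. induction N as [|N IH]; cbn [zsum].
    - rewrite Rmult_0_l. apply sin_0.
    - rewrite IH, opp_IZR.
      replace (- IZR (Z.of_nat (S N)) * z) with (- (IZR (Z.of_nat (S N)) * z)) by ring.
      rewrite sin_neg. ring. }
  rewrite (zsum_ext N1 _ (fun k1 => (f y1 y2 * DN N2 (x2 - y2)) * cos (IZR k1 * (x1 - y1)))).
  - rewrite zsum_scal. unfold DN. ring.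
  - intros k1. unfold F.
    rewrite (zsum_ext N2 _ (fun k2 => (f y1 y2 * cos (IZR k1 * (x1 - y1))) * cos (IZR k2 *
      (x2 - y2))
      - (f y1 y2 * sin (IZR k1 * (x1 - y1))) * sin (IZR k2 * (x2 - y2)))).
    + rewrite zsum_minus, !zsum_scal, S0. unfold DN. ring.
    + intros k2. rewrite cos_plus. ring.
Qed.

Lemma zsum_delta N c : zsum N (fun k => if Z.eqb k 0 then c else 0) = c.
Proof.
  induction N as [|N IH]; [reflexivity|]. cbn [zsum]. rewrite IH.
  replace (Z.of_nat (S N) =? 0)%Z with false by (symmetry; apply Z.eqb_neq; lia).
  replace (- Z.of_nat (S N) =? 0)%Z with false by (symmetry; apply Z.eqb_neq; lia). ring.
Qed.

(** Lets the first cut-off go to infinity with the second fixed, at a cost of order [1 / (N2 + 1)]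
    relative to the square sum. *)
Lemma rect_row_limit K a N2 : 0 <= K -> decay K a ->
  exists l, is_lim_seq (fun N1 => rect a N1 N2) (Finite l) /\
    Rabs (l - rect a N2 N2) <= 40 * K * / INR (S N2).
Proof.
  intros HK Ha.
  (* Storing the whole inner sum at [k2 = 0] presents a simple series as a double one, to which
     [Ssum_spec] applies; [5] bounds the sum of the weights. *)
  set (b := fun k1 k2 => if Z.eqb k2 0 then zsum N2 (a k1) else 0).
  assert (Hb : decay (5 * K) b).
  { intros k1 k2. unfold b. pose proof (wt_pos k1) as w1. pose proof (wt_pos k2) as w2.
    destruct (Z.eqb_spec k2 0) as [->|_].
    - replace (wt 0) with 1 by (unfold wt; simpl; field).
      apply Rle_trans with (zsum N2 (fun k => K * wt k1 * wt k)).
      + apply zsum_abs. intros k. eapply Rle_trans; [apply Ha|]. right; ring.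
      + rewrite zsum_scal. pose proof (zsum_wt_bound N2).
        replace (5 * K * (wt k1 * 1)) with (K * wt k1 * 5) by ring.
        apply Rmult_le_compat_l; [apply Rmult_le_pos; lra | lra].
    - rewrite Rabs_R0. apply Rmult_le_pos; [lra|]. apply Rmult_le_pos; lra. }
  destruct (Ssum_spec (5 * K) b) as [L _]; [lra | exact Hb|].
  exists (Ssum b).
  assert (L' : is_lim_seq (fun N1 => rect a N1 N2) (Ssum b)).
  { revert L. apply is_lim_seq_ext. intros N. unfold rect. apply zsum_ext. intros k1.
    unfold b. apply zsum_delta. }
  split; [exact L'|].
  apply (is_lim_seq_le (fun N => Rabs (rect a (N + N2) N2 - rect a N2 N2))
    (fun _ => 40 * K * / INR (S N2)) (Finite _) (Finite _)).
  - intros N. eapply Rle_trans; [apply (rect_tail K); auto; lia|]. right; ring.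
  - apply (is_lim_seq_abs _ (Finite (Ssum b - rect a N2 N2))). apply is_lim_seq_minus'.
    + apply (is_lim_seq_incr_n (fun N1 => rect a N1 N2) N2). exact L'.
    + apply is_lim_seq_const.
  - apply is_lim_seq_const.
Qed.

(** One-dimensional inversion is applied twice: in [x1] to the function already convolved with
    [DN N2] in [x2], then in [x2]. The rate of [rect_row_limit] ties the iterated limit to the
    square sums. *)
Lemma fourier_inversion f t x1 x2 : smooth_family f -> Ssum (mode (f t) x1 x2) = f t x1 x2.
Proof.
  intros Hf. pose proof PI_pos as HP. pose proof (smooth_family_cont2 f t Hf) as C.
  set (a := mode (f t) x1 x2).
  pose proof (decay_const_pos f t Hf) as K0. set (K := decay_const f t) in *.
  assert (Ha : decay K a) by apply (mode_decay f t x1 x2 Hf).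
  assert (per : periodic (f t)) by apply Hf.
  assert (row : forall N2, Rabs (/ (2 * PI) * I1 (fun y2 => f t x1 y2 * DN N2 (x2 - y2))
     - rect a N2 N2) <= 40 * K * / INR (S N2)).
  { intros N2. destruct (rect_row_limit K a N2 K0 Ha) as [l [Hl Hb]].
    pose proof (cont1_DN N2) as cD.
    replace (/ (2 * PI) * I1 (fun y2 => f t x1 y2 * DN N2 (x2 - y2))) with l; [exact Hb|].
    assert (E : (2 * PI) ^ 2 * l = 2 * PI * I1 (fun y2 => f t x1 y2 * DN N2 (x2 - y2))).
    { apply (fourier_series_limit (fun y1 => I1 (fun y2 => f t y1 y2 * DN N2 (x2 - y2))) x1).
      - solve_cont.
      - intros y. apply I1_ext. intros z. f_equal. exact (proj1 (per y z)).
      - apply (is_lim_seq_scal_l _ ((2 * PI) ^ 2) (Finite l)) in Hl. revert Hl.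
        apply is_lim_seq_ext. intros N1. unfold a. rewrite rect_dirichlet by auto.
        field. lra. }
    apply Rmult_eq_reg_l with ((2 * PI) ^ 2); [|apply pow_nonzero; lra].
    rewrite E. field. lra. }
  destruct (Ssum_spec K a K0 Ha) as [_ HS].
  assert (L : is_lim_seq (fun N2 => / (2 * PI) * I1 (fun y2 => f t x1 y2 * DN N2 (x2 - y2)))
     (Ssum a)).
  { apply (lim_of_rate _ _ (80 * K)). intros n. specialize (row n). specialize (HS n).
    rewrite Rabs_minus_sym in HS.
    set (u := / (2 * PI) * _) in *.
    replace (u - Ssum a) with ((u - rect a n n) + (rect a n n - Ssum a)) by ring.
    eapply Rle_trans; [apply Rabs_triang | lra]. }
  apply (is_lim_seq_scal_l _ (2 * PI) (Finite _)) in L.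
  assert (E : 2 * PI * Ssum a = 2 * PI * f t x1 x2).
  { apply (fourier_series_limit (f t x1) x2).
    - solve_cont.
    - intros y. exact (proj2 (per x1 y)).
    - revert L. apply is_lim_seq_ext. intros N. field. lra. }
  apply Rmult_eq_reg_l with (2 * PI); lra.
Qed.

(** * The inverse Laplacian *)

Definition inv_lap (f : R -> R -> R -> R) (t : R) : R -> R -> R := inv_laplacian (f t).

Lemma inv_lap_rate f t x y N : smooth_family f ->
  Rabs (inv_lap f t x y - rect (inv_term (f t) x y) N N) <= 40 * decay_const f t * / INR (S N).
Proof.
  intros H. unfold inv_lap. rewrite inv_laplacian_Ssum by now apply smooth_family_cont2.
  apply Ssum_spec; [now apply decay_const_pos | now apply inv_term_decay].
Qed.

(** A locally uniform limit: [K] is continuous, so near [u] it stays below [|K u| + 1], and one [N]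
    serves the whole neighbourhood. *)
Lemma continuous_of_rate {U : UniformSpace} (F K : U -> R) (FN : nat -> U -> R) u :
  (forall N, continuous (FN N) u) -> continuous K u ->
  (forall N v, Rabs (F v - FN N v) <= K v * / INR (S N)) -> continuous F u.
Proof.
  intros HF HK H. apply filterlim_locally. intros eps.
  set (k := Rabs (K u) + 1).
  assert (k0 : 0 < k) by (unfold k; pose proof (Rabs_pos (K u)); lra).
  destruct (inv_INR_small (eps / (3 * k))) as [N HN].
  { apply Rdiv_lt_0_compat; [apply cond_pos | lra]. }
  specialize (HN N (Nat.le_refl N)).
  assert (e3 : 0 < eps / 3) by (pose proof (cond_pos eps); lra).
  generalize (filter_and _ _ (continuous_lt _ _ _ (HF N) e3) (continuous_lt _ _ _ HK Rlt_0_1)).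
  apply filter_imp. intros v [h1 h2]. change (Rabs (F v - F u) < eps).
  assert (I0 : 0 < / INR (S N)) by (apply Rinv_0_lt_compat, lt_0_INR; lia).
  assert (B : forall w, K w <= k -> Rabs (F w - FN N w) < eps / 3).
  { intros w hw. eapply Rle_lt_trans; [apply H|].
    apply Rle_lt_trans with (k * / INR (S N)); [apply Rmult_le_compat_r; lra|].
    replace (eps / 3) with (k * (eps / (3 * k))) by (field; lra).
    apply Rmult_lt_compat_l; lra. }
  assert (bu := B u). assert (bv := B v).
  apply Rabs_def2 in h2. pose proof (Rle_abs (K u)).
  specialize (bu ltac:(unfold k; lra)). specialize (bv ltac:(unfold k; lra)).
  replace (F v - F u) with ((F v - FN N v) + (FN N v - FN N u) + - (F u - FN N u)) by ring.
  eapply Rle_lt_trans; [apply Rabs_triang|]. rewrite Rabs_Ropp.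
  pose proof (Rabs_triang (F v - FN N v) (FN N v - FN N u)). lra.
Qed.

(** The fundamental theorem of calculus holds for the approximants and passes to the uniform limit;
    [F] is then differentiated as a primitive of [G]. *)
Lemma is_derive_of_rate (F G : R -> R) (FN GN : nat -> R -> R) K x :
  (forall N y, is_derive (FN N) y (GN N y)) -> (forall N, cont1 (GN N)) -> cont1 G ->
  (forall N y, Rabs (F y - FN N y) <= K * / INR (S N)) ->
  (forall N y, Rabs (G y - GN N y) <= K * / INR (S N)) ->
  is_derive F x (G x).
Proof.
  intros HD HG' HG HFr HGr.
  assert (E : forall y, F y = F 0 + RInt G 0 y).
  { intros y.
    assert (L1 : is_lim_seq (fun N => FN N y - FN N 0) (F y - F 0)).
    { apply (lim_of_rate _ _ (2 * K)). intros N.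
      replace (FN N y - FN N 0 - (F y - F 0)) with (- (F y - FN N y) + (F 0 - FN N 0)) by ring.
      eapply Rle_trans; [apply Rabs_triang|]. rewrite Rabs_Ropp.
      pose proof (HFr N y). pose proof (HFr N 0). lra. }
    assert (L2 : is_lim_seq (fun N => FN N y - FN N 0) (RInt G 0 y)).
    { apply (lim_of_rate _ _ (Rabs y * K)). intros N.
      replace (FN N y - FN N 0) with (RInt (GN N) 0 y).
      2:{ apply (is_RInt_unique (V := R_CompleteNormedModule)).
          apply (is_RInt_derive (V := R_CompleteNormedModule)); intros; auto. apply HG'. }
      assert (EM : RInt (GN N) 0 y - RInt G 0 y = RInt (fun z => GN N z - G z) 0 y).
      { symmetry. apply (RInt_minus (V := R_CompleteNormedModule)); now apply cont1_ex. }
      rewrite EM.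
      assert (cd : cont1 (fun z => GN N z - G z)) by
        (intros z; apply cont_minus; [apply HG' | apply HG]).
      assert (bd : forall z, Rabs (GN N z - G z) <= K * / INR (S N)).
      { intros z. rewrite Rabs_minus_sym. apply HGr. }
      destruct (Rle_dec 0 y) as [h|h].
      - rewrite (Rabs_pos_eq y) by auto. eapply Rle_trans.
        apply (abs_RInt_le_const _ 0 y (K * / INR (S N))); auto. now apply cont1_ex. lra.
      - rewrite <- (opp_RInt_swap (V := R_CompleteNormedModule)) by now apply cont1_ex.
        change (Rabs (- RInt (fun z => GN N z - G z) y 0) <= Rabs y * K * / INR (S N)).
        rewrite Rabs_Ropp, (Rabs_left y) by lra. eapply Rle_trans.
        apply (abs_RInt_le_const _ y 0 (K * / INR (S N))); auto. lra. now apply cont1_ex. lra. }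
    apply is_lim_seq_unique in L1. apply is_lim_seq_unique in L2. rewrite L1 in L2.
    inversion L2. lra. }
  apply (is_derive_ext (fun y => F 0 + RInt G 0 y)); [intros; symmetry; apply E|].
  replace (G x) with (plus (G := R_AbelianMonoid) 0 (G x)) by apply Rplus_0_l.
  apply (is_derive_plus (V := R_NormedModule) (fun _ => F 0)); [apply (is_derive_const
    (V := R_NormedModule))|].
  apply (is_derive_RInt (V := R_NormedModule) G _ 0); [|apply HG].
  apply filter_forall. intros y. apply (RInt_correct (V := R_CompleteNormedModule)).
  now apply cont1_ex.
Qed.

Lemma rect_inv_term_continuous f N : smooth_family f ->
  cont3 (fun t x y => rect (inv_term (f t) x y) N N).
Proof.
  intros Hf p. unfold rect. pose proof (smooth_family_cont3 f Hf) as C.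
  apply (cont_zsum N (fun k1 (q : R * (R * R)) => zsum N
    (inv_term (f (fst q)) (fst (snd q)) (snd (snd q)) k1))). intros k1.
  apply (cont_zsum N (fun k2 (q : R * (R * R)) =>
    inv_term (f (fst q)) (fst (snd q)) (snd (snd q)) k1 k2)). intros k2.
  unfold inv_term, omit0. destruct (andb _ _); [apply continuous_const|].
  unfold mode, Ac, Bc. pose proof (cont2_cosk k1 k2). pose proof (cont2_sink k1 k2). cont.
Qed.

Lemma inv_lap_cont3 f : smooth_family f -> cont3 (inv_lap f).
Proof.
  intros Hf p.
  apply (continuous_of_rate _ (fun q : R * (R * R) => 40 * decay_const f (fst q))
    (fun N q => rect (inv_term (f (fst q)) (fst (snd q)) (snd (snd q))) N N)).
  - intros N. apply (rect_inv_term_continuous f N Hf).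
  - pose proof (decay_const_continuous f Hf). cont.
  - intros N q. now apply inv_lap_rate.
Qed.

Lemma is_derive_mode1 f t x y k1 k2 : smooth_family f ->
  is_derive (fun z => mode (f t) z y k1 k2) x (mode (D1 f t) x y k1 k2).
Proof.
  intros Hf. unfold mode. rewrite Ac_D1, Bc_D1 by auto.
  evar_last.
  - apply (is_derive_plus (V := R_NormedModule));
      apply is_derive_scal; [apply is_derive_cosk1 | apply is_derive_sink1].
  - unfold plus; simpl. ring.
Qed.

Lemma is_derive_mode2 f t x y k1 k2 : smooth_family f ->
  is_derive (fun z => mode (f t) x z k1 k2) y (mode (D2 f t) x y k1 k2).
Proof.
  intros Hf. unfold mode. rewrite Ac_D2, Bc_D2 by auto.
  evar_last.
  - apply (is_derive_plus (V := R_NormedModule));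
      apply is_derive_scal; [apply is_derive_cosk2 | apply is_derive_sink2].
  - unfold plus; simpl. ring.
Qed.

Lemma is_derive_inv_term1 f t x y k1 k2 : smooth_family f ->
  is_derive (fun z => inv_term (f t) z y k1 k2) x (inv_term (D1 f t) x y k1 k2).
Proof.
  intros Hf. unfold inv_term, omit0. destruct (andb _ _).
  - apply (is_derive_const (V := R_NormedModule)).
  - apply is_derive_scal. now apply is_derive_mode1.
Qed.

Lemma is_derive_inv_term2 f t x y k1 k2 : smooth_family f ->
  is_derive (fun z => inv_term (f t) x z k1 k2) y (inv_term (D2 f t) x y k1 k2).
Proof.
  intros Hf. unfold inv_term, omit0. destruct (andb _ _).
  - apply (is_derive_const (V := R_NormedModule)).
  - apply is_derive_scal. now apply is_derive_mode2.
Qed.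

Lemma rate_mono k m u N : k <= m -> u <= 40 * k * / INR (S N) -> u <= 40 * m * / INR (S N).
Proof.
  intros H Hu. assert (I0 : 0 < / INR (S N)) by (apply Rinv_0_lt_compat, lt_0_INR; lia).
  eapply Rle_trans; [exact Hu|]. apply Rmult_le_compat_r; lra.
Qed.

Lemma inv_lap_derive1 f t x y : smooth_family f ->
  is_derive (fun z => inv_lap f t z y) x (inv_lap (D1 f) t x y).
Proof.
  intros Hf. pose proof (smooth_family_D1 f Hf) as Hd.
  apply (is_derive_of_rate (fun z => inv_lap f t z y) (fun z => inv_lap (D1 f) t z y)
    (fun N z => rect (inv_term (f t) z y) N N) (fun N z => rect (inv_term (D1 f t) z y) N N)
    (40 * Rmax (decay_const f t) (decay_const (D1 f) t))).
  - intros N z. unfold rect.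
    apply (is_derive_zsum N (fun k1 z => zsum N (inv_term (f t) z y k1))
      (fun k1 z => zsum N (inv_term (D1 f t) z y k1))). intros k1.
    apply (is_derive_zsum N (fun k2 z => inv_term (f t) z y k1 k2)
      (fun k2 z => inv_term (D1 f t) z y k1 k2)). intros k2.
    now apply is_derive_inv_term1.
  - intros N. pose proof (rect_inv_term_continuous (D1 f) N Hd) as C.
    intros z. apply (cont_app3 _ (fun _ => t) (fun z => z) (fun _ => y) _ C); cont.
  - pose proof (inv_lap_cont3 (D1 f) Hd) as C. solve_cont.
  - intros N z. apply (rate_mono _ _ _ _ (Rmax_l _ _) (inv_lap_rate f t _ _ N Hf)).
  - intros N z. apply (rate_mono _ _ _ _ (Rmax_r _ _) (inv_lap_rate (D1 f) t _ _ N Hd)).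
Qed.

Lemma inv_lap_derive2 f t x y : smooth_family f ->
  is_derive (fun z => inv_lap f t x z) y (inv_lap (D2 f) t x y).
Proof.
  intros Hf. pose proof (smooth_family_D2 f Hf) as Hd.
  apply (is_derive_of_rate (fun z => inv_lap f t x z) (fun z => inv_lap (D2 f) t x z)
    (fun N z => rect (inv_term (f t) x z) N N) (fun N z => rect (inv_term (D2 f t) x z) N N)
    (40 * Rmax (decay_const f t) (decay_const (D2 f) t))).
  - intros N z. unfold rect.
    apply (is_derive_zsum N (fun k1 z => zsum N (inv_term (f t) x z k1))
      (fun k1 z => zsum N (inv_term (D2 f t) x z k1))). intros k1.
    apply (is_derive_zsum N (fun k2 z => inv_term (f t) x z k1 k2)
      (fun k2 z => inv_term (D2 f t) x z k1 k2)). intros k2.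
    now apply is_derive_inv_term2.
  - intros N. pose proof (rect_inv_term_continuous (D2 f) N Hd) as C.
    intros z. apply (cont_app3 _ (fun _ => t) (fun _ => x) (fun z => z) _ C); cont.
  - pose proof (inv_lap_cont3 (D2 f) Hd) as C. solve_cont.
  - intros N z. apply (rate_mono _ _ _ _ (Rmax_l _ _) (inv_lap_rate f t _ _ N Hf)).
  - intros N z. apply (rate_mono _ _ _ _ (Rmax_r _ _) (inv_lap_rate (D2 f) t _ _ N Hd)).
Qed.

Lemma D1_inv_lap f : smooth_family f -> D1 (inv_lap f) = inv_lap (D1 f).
Proof.
  intros Hf. extensionality t; extensionality x; extensionality y.
  apply is_derive_unique. now apply inv_lap_derive1.
Qed.

Lemma D2_inv_lap f : smooth_family f -> D2 (inv_lap f) = inv_lap (D2 f).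
Proof.
  intros Hf. extensionality t; extensionality x; extensionality y.
  apply is_derive_unique. now apply inv_lap_derive2.
Qed.

(** Since [inv_lap] commutes with both derivatives, smoothness of every order reduces to joint
    continuity. *)
Lemma smooth_family_inv_lap f : smooth_family f -> smooth_family (inv_lap f).
Proof.
  intros Hf. split.
  - intros t x y. unfold inv_lap. rewrite !inv_laplacian_Ssum by now apply smooth_family_cont2.
    split; f_equal; extensionality k1; extensionality k2; unfold inv_term, omit0, mode.
    + rewrite (proj1 (periodic_cosk k1 k2 x y)), (proj1 (periodic_sink k1 k2 x y)); auto.
    + rewrite (proj2 (periodic_cosk k1 k2 x y)), (proj2 (periodic_sink k1 k2 x y)); auto.
  - intros n. revert f Hf. induction n as [|n IH]; intros f Hf.
    + split; auto. now apply inv_lap_cont3.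
    + split; [now apply inv_lap_cont3|]. split; [|split].
      * intros t x y. split; eexists; [now apply inv_lap_derive1 | now apply inv_lap_derive2].
      * rewrite D1_inv_lap by auto. apply IH, smooth_family_D1, Hf.
      * rewrite D2_inv_lap by auto. apply IH, smooth_family_D2, Hf.
Qed.

(** Termwise, [- (k1^2 + k2^2)] cancels [1 / |k|^2] and leaves the Fourier series of [- f]; the
    mean-zero hypothesis accounts for the omitted mode. *)
Lemma laplacian_inv_lap f t x y : smooth_family f -> Ac 0 0 (f t) = 0 ->
  D1 (D1 (inv_lap f)) t x y + D2 (D2 (inv_lap f)) t x y = - f t x y.
Proof.
  intros Hf H0. pose proof (smooth_family_D1 f Hf) as Hf1.
  pose proof (smooth_family_D2 f Hf) as Hf2.
  pose proof (smooth_family_D1 _ Hf1) as Hf11. pose proof (smooth_family_D2 _ Hf2) as Hf22.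
  rewrite !D1_inv_lap, !D2_inv_lap by auto.
  unfold inv_lap. rewrite !inv_laplacian_Ssum by now apply smooth_family_cont2.
  destruct (Ssum_spec _ _ (decay_const_pos _ t Hf11) (inv_term_decay _ t x y Hf11)) as [L1 _].
  destruct (Ssum_spec _ _ (decay_const_pos _ t Hf22) (inv_term_decay _ t x y Hf22)) as [L2 _].
  destruct (Ssum_spec _ _ (decay_const_pos _ t Hf) (mode_decay _ t x y Hf)) as [L0 _].
  rewrite (fourier_inversion f t x y Hf) in L0.
  apply (is_lim_seq_scal_l _ (-1) (Finite _)) in L0.
  pose proof (is_lim_seq_plus' _ _ _ _ L1 L2) as L.
  apply is_lim_seq_unique in L. apply is_lim_seq_unique in L0.
  rewrite (Lim_seq_ext _ (fun N => -1 * rect (mode (f t) x y) N N)) in L.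
  - rewrite L0 in L. inversion L. lra.
  - intros N. unfold rect. rewrite <- zsum_plus, <- zsum_scal. apply zsum_ext; intros k1.
    rewrite <- zsum_plus, <- zsum_scal. apply zsum_ext; intros k2.
    unfold inv_term, omit0, mode. destruct (andb _ _) eqn:E.
    + apply andb_prop in E. destruct E as [E1 E2].
      apply Z.eqb_eq in E1, E2. subst. rewrite H0.
      change (@zero R_AbelianMonoid) with 0. unfold sink, dotk.
      rewrite !Rmult_0_l, Rplus_0_l, sin_0. ring.
    + apply normk2_ge1 in E. rewrite !Ac_D1, !Bc_D1, !Ac_D2, !Bc_D2 by auto.
      rewrite ?Ac_D1, ?Bc_D1, ?Ac_D2, ?Bc_D2 by auto. unfold normk2 in *. field. lra.
Qed.

(** * Parseval identities *)

(** A uniformly convergent series is integrated against [f]; taking [h] to be [f] or its inverse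
    Laplacian gives the L^2 and the H^{-1} identity. *)
Lemma parseval_limit (f h : R -> R -> R) (a : Z -> Z -> R -> R -> R) K :
  cont2 f -> cont2 h -> (forall k1 k2, cont2 (a k1 k2)) ->
  (forall x y N, Rabs (h x y - rect (fun k1 k2 => a k1 k2 x y) N N) <= K * / INR (S N)) ->
  is_lim_seq (fun N => rect (fun k1 k2 => I2 (fun x y => f x y * a k1 k2 x y)) N N)
    (I2 (fun x y => f x y * h x y)).
Proof.
  intros Hf Hh Ha H. apply (lim_of_rate _ _ (I2 (fun x y => Rabs (f x y)) * K)). intros N.
  assert (Cr : cont2 (fun x y => rect (fun k1 k2 => a k1 k2 x y) N N)).
  { apply (I2_zsum N (fun k1 x y => zsum N (fun k2 => a k1 k2 x y))). intros k1.
    apply (I2_zsum N (a k1)). apply Ha. }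
  assert (E : rect (fun k1 k2 => I2 (fun x y => f x y * a k1 k2 x y)) N N =
     I2 (fun x y => f x y * rect (fun k1 k2 => a k1 k2 x y) N N)).
  { assert (Hfa : forall k1 k2, cont2 (fun x y => f x y * a k1 k2 x y)).
    { intros k1 k2. pose proof (Ha k1 k2). solve_cont. }
    unfold rect. rewrite (zsum_ext N _ (fun k1 => I2 (fun x y => zsum N
      (fun k2 => f x y * a k1 k2 x y)))).
    2:{ intros k1. apply (I2_zsum N (fun k2 x y => f x y * a k1 k2 x y)). apply Hfa. }
    rewrite (proj2 (I2_zsum N (fun k1 x y => zsum N (fun k2 => f x y * a k1 k2 x y))
      (fun k1 => proj1 (I2_zsum N (fun k2 x y => f x y * a k1 k2 x y) (Hfa k1))))).
    apply I2_ext. intros x y. rewrite <- zsum_scal. apply zsum_ext. intros k1.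
    apply zsum_scal. }
  rewrite E, <- I2_minus by solve_cont.
  eapply Rle_trans; [apply I2_abs; solve_cont|].
  replace (I2 (fun x y => Rabs (f x y)) * K * / INR (S N))
    with (K * / INR (S N) * I2 (fun x y => Rabs (f x y))) by ring.
  rewrite <- I2_scal by solve_cont. apply I2_le; try solve_cont.
  intros x y _ _. rewrite <- Rmult_minus_distr_l, Rabs_mult, Rmult_comm, Rabs_minus_sym.
  apply Rmult_le_compat_r; [apply Rabs_pos | apply H].
Qed.

Lemma I2_mode f k1 k2 : cont2 f -> I2 (fun x y => f x y * mode f x y k1 k2) =
  (2 * PI) ^ 2 * (Ac k1 k2 f ^ 2 + Bc k1 k2 f ^ 2).
Proof.
  intros Hf. pose proof (cont2_cosk k1 k2). pose proof (cont2_sink k1 k2). pose proof PI_pos.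
  rewrite (I2_ext _ (fun x y => Ac k1 k2 f * (f x y * cosk k1 k2 x y) +
    Bc k1 k2 f * (f x y * sink k1 k2 x y))) by (intros; unfold mode; ring).
  rewrite I2_plus, !I2_scal by solve_cont. unfold Ac, Bc. field. lra.
Qed.

Definition energy (f : R -> R -> R) (k1 k2 : Z) : R :=
  (2 * PI) ^ 2 * Cmod (fourier f k1 k2) ^ 2.

Lemma parseval f t : smooth_family f ->
  is_lim_seq (fun N => rect (energy (f t)) N N) (I2 (fun x y => f t x y * f t x y)).
Proof.
  intros Hf. pose proof (smooth_family_cont2 f t Hf) as C.
  apply (is_lim_seq_ext
    (fun N => rect (fun k1 k2 => I2 (fun x y => f t x y * mode (f t) x y k1 k2)) N N)).
  - intros N. unfold rect. apply zsum_ext; intros k1; apply zsum_ext; intros k2.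
    unfold energy. rewrite I2_mode, Cmod2_fourier; auto.
  - apply (parseval_limit (f t) (f t) (fun k1 k2 x y => mode (f t) x y k1 k2)
      (40 * decay_const f t)); auto.
    + intros k1 k2. unfold mode. pose proof (cont2_cosk k1 k2). pose proof (cont2_sink k1 k2).
      solve_cont.
    + intros x y N. rewrite <- (fourier_inversion f t x y Hf) at 1.
      apply Ssum_spec; [now apply decay_const_pos | now apply mode_decay].
Qed.

Lemma parseval_inv f t : smooth_family f ->
  is_lim_seq (fun N => rect (omit0 (G := R_AbelianMonoid)
      (fun k1 k2 => / normk2 k1 k2 * energy (f t) k1 k2)) N N)
    (I2 (fun x y => f t x y * inv_lap f t x y)).
Proof.
  intros Hf. pose proof (smooth_family_cont2 f t Hf) as C.
  assert (Cm : forall k1 k2, cont2 (fun x y => mode (f t) x y k1 k2)).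
  { intros k1 k2. unfold mode. pose proof (cont2_cosk k1 k2). pose proof (cont2_sink k1 k2).
    solve_cont. }
  apply (is_lim_seq_ext
    (fun N => rect (fun k1 k2 => I2 (fun x y => f t x y * inv_term (f t) x y k1 k2)) N N)).
  - intros N. unfold rect. apply zsum_ext; intros k1; apply zsum_ext; intros k2.
    unfold inv_term, omit0. destruct (andb _ _).
    + rewrite (I2_ext _ (fun _ _ => 0)); [rewrite I2_const; apply Rmult_0_r|].
      intros; apply Rmult_0_r.
    + unfold energy. rewrite Cmod2_fourier, <- I2_mode by auto.
      pose proof (Cm k1 k2). rewrite <- I2_scal by solve_cont.
      apply I2_ext. intros; ring.
  - apply (parseval_limit (f t) (inv_lap f t) (fun k1 k2 x y => inv_term (f t) x y k1 k2)
      (40 * decay_const f t)); auto.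
    + now apply (smooth_family_cont2 (inv_lap f)), smooth_family_inv_lap.
    + intros k1 k2. unfold inv_term, omit0. pose proof (Cm k1 k2).
      destruct (andb _ _); [intros p; apply continuous_const | solve_cont].
    + intros x y N. now apply inv_lap_rate.
Qed.

(** * Transport by a stream function *)

Definition rhs (rho psi : R -> R -> R -> R) (t x y : R) : R :=
  D2 psi t x y * D1 rho t x y - D1 psi t x y * D2 rho t x y.

(* A density and a stream function with velocity (- d2 psi, d1 psi). *)
Definition flow_pair (rho psi : R -> R -> R -> R) : Prop :=
  smooth_family rho /\ smooth_family psi /\
  (forall t x y, D1 (D1 psi) t x y + D2 (D2 psi) t x y = - D1 rho t x y) /\
  (forall t x y, 0 < t -> is_derive (fun s => rho s x y) t (rhs rho psi t x y)).

Lemma smooth_family_c3_D1 f : smooth_family f -> cont3 (D1 f).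
Proof. intros H; apply smooth_family_cont3, smooth_family_D1, H. Qed.
Lemma smooth_family_c3_D2 f : smooth_family f -> cont3 (D2 f).
Proof. intros H; apply smooth_family_cont3, smooth_family_D2, H. Qed.

Lemma rhs_cont3 rho psi : smooth_family rho -> smooth_family psi -> cont3 (rhs rho psi).
Proof.
  intros Hr Hp. pose proof (smooth_family_c3_D1 _ Hr). pose proof (smooth_family_c3_D2 _ Hr).
  pose proof (smooth_family_c3_D1 _ Hp). pose proof (smooth_family_c3_D2 _ Hp). unfold rhs.
  solve_cont.
Qed.

Lemma clamp_continuous : cont1 (fun t => Rmax t 0).
Proof.
  intros t. apply continuous_ext with (fun t => (t + Rabs t) / 2).
  - intros z. unfold Rmax, Rabs. destruct (Rcase_abs z), (Rle_dec z 0); lra.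
  - cont.
Qed.

(** The density is frozen at its initial value for negative times. The clamp is continuous with
    values in [t >= 0], so one-sided continuity becomes continuity. *)
Lemma Cn_family_clamp n rho : Cn_time n rho -> Cn_family n (fun t => rho (Rmax t 0)).
Proof.
  revert rho. induction n as [|n IH]; intros rho [Hc H].
  all: assert (C : cont3 (fun t => rho (Rmax t 0))).
  1,3: intros [t [x y]];
    set (g := fun q : R * (R * R) => (Rmax (fst q) 0, snd q));
    apply (filterlim_comp _ _ _ g
      (fun p : R * (R * R) => rho (fst p) (fst (snd p)) (snd (snd p))) _
      (within (fun p : R * (R * R) => 0 <= fst p) (locally (Rmax t 0, (x, y)))));
    [ intros P HP; unfold within in HP;
      assert (Cg : continuous g (t, (x, y)));
      [ unfold g; apply (continuous_comp_2 (fun q : R * (R * R) => Rmax (fst q) 0) snd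
          (fun a b => (a, b)) (t, (x, y)));
        [ pose proof clamp_continuous; apply (cont_app1 (fun t => Rmax t 0) fst _ H0);
          apply continuous_fst
        | apply continuous_snd
        | apply continuous_ext with (fun z : R *
          (R * R) => z); [intros []; reflexivity | apply continuous_id] ]
      | change (locally (t, (x, y)) (fun q => P (g q)));
        apply (filter_imp (fun q => 0 <= fst (g q) -> P (g q)));
        [intros q Hq; apply Hq; apply Rmax_r | exact (Cg _ HP)] ]
    | apply Hc; apply Rmax_r ].
  - split; auto.
  - destruct H as [H1 [H2 H3]]. split; [exact C|]. split; [|split].
    + intros t. apply H1, Rmax_r.
    + exact (IH _ H2).
    + exact (IH _ H3).
Qed.

Lemma Ac00_D1 f t : smooth_family f -> Ac 0 0 (D1 f t) = 0.
Proof. intros H. rewrite Ac_D1 by auto. apply Rmult_0_l. Qed.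

Lemma solution_flow_pair rho0 rho : global_smooth_IPM_solution rho0 rho ->
  flow_pair (fun t => rho (Rmax t 0)) (inv_lap (D1 (fun t => rho (Rmax t 0)))).
Proof.
  intros [Hp [Hc [_ Hd]]]. set (r := fun t => rho (Rmax t 0)).
  assert (Hr : smooth_family r).
  { split; [intros t; apply Hp, Rmax_r | intros n; apply Cn_family_clamp, Hc]. }
  pose proof (smooth_family_D1 r Hr) as Hr1.
  split; [exact Hr|]. split; [now apply smooth_family_inv_lap|]. split.
  - intros t x y. apply laplacian_inv_lap; auto. now apply Ac00_D1.
  - intros t x y Ht.
    assert (E : Rmax t 0 = t) by (apply Rmax_left; lra).
    apply is_derive_ext_loc with (fun s => rho s x y).
    + generalize (open_gt 0 t Ht). apply filter_imp. intros s Hs. unfold r.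
      now rewrite Rmax_left by lra.
    + evar_last; [apply (Hd t x y Ht)|].
      unfold rhs, velocity1, velocity2, inv_lap, D1, D2, r. rewrite E. ring.
Qed.

Lemma nonincreasing_of_derive (f df : R -> R) a b : a <= b -> cont1 f ->
  (forall t, a < t < b -> is_derive f t (df t) /\ df t <= 0) -> f b <= f a.
Proof.
  intros Hab Hc H. destruct (Rle_lt_or_eq_dec a b Hab) as [lt| ->]; [|lra].
  (* [MVT_gen] places the mean point only in the closed interval, so [df] is replaced by [0] at the
     ends, where nothing is assumed about it. *)
  set (g := fun t => if Rlt_dec a t then if Rlt_dec t b then df t else 0 else 0).
  destruct (MVT_gen f a b g) as [c [_ Hcc]].
  - rewrite Rmin_left, Rmax_right by lra. intros t Ht. unfold g.
    destruct (Rlt_dec a t), (Rlt_dec t b); try lra. now apply H.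
  - intros t _. apply continuity_pt_filterlim. apply Hc.
  - assert (g c <= 0).
    { unfold g. destruct (Rlt_dec a c), (Rlt_dec c b); try lra. apply H; lra. }
    nra.
Qed.

Lemma gronwall_zero (Q dQ : R -> R) C T : 0 <= T -> cont1 Q -> (forall t, 0 <= Q t) ->
  (forall t, 0 < t < T -> is_derive Q t (dQ t) /\ dQ t <= C * Q t) -> Q 0 = 0 -> Q T = 0.
Proof.
  intros HT Hc H0 Hd Q0.
  assert (D : forall t, is_derive (fun t => exp (- C * t)) t (- C * exp (- C * t))).
  { intros t. auto_derive; auto. ring. }
  assert (L : Q T * exp (- C * T) <= Q 0 * exp (- C * 0)).
  { apply (nonincreasing_of_derive (fun t => Q t * exp (- C * t))
      (fun t => dQ t * exp (- C * t) + Q t * (- C * exp (- C * t)))); auto.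
    - intros t. apply cont_mult; [apply Hc|].
      apply (ex_derive_continuous (fun t => exp (- C * t))). eexists; apply D.
    - intros t Ht. destruct (Hd t Ht) as [d1 d2]. split.
      + apply (is_derive_mult Q (fun t => exp (- C * t)) t _ _ d1 (D t)). apply Rmult_comm.
      + pose proof (exp_pos (- C * t)). nra. }
  rewrite Q0, Rmult_0_l in L. pose proof (exp_pos (- C * T)). specialize (H0 T). nra.
Qed.

(** After integration by parts the two mixed derivatives of [psi] cancel: the velocity is
    divergence-free. In [x2] only the flux [G * D1 psi] has to match at the two ends, which admits
    the non-periodic [G = x2 * rho]. *)
Lemma transport_mean_zero psi t (G : R -> R -> R) : smooth_family psi ->
  cont2 G -> cont2 (d1 G) -> cont2 (d2 G) -> has_partials G ->
  (forall y, G PI y = G (- PI) y) ->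
  (forall x, G x PI * D1 psi t x PI = G x (- PI) * D1 psi t x (- PI)) ->
  I2 (fun x y => D2 psi t x y * d1 G x y - D1 psi t x y * d2 G x y) = 0.
Proof.
  intros Hp C0 C1 C2 HG b1 b2.
  pose proof (smooth_family_D1 _ Hp) as P1. pose proof (smooth_family_D2 _ Hp) as P2.
  pose proof (smooth_family_cont2 _ t P1) as cont1'.
  pose proof (smooth_family_cont2 _ t P2) as cont2'.
  pose proof (smooth_family_cont2 _ t (smooth_family_D2 _ P1)) as c12.
  pose proof (smooth_family_cont2 _ t (smooth_family_D1 _ P2)) as c21.
  pose proof (I2_ibp1 G (D2 psi t) C0 cont2' C1 c21 (fun x y => proj1 (HG x y))
    (fun x y => proj1 (smooth_family_partials _ t P2 x y))) as E1.
  pose proof (I2_ibp2 G (D1 psi t) C0 cont1' C2 c12 (fun x y => proj2 (HG x y))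
    (fun x y => proj2 (smooth_family_partials _ t P1 x y)) b2) as E2.
  assert (B : forall y, G PI y * D2 psi t PI y = G (- PI) y * D2 psi t (- PI) y).
  { intros y. rewrite b1. f_equal. apply (periodic_end (D2 psi t)). apply P2. }
  specialize (E1 B).
  rewrite I2_minus by solve_cont.
  rewrite (I2_ext (fun x y => D2 psi t x y * d1 G x y) (fun x y => d1 G x y * D2 psi t x y))
    by (intros; ring).
  rewrite (I2_ext (fun x y => D1 psi t x y * d2 G x y) (fun x y => d2 G x y * D1 psi t x y))
    by (intros; ring).
  rewrite E1, E2.
  rewrite (I2_ext (fun x y => G x y * d1 (D2 psi t) x y) (fun x y => G x y * d2 (D1 psi t) x y)).
  - ring.
  - intros x y. f_equal. exact (smooth_family_D12 psi t x y Hp).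
Qed.

Lemma d_comp (F dF : R -> R) (f : R -> R -> R) : (forall z, is_derive F z (dF z)) ->
  has_partials f -> let G := fun x y => F (f x y) in
  has_partials G /\ d1 G = (fun x y => dF (f x y) * d1 f x y) /\
  d2 G = (fun x y => dF (f x y) * d2 f x y).
Proof.
  intros HF Hf G.
  assert (E1 : forall x y, is_derive (fun z => G z y) x (dF (f x y) * d1 f x y)).
  { intros x y. evar_last.
    - apply (is_derive_comp F (fun z => f z y)); [apply HF | apply Derive_correct; exact (proj1
        (Hf x y))].
    - unfold scal; simpl; unfold mult; simpl. unfold d1. ring. }
  assert (E2 : forall x y, is_derive (fun z => G x z) y (dF (f x y) * d2 f x y)).
  { intros x y. evar_last.
    - apply (is_derive_comp F (fun z => f x z)); [apply HF | apply Derive_correct; exact (proj2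
        (Hf x y))].
    - unfold scal; simpl; unfold mult; simpl. unfold d2. ring. }
  split; [|split].
  - intros x y; split; eexists; [apply E1 | apply E2].
  - extensionality x; extensionality y; apply is_derive_unique, E1.
  - extensionality x; extensionality y; apply is_derive_unique, E2.
Qed.

Lemma transport_comp_zero rho psi t (F dF : R -> R) : smooth_family rho -> smooth_family psi ->
  cont1 dF ->
  (forall z, is_derive F z (dF z)) ->
  I2 (fun x y => dF (rho t x y) * rhs rho psi t x y) = 0.
Proof.
  intros Hr Hp CF HF.
  assert (cF : cont1 F) by (intros z; apply (ex_derive_continuous F); eexists; apply HF).
  destruct (d_comp F dF (rho t) HF (smooth_family_partials rho t Hr)) as [P [E1 E2]].
  pose proof (smooth_family_cont2 rho t Hr) as C0.
  pose proof (smooth_family_cont2 _ t (smooth_family_D1 _ Hr)) as C1.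
  pose proof (smooth_family_cont2 _ t (smooth_family_D2 _ Hr)) as C2.
  unfold D1 in C1. unfold D2 in C2.
  rewrite (I2_ext _ (fun x y => D2 psi t x y * d1 (fun x y => F (rho t x y)) x y -
     D1 psi t x y * d2 (fun x y => F (rho t x y)) x y)).
  - apply transport_mean_zero; auto.
    + solve_cont.
    + rewrite E1. solve_cont.
    + rewrite E2. solve_cont.
    + intros y. f_equal. apply periodic_end, Hr.
    + intros x. rewrite (proj2 (periodic_end (rho t) (proj1 Hr t))). f_equal.
      apply (periodic_end (D1 psi t)), smooth_family_D1, Hp.
  - intros x y. rewrite E1, E2. unfold rhs, D1, D2. ring.
Qed.

Lemma conserved rho psi (F dF : R -> R) T : flow_pair rho psi -> cont1 dF ->
  (forall z, is_derive F z (dF z)) -> 0 <= T ->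
  I2 (fun x y => F (rho T x y)) = I2 (fun x y => F (rho 0 x y)).
Proof.
  intros [Hr [Hp [_ Hd]]] CF HF HT.
  assert (cF : cont1 F) by (intros z; apply (ex_derive_continuous F); eexists; apply HF).
  pose proof (smooth_family_cont3 _ Hr) as C. pose proof (rhs_cont3 _ _ Hr Hp) as CR.
  set (Q := fun t => I2 (fun x y => F (rho t x y))).
  assert (cQ : cont1 Q) by (unfold Q; solve_cont).
  assert (dQ : forall t, 0 < t -> is_derive Q t 0).
  { intros t Ht. rewrite <- (transport_comp_zero rho psi t F dF Hr Hp CF HF).
    apply (I2_derive_param (fun t x y => F (rho t x y))
      (fun t x y => dF (rho t x y) * rhs rho psi t x y) t Ht); [|solve_cont|solve_cont].
    intros s x y Hs. evar_last.
    - apply (is_derive_comp F (fun s => rho s x y)); [apply HF | apply (Hd s x y Hs)].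
    - unfold scal; simpl; unfold mult; simpl. ring. }
  assert (L1 : Q T <= Q 0).
  { apply (nonincreasing_of_derive Q (fun _ => 0)); auto. intros t Ht.
    split; [apply dQ; lra | lra]. }
  assert (L2 : - Q T <= - Q 0).
  { apply (nonincreasing_of_derive (fun t => - Q t) (fun _ => - 0)); auto.
    - intros t. apply cont_opp, cQ.
    - intros t Ht. split; [|lra]. apply (is_derive_opp (V := R_NormedModule) Q), dQ. lra. }
  unfold Q in *. lra.
Qed.

(** * Uniqueness *)

(** Testing the equation with [phi] gives [int |grad phi|^2 = - int D1 phi * w]; Young's inequality
    then absorbs half of the left side. *)
Lemma elliptic_estimate phi w t : smooth_family phi -> smooth_family w ->
  (forall x y, D1 (D1 phi) t x y + D2 (D2 phi) t x y = - D1 w t x y) ->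
  I2 (fun x y => D1 phi t x y ^ 2 + D2 phi t x y ^ 2) <= I2 (fun x y => w t x y ^ 2).
Proof.
  intros Hp Hw HL.
  pose proof (smooth_family_D1 _ Hp) as P1. pose proof (smooth_family_D2 _ Hp) as P2.
  pose proof (smooth_family_cont2 _ t Hp) as a0. pose proof (smooth_family_cont2 _ t Hw) as a1.
  pose proof (smooth_family_cont2 _ t P1) as a2. pose proof (smooth_family_cont2 _ t P2) as a3.
  pose proof (smooth_family_cont2 _ t (smooth_family_D1 _ P1)) as a4.
  pose proof (smooth_family_cont2 _ t (smooth_family_D2 _ P2)) as a5.
  pose proof (smooth_family_cont2 _ t (smooth_family_D1 _ Hw)) as a6.
  pose proof (smooth_family_ibp1 phi (D1 phi) t Hp P1) as E1.
  pose proof (smooth_family_ibp2 phi (D2 phi) t Hp P2) as E2.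
  pose proof (smooth_family_ibp1 phi w t Hp Hw) as E3.
  set (X := I2 (fun x y => D1 phi t x y ^ 2 + D2 phi t x y ^ 2)).
  assert (EX : X = - I2 (fun x y => D1 phi t x y * w t x y)).
  { unfold X.
    rewrite (I2_ext _ (fun x y => D1 phi t x y * D1 phi t x y + D2 phi t x y * D2 phi t x y))
      by (intros; ring).
    rewrite I2_plus, E1, E2, E3 by solve_cont.
    rewrite (I2_ext (fun x y => phi t x y * D1 w t x y) (fun x y =>
      -1 * (phi t x y * D1 (D1 phi) t x y + phi t x y * D2 (D2 phi) t x y))).
    - rewrite I2_scal, I2_plus by solve_cont. ring.
    - intros x y. specialize (HL x y).
      replace (D1 w t x y) with (- (D1 (D1 phi) t x y + D2 (D2 phi) t x y)) by lra. ring. }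
  assert (B : X <= / 2 * X + / 2 * I2 (fun x y => w t x y ^ 2)).
  { rewrite EX at 1. unfold X. rewrite <- !I2_scal, <- I2_plus by solve_cont.
    replace (- I2 (fun x y => D1 phi t x y * w t x y))
      with (I2 (fun x y => -1 * (D1 phi t x y * w t x y))) by (rewrite I2_scal by solve_cont; ring).
    apply I2_le; try solve_cont. intros x y _ _.
    pose proof (pow2_ge_0 (D1 phi t x y + w t x y)). pose proof (pow2_ge_0 (D2 phi t x y)). nra. }
  lra.
Qed.

Lemma periodic_on_box (P : R -> Prop) f : periodic f ->
  (forall x y, - PI <= x <= PI -> - PI <= y <= PI -> P (f x y)) -> forall x y, P (f x y).
Proof.
  intros Hp H x y. destruct (exists_shift x) as [n Hn]. destruct (exists_shift y) as [m Hm].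
  rewrite <- (periodZ (fun x => f x y) (fun x => proj1 (Hp x y)) (- n) x).
  rewrite <- (periodZ (f (x + 2 * IZR (- n) * PI)) (fun y => proj2 (Hp _ y)) (- m) y).
  rewrite !opp_IZR. apply H.
  - replace (x + 2 * - IZR n * PI) with (x - 2 * IZR n * PI) by ring; exact Hn.
  - replace (y + 2 * - IZR m * PI) with (y - 2 * IZR m * PI) by ring; exact Hm.
Qed.

Lemma I2_sqr_zero f : periodic f -> cont2 f -> I2 (fun x y => f x y ^ 2) <= 0 ->
  forall x y, f x y = 0.
Proof.
  intros Hp Hf H. apply (periodic_on_box (fun z => z = 0) f Hp).
  intros x y Hx Hy.
  assert (E : f x y ^ 2 = 0).
  { apply (I2_zero (fun x y => f x y ^ 2)); auto. solve_cont. intros; apply pow2_ge_0.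
    apply Rle_antisym; [exact H|]. apply I2_ge0; [solve_cont | intros; apply pow2_ge_0]. }
  nra.
Qed.

(** An L^2 energy estimate for the difference. Only gradients of the stream functions are compared,
    because the equation leaves an additive constant in space free. *)
Lemma flow_pair_unique rho psi rho' psi' T : flow_pair rho psi -> flow_pair rho' psi' ->
  (forall x y, rho 0 x y = rho' 0 x y) -> 0 <= T ->
  forall x y, rho T x y = rho' T x y /\ D1 psi T x y = D1 psi' T x y /\
    D2 psi T x y = D2 psi' T x y.
Proof.
  intros [Hr [Hp [HL Hd]]] [Hr' [Hp' [HL' Hd']]] H0 HT.
  set (w := flin (-1) rho rho'). set (phi := flin (-1) psi psi').
  assert (Hw : smooth_family w) by now apply smooth_family_flin.
  assert (Hphi : smooth_family phi) by now apply smooth_family_flin.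
  assert (Pr := fun t => smooth_family_partials rho t Hr).
  assert (Pr' := fun t => smooth_family_partials rho' t Hr').
  assert (Pp := fun t => smooth_family_partials psi t Hp).
  assert (Pp' := fun t => smooth_family_partials psi' t Hp').
  assert (w1 : D1 w = flin (-1) (D1 rho) (D1 rho')) by now apply D1_flin.
  assert (w2 : D2 w = flin (-1) (D2 rho) (D2 rho')) by now apply D2_flin.
  assert (p1 : D1 phi = flin (-1) (D1 psi) (D1 psi')) by now apply D1_flin.
  assert (p2 : D2 phi = flin (-1) (D2 psi) (D2 psi')) by now apply D2_flin.
  assert (Lw : forall t x y, D1 (D1 phi) t x y + D2 (D2 phi) t x y = - D1 w t x y).
  { intros t x y. rewrite p1, p2, w1.
    rewrite D1_flin by (intros; apply smooth_family_partials; now apply smooth_family_D1).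
    rewrite D2_flin by (intros; apply smooth_family_partials; now apply smooth_family_D2).
    unfold flin. specialize (HL t x y). specialize (HL' t x y). lra. }
  assert (EL := fun t => elliptic_estimate phi w t Hphi Hw (Lw t)).
  pose proof (smooth_family_cont3 _ Hw) as cw. pose proof (smooth_family_c3_D1 _ Hphi) as cp1.
  pose proof (smooth_family_c3_D2 _ Hphi) as cp2. pose proof (smooth_family_c3_D1 _ Hr') as cr1.
  pose proof (smooth_family_c3_D2 _ Hr') as cr2. pose proof (rhs_cont3 _ _ Hr Hp) as R1.
  pose proof (rhs_cont3 _ _ Hr' Hp') as R2. pose proof (rhs_cont3 w psi Hw Hp) as R3.
  set (Q := fun t => I2 (fun x y => w t x y ^ 2)).
  destruct (bounded_on_box (D1 rho') T cr1) as [K1 HK1].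
  destruct (bounded_on_box (D2 rho') T cr2) as [K2 HK2].
  set (K := Rmax 0 (Rmax K1 K2)).
  assert (K0 : 0 <= K) by apply Rmax_l.
  assert (KK : K1 <= K /\ K2 <= K).
  { unfold K. pose proof (Rmax_r 0 (Rmax K1 K2)). pose proof (Rmax_l K1 K2).
    pose proof (Rmax_r K1 K2). lra. }
  assert (QT : Q T = 0).
  { apply (gronwall_zero Q (fun t => I2 (fun x y => 2 * w t x y *
      (rhs rho psi t x y - rhs rho' psi' t x y)))
      (3 * K) T HT).
    - unfold Q; solve_cont.
    - intros t. apply I2_ge0; [solve_cont | intros; apply pow2_ge_0].
    - intros t Ht. split.
      + apply (I2_derive_param (fun t x y => w t x y ^ 2)
          (fun t x y => 2 * w t x y * (rhs rho psi t x y - rhs rho' psi' t x y)) t (proj1 Ht));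
          [|solve_cont|solve_cont].
        intros s x y Hs.
        assert (dw : is_derive (fun s => w s x y) s (rhs rho psi s x y - rhs rho' psi' s x y)).
        { unfold w, flin. evar_last.
          - apply (is_derive_plus (V := R_NormedModule)); [apply (Hd s x y Hs)|].
            apply is_derive_scal. apply (Hd' s x y Hs).
          - unfold plus; simpl. ring. }
        evar_last; [apply (is_derive_pow (fun s => w s x y) 2 s _ dw)|]. simpl. ring.
      (* The nonlinear terms differ by the transport of [w] by [psi], which preserves the L^2 norm,
         and the transport of [rho'] by [phi]. Young's inequality bounds the latter by [K] times
         [2 Q + int |grad phi|^2], and the elliptic estimate makes this [3 K Q]. *)
      + rewrite (I2_ext _ (fun x y => 2 * w t x y * rhs w psi t x y +
           2 * w t x y * (D2 phi t x y * D1 rho' t x y - D1 phi t x y * D2 rho' t x y))).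
        2:{ intros x y. unfold rhs. rewrite w1, w2, p1, p2. unfold flin. ring. }
        rewrite I2_plus by solve_cont.
        rewrite (transport_comp_zero w psi t (fun z => z ^ 2) (fun z => 2 * z) Hw Hp).
        2:{ solve_cont. }
        2:{ intros z. auto_derive; auto. ring. }
        rewrite Rplus_0_l.
        apply Rle_trans with (K * (2 * I2 (fun x y => w t x y ^ 2) +
          I2 (fun x y => D1 phi t x y ^ 2 + D2 phi t x y ^ 2))).
        * rewrite <- I2_scal, <- I2_plus, <- I2_scal by solve_cont.
          apply I2_le; try solve_cont. intros x y Hx Hy.
          specialize (HK1 t x y ltac:(lra) Hx Hy). specialize (HK2 t x y ltac:(lra) Hx Hy).
          set (W := w t x y). set (a := D1 phi t x y). set (b := D2 phi t x y).
          set (r1 := D1 rho' t x y) in *. set (r2 := D2 rho' t x y) in *.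
          assert (h1 : 2 * W * b * r1 <= K * (W ^ 2 + b ^ 2)).
          { apply Rle_trans with (Rabs (2 * W * b) * Rabs r1).
            { rewrite <- Rabs_mult. apply Rle_abs. }
            rewrite Rmult_comm. apply Rmult_le_compat; try apply Rabs_pos; [lra|].
            apply Rabs_le. split; [pose proof (pow2_ge_0 (W + b)) | pose proof (pow2_ge_0
              (W - b))]; nra. }
          assert (h2 : - (2 * W * a * r2) <= K * (W ^ 2 + a ^ 2)).
          { apply Rle_trans with (Rabs (2 * W * a) * Rabs r2).
            { rewrite <- Rabs_mult, <- Rabs_Ropp. apply Rle_abs. }
            rewrite Rmult_comm. apply Rmult_le_compat; try apply Rabs_pos; [lra|].
            apply Rabs_le. split; [pose proof (pow2_ge_0 (W + a)) | pose proof (pow2_ge_0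
              (W - a))]; nra. }
          lra.
        * replace (3 * K * Q t) with (K * (2 * Q t + Q t)) by ring.
          apply Rmult_le_compat_l; [lra|]. specialize (EL t). unfold Q. lra.
    - unfold Q. rewrite (I2_ext _ (fun _ _ => 0)); [rewrite I2_const; ring|].
      intros x y. unfold w, flin. rewrite H0. ring. }
  assert (W0 : forall x y, w T x y = 0).
  { apply I2_sqr_zero; [apply Hw | now apply smooth_family_cont2 | unfold Q in QT; lra]. }
  pose proof (smooth_family_cont2 _ T (smooth_family_D1 _ Hphi)) as cont1'.
  pose proof (smooth_family_cont2 _ T (smooth_family_D2 _ Hphi)) as cont2'.
  assert (G0 : forall x y, D1 phi T x y = 0).
  { apply I2_sqr_zero; [apply (smooth_family_D1 _ Hphi) | exact cont1' |].
    apply Rle_trans with (I2 (fun x y => D1 phi T x y ^ 2 + D2 phi T x y ^ 2)).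
    - apply I2_le; try solve_cont. intros x y _ _. pose proof (pow2_ge_0 (D2 phi T x y)). lra.
    - rewrite <- QT. apply EL. }
  assert (G1 : forall x y, D2 phi T x y = 0).
  { apply I2_sqr_zero; [apply (smooth_family_D2 _ Hphi) | exact cont2' |].
    apply Rle_trans with (I2 (fun x y => D1 phi T x y ^ 2 + D2 phi T x y ^ 2)).
    - apply I2_le; try solve_cont. intros x y _ _. pose proof (pow2_ge_0 (D1 phi T x y)). lra.
    - rewrite <- QT. apply EL. }
  intros x y. specialize (W0 x y). specialize (G0 x y). specialize (G1 x y).
  rewrite p1 in G0. rewrite p2 in G1. unfold w, flin in *. lra.
Qed.

(** * Symmetries *)

Definition reflect (c a b : R) (f : R -> R -> R -> R) : R -> R -> R -> R :=
  fun t x y => c * f t (a * x) (b * y).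

Lemma is_derive_reflect (g : R -> R) c a x : ex_derive g (a * x) ->
  is_derive (fun z => c * g (a * z)) x (c * a * Derive g (a * x)).
Proof.
  intros H. evar_last.
  - apply is_derive_scal. apply (is_derive_comp g (fun z => a * z)).
    + apply Derive_correct, H.
    + auto_derive; auto.
  - unfold scal; simpl; unfold mult; simpl. ring.
Qed.

Lemma D1_reflect c a b f : (forall t, has_partials (f t)) ->
  D1 (reflect c a b f) = reflect (c * a) a b (D1 f).
Proof.
  intros H. extensionality t; extensionality x; extensionality y.
  apply is_derive_unique. apply (is_derive_reflect (fun z => f t z (b * y)) c a x).
  exact (proj1 (H t (a * x) (b * y))).
Qed.

Lemma D2_reflect c a b f : (forall t, has_partials (f t)) ->
  D2 (reflect c a b f) = reflect (c * b) a b (D2 f).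
Proof.
  intros H. extensionality t; extensionality x; extensionality y.
  apply is_derive_unique. apply (is_derive_reflect (fun z => f t (a * x) z) c b y).
  exact (proj2 (H t (a * x) (b * y))).
Qed.

Lemma Cn_family_reflect n c a b f : Cn_family n f -> Cn_family n (reflect c a b f).
Proof.
  revert c f. induction n as [|n IH]; intros c f [C H].
  - split; auto. unfold reflect; solve_cont.
  - destruct H as [H1 [H2 H3]]. split; [unfold reflect; solve_cont|]. split; [|split].
    + intros t x y. split; eexists.
      * apply (is_derive_reflect (fun z => f t z (b * y)) c a x).
        exact (proj1 (H1 t (a * x) (b * y))).
      * apply (is_derive_reflect (fun z => f t (a * x) z) c b y).
        exact (proj2 (H1 t (a * x) (b * y))).
    + rewrite D1_reflect by auto. auto.
    + rewrite D2_reflect by auto. auto.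
Qed.

Lemma smooth_family_reflect c a b f : a = 1 \/ a = -1 -> b = 1 \/ b = -1 -> smooth_family f ->
  smooth_family (reflect c a b f).
Proof.
  intros Ha Hb [Hp H]. split; [|intros n; now apply Cn_family_reflect].
  intros t x y. unfold reflect. split; f_equal.
  - destruct Ha as [-> | ->].
    + rewrite <- (proj1 (Hp t (1 * x) (b * y))). f_equal; ring.
    + rewrite <- (proj1 (Hp t (-1 * (x + 2 * PI)) (b * y))). f_equal; ring.
  - destruct Hb as [-> | ->].
    + rewrite <- (proj2 (Hp t (a * x) (1 * y))). f_equal; ring.
    + rewrite <- (proj2 (Hp t (a * x) (-1 * (y + 2 * PI)))). f_equal; ring.
Qed.

(** The signs are forced. If the density carries the sign [c], the elliptic equation gives the
    stream function [c * a]; the quadratic term then carries [c^2 a^2 b = b], so [c = b]. *)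
Lemma flow_pair_reflect a b rho psi : a = 1 \/ a = -1 -> b = 1 \/ b = -1 ->
  flow_pair rho psi -> flow_pair (reflect b a b rho) (reflect (a * b) a b psi).
Proof.
  intros Ha Hb [Hr [Hp [HL Hd]]].
  assert (Pr := fun t => smooth_family_partials rho t Hr).
  assert (Pp := fun t => smooth_family_partials psi t Hp).
  assert (Pp1 := fun t => smooth_family_partials _ t (smooth_family_D1 psi Hp)).
  assert (Pp2 := fun t => smooth_family_partials _ t (smooth_family_D2 psi Hp)).
  assert (a2 : a * a = 1) by (destruct Ha as [-> | ->]; ring).
  assert (b2 : b * b = 1) by (destruct Hb as [-> | ->]; ring).
  split; [now apply smooth_family_reflect|]. split; [now apply smooth_family_reflect|]. split.
  - intros t x y. rewrite !D1_reflect, !D2_reflect by auto.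
    unfold reflect.
    replace (a * b * a * a) with (a * a * (a * b)) by ring.
    replace (a * b * b * b) with (b * b * (a * b)) by ring. rewrite a2, b2.
    specialize (HL t (a * x) (b * y)). nra.
  - intros t x y Ht. unfold rhs.
    rewrite !D1_reflect, !D2_reflect by auto. unfold reflect.
    evar_last; [apply is_derive_scal; apply (Hd t (a * x) (b * y) Ht)|].
    unfold rhs.
    replace (a * b * b * D2 psi t (a * x) (b * y) * (b * a * D1 rho t (a * x) (b * y)))
      with ((a * a) * (b * b) * b * (D2 psi t (a * x) (b * y) * D1 rho t (a * x) (b * y))) by ring.
    replace (a * b * a * D1 psi t (a * x) (b * y) * (b * b * D2 rho t (a * x) (b * y)))
      with ((a * a) * (b * b) * b * (D1 psi t (a * x) (b * y) * D2 rho t (a * x) (b * y))) by ring.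
    rewrite a2, b2. ring.
Qed.

Lemma symmetry_preserved a b rho psi t : a = 1 \/ a = -1 -> b = 1 \/ b = -1 ->
  flow_pair rho psi -> (forall x y, rho 0 x y = b * rho 0 (a * x) (b * y)) -> 0 <= t ->
  forall x y, D1 psi t x y = b * D1 psi t (a * x) (b * y) /\
    D2 psi t x y = a * D2 psi t (a * x) (b * y).
Proof.
  intros Ha Hb H H0 Ht x y.
  destruct (flow_pair_unique _ _ _ _ t H (flow_pair_reflect a b rho psi Ha Hb H) H0 Ht x y)
    as [_ [E1 E2]].
  destruct H as [_ [Hp _]]. assert (Pp := fun t => smooth_family_partials psi t Hp).
  rewrite E1, E2, D1_reflect, D2_reflect by auto. unfold reflect.
  destruct Ha as [-> | ->], Hb as [-> | ->]; split; ring.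
Qed.

(** [D2 psi] is odd in [x1] and [2 PI]-periodic, and such a function vanishes at [PI]. *)
Lemma normal_velocity_x rho psi t y : flow_pair rho psi ->
  (forall x y, rho 0 (- x) y = rho 0 x y) -> 0 <= t -> D2 psi t PI y = 0.
Proof.
  intros H H0 Ht.
  destruct (symmetry_preserved (-1) 1 rho psi t) with (x := PI) (y := y) as [_ E]; auto.
  - intros x z. rewrite <- H0. replace (-1 * x) with (- x) by ring. now rewrite !Rmult_1_l.
  - assert (Hp : smooth_family psi) by apply H.
    pose proof (proj1 (periodic_end (D2 psi t) (proj1 (smooth_family_D2 _ Hp) t)) y) as P.
    replace (-1 * PI) with (- PI) in E by ring. rewrite Rmult_1_l, <- P in E. lra.
Qed.

Lemma normal_velocity_y rho psi t x : flow_pair rho psi ->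
  (forall x y, rho 0 x (- y) = - rho 0 x y) -> 0 <= t ->
  D1 psi t x PI = 0 /\ D1 psi t x (- PI) = 0.
Proof.
  intros H H0 Ht.
  destruct (symmetry_preserved 1 (-1) rho psi t) with (x := x) (y := PI) as [E _]; auto.
  - intros z y. replace (-1 * y) with (- y) by ring. rewrite H0, Rmult_1_l. ring.
  - assert (Hp : smooth_family psi) by apply H.
    pose proof (proj2 (periodic_end (D1 psi t) (proj1 (smooth_family_D1 _ Hp) t)) x) as P.
    replace (-1 * PI) with (- PI) in E by ring. rewrite Rmult_1_l, <- P in E. lra.
Qed.

(** * A persistent horizontal gradient *)

(** This has a corner at [M], but its square is C^1, which is what [conserved] asks for. *)
Definition excess (M z : R) : R := Rmax (z - M) 0.

Lemma cont1_excess M : cont1 (excess M).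
Proof.
  intros z. unfold excess. pose proof clamp_continuous as H.
  apply (cont_app1 (fun t => Rmax t 0) (fun z => z - M) z H). cont.
Qed.

Lemma excess_nonneg M z : 0 <= excess M z. Proof. apply Rmax_r. Qed.

Lemma is_derive_excess_sqr M z : is_derive (fun z => excess M z ^ 2) z (2 * excess M z).
Proof.
  assert (H : forall w, is_derive (fun w => Rmax w 0 ^ 2) w (2 * Rmax w 0)).
  { intros w. apply is_derive_Reals. intros e He. exists (mkposreal e He). intros h Hh0 Hh.
    simpl in Hh.
    (* In all four sign cases the remainder is at most [h^2], so the increment bound can be [e]
       itself. *)
    assert (B : Rabs (Rmax (w + h) 0 ^ 2 - Rmax w 0 ^ 2 - 2 * Rmax w 0 * h) <= Rabs h * Rabs h).
    { rewrite <- Rabs_mult, (Rabs_pos_eq (h * h)) by nra. apply Rabs_le.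
      unfold Rmax. destruct (Rle_dec (w + h) 0), (Rle_dec w 0); split; nra. }
    replace ((Rmax (w + h) 0 ^ 2 - Rmax w 0 ^ 2) / h - 2 * Rmax w 0)
      with ((Rmax (w + h) 0 ^ 2 - Rmax w 0 ^ 2 - 2 * Rmax w 0 * h) * / h) by (field; auto).
    rewrite Rabs_mult, Rabs_inv. assert (0 < Rabs h) by now apply Rabs_pos_lt.
    apply Rle_lt_trans with (Rabs h * Rabs h * / Rabs h).
    - apply Rmult_le_compat_r; [left; now apply Rinv_0_lt_compat | exact B].
    - rewrite Rmult_assoc, Rinv_r by lra. lra. }
  unfold excess. evar_last.
  - apply (is_derive_comp (fun w => Rmax w 0 ^ 2) (fun z => z - M)); [apply H|].
    auto_derive; auto.
  - unfold scal; simpl; unfold mult; simpl. ring.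
Qed.

(* The line x = PI is invariant, so the maximum of the density on it cannot
   increase. *)
Lemma excess_zero_on_line rho psi M T : flow_pair rho psi ->
  (forall x y, rho 0 (- x) y = rho 0 x y) -> (forall y, rho 0 PI y <= M) -> 0 <= T ->
  forall y, - PI <= y <= PI -> excess M (rho T PI y) = 0.
Proof.
  intros H Heven HM HT. pose proof H as [Hr [Hp [_ Hd]]].
  pose proof (cont1_excess M) as ce. pose proof (smooth_family_cont3 _ Hr) as cr.
  pose proof (rhs_cont3 _ _ Hr Hp) as crhs. pose proof (smooth_family_D1 _ Hp) as P1.
  pose proof (smooth_family_cont3 _ P1) as cp1. pose proof (smooth_family_c3_D2 _ P1) as cp12.
  destruct (bounded_on_box (D2 (D1 psi)) T cp12) as [K HK].
  set (Q := fun t => I1 (fun y => excess M (rho t PI y) ^ 2)).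
  pose proof PI_pos as HP.
  assert (Q0 : Q T = 0).
  { apply (gronwall_zero Q (fun t => I1 (fun y => 2 * excess M
      (rho t PI y) * rhs rho psi t PI y)) K T HT).
    - unfold Q; solve_cont.
    - intros t. unfold Q. replace 0 with (I1 (fun _ => 0)) by (rewrite I1_const; ring).
      apply I1_le; try solve_cont. intros; apply pow2_ge_0.
    - intros t Ht. split.
      + apply (I1_derive_param (fun t y => excess M (rho t PI y) ^ 2)
          (fun t y => 2 * excess M (rho t PI y) * rhs rho psi t PI y)).
        * generalize (open_gt 0 t (proj1 Ht)). apply filter_imp. intros s Hs y.
          evar_last.
          -- apply (is_derive_comp (fun z => excess M z ^ 2) (fun s => rho s PI y));
               [apply is_derive_excess_sqr | apply (Hd s PI y Hs)].
          -- unfold scal; simpl; unfold mult; simpl. ring.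
        * apply cont2_continuity. solve_cont.
        * intros; solve_cont.
      (* The integral of a derivative along the line, zero by periodicity. It moves the derivative
         in the transport term from the density to the vertical velocity, whose slope is bounded by
         [K]. *)
      + assert (E : I1 (fun y => D2 (D1 psi) t PI y * excess M (rho t PI y) ^ 2 +
           D1 psi t PI y * (2 * excess M (rho t PI y) * D2 rho t PI y)) = 0).
        { pose proof (smooth_family_c3_D2 _ Hr) as cr2.
          rewrite (I1_derive (fun y => D1 psi t PI y * excess M (rho t PI y) ^ 2)).
          - rewrite (proj2 (periodic_end (rho t) (proj1 Hr t))).
            rewrite (proj2 (periodic_end (D1 psi t) (proj1 P1 t))). ring.
          - intros y. evar_last.
            + apply (is_derive_mult (fun y => D1 psi t PI y) (fun y => excess M (rho t PI y) ^ 2)).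
              * apply Derive_correct. exact (proj2 (smooth_family_partials _ t P1 PI y)).
              * apply (is_derive_comp (fun z => excess M z ^ 2) (fun y => rho t PI y));
                  [apply is_derive_excess_sqr|].
                apply Derive_correct. exact (proj2 (smooth_family_partials _ t Hr PI y)).
              * apply Rmult_comm.
            + unfold plus, mult, scal; simpl; unfold mult; simpl. unfold D2, d2. ring.
          - solve_cont. }
        rewrite (I1_ext _ (fun y => D2 (D1 psi) t PI y * excess M (rho t PI y) ^ 2 -
          (D2 (D1 psi) t PI y * excess M (rho t PI y) ^ 2 +
           D1 psi t PI y * (2 * excess M (rho t PI y) * D2 rho t PI y)))).
        2:{ intros y. unfold rhs.
            rewrite (normal_velocity_x rho psi t y H Heven) by lra. ring. }
        pose proof (smooth_family_c3_D2 _ Hr) as cr2.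
        rewrite I1_minus, E by solve_cont. unfold Q. rewrite <- I1_scal by solve_cont.
        rewrite Rminus_0_r. apply I1_le; try solve_cont. intros y Hy.
        apply Rmult_le_compat_r; [apply pow2_ge_0|].
        apply Rle_trans with (1 := Rle_abs _). apply HK; lra.
    - unfold Q. rewrite (I1_ext _ (fun _ => 0)); [rewrite I1_const; ring|].
      intros y. unfold excess. rewrite Rmax_right; [ring|]. specialize (HM y). lra. }
  intros y Hy.
  assert (Z : excess M (rho T PI y) ^ 2 = 0).
  { apply (I1_zero (fun y => excess M (rho T PI y) ^ 2)); auto.
    - solve_cont.
    - intros; apply pow2_ge_0. }
  nra.
Qed.

(** The column integral [q] of the squared excess vanishes at [x1 = PI], so everywhere it is at most
    the integral of [|dq|], where the horizontal gradient appears. The integral of [q] over [x1] is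
    the conserved quantity. *)
Lemma gradient_lower_bound rho psi M T : flow_pair rho psi ->
  (forall x y, rho 0 (- x) y = rho 0 x y) -> (forall y, rho 0 PI y <= M) -> 0 <= T ->
  I2 (fun x y => excess M (rho 0 x y) ^ 2) <=
    16 * PI ^ 2 * I2 (fun x y => D1 rho T x y * D1 rho T x y).
Proof.
  intros H Heven HM HT. pose proof H as [Hr [Hp _]].
  pose proof (cont1_excess M) as ce. pose proof (smooth_family_cont2 _ T Hr) as cr.
  pose proof (smooth_family_cont2 _ T (smooth_family_D1 _ Hr)) as cr1. pose proof PI_pos as HP.
  rewrite <- (conserved rho psi (fun z => excess M z ^ 2) (fun z => 2 * excess M z) T H);
    [| solve_cont | apply is_derive_excess_sqr | exact HT].
  set (q := fun x => I1 (fun y => excess M (rho T x y) ^ 2)).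
  set (dq := fun x => I1 (fun y => 2 * excess M (rho T x y) * D1 rho T x y)).
  set (r := fun x => I1 (fun y => 2 * excess M (rho T x y) * Rabs (D1 rho T x y))).
  assert (cdq : cont1 dq) by (unfold dq; solve_cont).
  assert (crr : cont1 r) by (unfold r; solve_cont).
  assert (Hdq : forall x, is_derive q x (dq x)).
  { intros x. destruct (d_comp (fun z => excess M z ^ 2) (fun z => 2 * excess M z) (rho T)
      (is_derive_excess_sqr M) (smooth_family_partials rho T Hr)) as [Pd [Ed _]].
    apply (I1_derive_param (fun x y => excess M (rho T x y) ^ 2)
      (fun x y => 2 * excess M (rho T x y) * D1 rho T x y)).
    - apply filter_forall. intros s y.
      change (D1 rho T s y) with (d1 (rho T) s y).
      pose proof (f_equal (fun g => g s y) Ed) as E. cbv beta in E. rewrite <- E.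
      apply Derive_correct. exact (proj1 (Pd s y)).
    - apply cont2_continuity. solve_cont.
    - intros; solve_cont. }
  assert (r0 : forall x, 0 <= r x).
  { intros x. unfold r. replace 0 with (I1 (fun _ => 0)) by (rewrite I1_const; ring).
    apply I1_le; try solve_cont. intros y _. pose proof (excess_nonneg M (rho T x y)).
    pose proof (Rabs_pos (D1 rho T x y)). nra. }
  assert (qpi : q PI = 0).
  { unfold q. transitivity (I1 (fun _ => 0)); [|rewrite I1_const; ring].
    apply RInt_ext. intros y Hy. rewrite Rmin_left, Rmax_right in Hy by lra.
    rewrite (excess_zero_on_line rho psi M T H Heven HM HT) by lra. apply (Rmult_0_l (0 * 1)). }
  assert (dqr : forall x, - r x <= dq x).
  { intros x. unfold r, dq. replace (- I1 (fun y => 2 * excess M (rho T x y) * Rabs (D1 rho T x y)))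
      with (I1 (fun y => -1 * (2 * excess M (rho T x y) * Rabs (D1 rho T x y)))).
    2:{ rewrite I1_scal by solve_cont. ring. }
    apply I1_le; try solve_cont. intros y _. pose proof (excess_nonneg M (rho T x y)).
    pose proof (Rabs_maj2 (D1 rho T x y)). nra. }
  assert (qr : forall x, - PI <= x <= PI -> q x <= I1 r).
  { intros x Hx.
    assert (E : RInt dq x PI = q PI - q x).
    { apply (is_RInt_unique (V := R_CompleteNormedModule)).
      apply (is_RInt_derive (V := R_CompleteNormedModule)); intros; auto. }
    assert (E2 : RInt (fun x => - r x) x PI = - RInt r x PI).
    { apply (RInt_opp (V := R_CompleteNormedModule)). now apply cont1_ex. }
    assert (L : RInt (fun x => - r x) x PI <= RInt dq x PI).
    { apply RInt_le; [lra | apply cont1_ex; solve_cont | now apply cont1_ex | auto]. }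
    assert (Ch : I1 r = RInt r (- PI) x + RInt r x PI).
    { symmetry. apply (RInt_Chasles (V := R_CompleteNormedModule)); now apply cont1_ex. }
    assert (P0 : 0 <= RInt r (- PI) x).
    { apply RInt_ge_0; [lra | now apply cont1_ex | auto]. }
    lra. }
  set (A := I2 (fun x y => excess M (rho T x y) ^ 2)).
  set (D := I2 (fun x y => D1 rho T x y * D1 rho T x y)).
  assert (A1 : A <= 2 * PI * I1 r).
  { rewrite <- I1_const. apply I1_le; [unfold q; solve_cont | solve_cont | exact qr]. }
  (* Young's inequality with weight [4 PI]: after multiplication by [2 PI] exactly half of [A] is
     absorbed, which leaves the constant [16 PI^2]. *)
  assert (A2 : I1 r <= / (4 * PI) * A + 4 * PI * D).
  { unfold A, D. rewrite <- !I2_scal, <- I2_plus by solve_cont.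
    apply (I2_le (fun x y => 2 * excess M (rho T x y) * Rabs (D1 rho T x y))); try solve_cont.
    intros x y _ _. set (e := excess M (rho T x y)). set (g := D1 rho T x y).
    assert (g2 : g * g = Rabs g * Rabs g) by (rewrite <- Rabs_mult, Rabs_pos_eq; nra).
    rewrite g2. set (u := Rabs g).
    assert (i0 : 0 < / (4 * PI)) by (apply Rinv_0_lt_compat; lra).
    replace (/ (4 * PI) * e ^ 2 + 4 * PI * (u * u))
      with (/ (4 * PI) * (e - 4 * PI * u) ^ 2 + 2 * e * u) by (field; lra).
    pose proof (pow2_ge_0 (e - 4 * PI * u)). nra. }
  assert (A3 : 2 * PI * I1 r <= 2 * PI * (/ (4 * PI) * A + 4 * PI * D)).
  { apply Rmult_le_compat_l; lra. }
  replace (2 * PI * (/ (4 * PI) * A + 4 * PI * D)) with (A / 2 + 8 * PI ^ 2 * D) in A3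
    by (field; lra).
  lra.
Qed.

(** * Potential energy *)

Definition potential (rho : R -> R -> R -> R) (t : R) : R := I2 (fun x y => y * rho t x y).

(** Differentiating the weight leaves the vertical flux [int rho * D1 psi], and an integration by
    parts in [x1] gives the stated form. *)
Lemma potential_derive rho psi t : flow_pair rho psi ->
  (forall x y, rho 0 x (- y) = - rho 0 x y) -> 0 < t ->
  is_derive (potential rho) t (- I2 (fun x y => D1 rho t x y * psi t x y)).
Proof.
  intros H Hodd Ht. pose proof H as [Hr [Hp [_ Hd]]].
  pose proof (smooth_family_cont3 _ Hr) as c3r. pose proof (rhs_cont3 _ _ Hr Hp) as c3rhs.
  evar_last.
  - apply (I2_derive_param (fun t x y => y * rho t x y) (fun t x y => y * rhs rho psi t x y) t Ht);
      [|solve_cont|solve_cont].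
    intros s x y Hs. apply is_derive_scal. apply (Hd s x y Hs).
  - pose proof (smooth_family_D1 _ Hp) as P1. pose proof (smooth_family_D1 _ Hr) as R1.
    pose proof (smooth_family_D2 _ Hr) as R2.
    pose proof (smooth_family_cont2 _ t Hr) as cr. pose proof (smooth_family_cont2 _ t Hp) as cp.
    pose proof (smooth_family_cont2 _ t R1) as cr1. pose proof (smooth_family_cont2 _ t R2) as cr2.
    pose proof (smooth_family_cont2 _ t P1) as cp1.
    pose proof (smooth_family_cont2 _ t (smooth_family_D2 _ Hp)) as cp2.
    pose proof (cont3_cont2 _ t c3rhs) as crhs.
    set (G := fun x y => y * rho t x y).
    assert (G1 : forall x y, is_derive (fun z => G z y) x (y * D1 rho t x y)).
    { intros x y. apply is_derive_scal. apply Derive_correct.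
      exact (proj1 (smooth_family_partials rho t Hr x y)). }
    assert (G2 : forall x y, is_derive (G x) y (rho t x y + y * D2 rho t x y)).
    { intros x y. unfold G. evar_last.
      - apply (is_derive_mult (fun y => y) (rho t x) y 1 (D2 rho t x y)).
        + apply (is_derive_id (K := R_AbsRing)).
        + apply Derive_correct. exact (proj2 (smooth_family_partials rho t Hr x y)).
        + apply Rmult_comm.
      - unfold plus, mult; simpl. ring. }
    assert (E1 : d1 G = fun x y => y * D1 rho t x y).
    { extensionality x; extensionality y. apply is_derive_unique, G1. }
    assert (E2 : d2 G = fun x y => rho t x y + y * D2 rho t x y).
    { extensionality x; extensionality y. apply is_derive_unique, G2. }
    (* [G] may jump across [x2 = PI], but the vertical velocity vanishes there, so no boundary term
       arises. *)
    assert (Z : I2 (fun x y => D2 psi t x y * d1 G x y - D1 psi t x y * d2 G x y) = 0).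
    { apply transport_mean_zero; auto.
      - unfold G; solve_cont.
      - rewrite E1; solve_cont.
      - rewrite E2; solve_cont.
      - intros x y; split; eexists; [apply G1 | apply G2].
      - intros y. unfold G. f_equal. apply (periodic_end (rho t)), Hr.
      - intros x. destruct (normal_velocity_y rho psi t x H Hodd (Rlt_le _ _ Ht)) as [-> ->].
        now rewrite !Rmult_0_r. }
    rewrite E1, E2 in Z.
    rewrite (I2_ext _ (fun x y => y * rhs rho psi t x y - D1 psi t x y * rho t x y)) in Z
      by (intros; unfold rhs; ring).
    rewrite I2_minus in Z by solve_cont.
    pose proof (smooth_family_ibp1 rho psi t Hr Hp) as B. rewrite B.
    rewrite (I2_ext (fun x y => rho t x y * D1 psi t x y) (fun x y => D1 psi t x y * rho t x y))
      by (intros; ring). apply Rminus_diag_uniq in Z. rewrite Ropp_involutive. exact Z.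
Qed.

(** On the period [|y rho| <= PI^2 + rho^2], and the L^2 norm of the density is conserved. *)
Lemma potential_bounded rho psi : flow_pair rho psi ->
  exists B, forall t, 0 <= t -> Rabs (potential rho t) <= B.
Proof.
  intros H. pose proof H as [Hr _]. pose proof (smooth_family_cont3 _ Hr) as cr3. pose proof PI_pos.
  exists (I2 (fun _ _ => PI ^ 2) + I2 (fun x y => rho 0 x y ^ 2)). intros t Ht.
  rewrite <- (conserved rho psi (fun z => z ^ 2) (fun z => 2 * z) t H); auto.
  - pose proof (smooth_family_cont2 _ t Hr) as cr. unfold potential.
    eapply Rle_trans; [apply I2_abs; solve_cont|]. rewrite <- I2_plus by solve_cont.
    apply I2_le; try solve_cont. intros x y _ Hy.
    assert (y ^ 2 <= PI ^ 2) by nra. set (r := rho t x y).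
    pose proof (pow2_ge_0 (y + r)). pose proof (pow2_ge_0 (y - r)). pose proof (pow2_ge_0 r).
    apply Rabs_le. split; nra.
  - solve_cont.
  - intros z. auto_derive; auto. ring.
Qed.

(** * Spectral interpolation *)

(** Partial sums of the square of [Hdot_norm]; bounds on them avoid arithmetic in the extended
    reals. *)
Definition hdot_sum (s : R) (f : R -> R -> R) (N : nat) : R :=
  (2 * PI) ^ 2 * box_sum (omit0 (G := R_AbelianMonoid) (fun k1 k2 =>
    Rpower (normk2 k1 k2) s * Cmod (fourier f k1 k2) ^ 2)) N.

(** Here [n] stands for [|k|^2]: the first term is at least [1] up to the cut-off [n = r], the
    second beyond it. *)
Lemma interpolation_weight n r s : 0 < n -> 0 < r -> 0 < s ->
  1 <= r * / n + Rpower r (- s) * Rpower n s.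
Proof.
  intros Hn Hr Hs.
  assert (p1 : 0 < Rpower r (- s) * Rpower n s) by (apply Rmult_lt_0_compat; apply exp_pos).
  assert (p2 : 0 < r * / n) by (apply Rmult_lt_0_compat; [|apply Rinv_0_lt_compat]; lra).
  destruct (Rle_dec n r).
  - assert (1 <= r * / n) by (apply Rmult_le_reg_r with n; [lra|]; field_simplify; lra). lra.
  - assert (Rpower r s <= Rpower n s) by (apply Rle_Rpower_l; lra).
    assert (Rpower r (- s) * Rpower r s = 1).
    { rewrite <- Rpower_plus. replace (- s + s) with 0 by ring. now apply Rpower_O. }
    assert (0 < Rpower r (- s)) by apply exp_pos.
    assert (Rpower r (- s) * Rpower r s <= Rpower r (- s) * Rpower n s)
      by (apply Rmult_le_compat_l; lra).
    lra.
Qed.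

(** Compared mode by mode. By [k1^2 <= |k|^2] the horizontal derivative costs at most one power of
    [|k|^2], so the exponent [s + 1] on [g] controls the exponent [s] on [D1 g]. *)
Lemma interpolation g t r s H : smooth_family g -> 0 < r -> 0 < s ->
  (forall N, hdot_sum (s + 1) (g t) N <= H) ->
  I2 (fun x y => D1 g t x y * D1 g t x y) <=
    r * I2 (fun x y => D1 g t x y * inv_lap (D1 g) t x y) + Rpower r (- s) * H.
Proof.
  intros Hg Hr Hs HH. pose proof (smooth_family_D1 _ Hg) as Hg1.
  pose proof (smooth_family_cont2 _ t Hg) as cg. pose proof (smooth_family_cont2 _ t Hg1) as cg1.
  pose proof (parseval _ t Hg1) as L1. pose proof (parseval_inv _ t Hg1) as L2.
  apply (is_lim_seq_scal_l _ r (Finite _)) in L2.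
  apply (is_lim_seq_le _ _ (Finite _) (Finite _)) with (2 := L1)
    (3 := is_lim_seq_plus' _ _ _ _ L2 (is_lim_seq_const (Rpower r (- s) * H))).
  intros N.
  apply Rle_trans with (r * rect (omit0 (G := R_AbelianMonoid)
      (fun k1 k2 => / normk2 k1 k2 * energy (D1 g t) k1 k2)) N N +
    Rpower r (- s) * hdot_sum (s + 1) (g t) N).
  2:{ apply Rplus_le_compat_l, Rmult_le_compat_l; [left; apply exp_pos | apply HH]. }
  unfold hdot_sum. rewrite box_sum_rect. unfold rect.
  rewrite <- !zsum_scal, <- zsum_plus. apply zsum_le. intros k1.
  rewrite <- !zsum_scal, <- zsum_plus. apply zsum_le. intros k2.
  unfold energy. rewrite !Cmod2_fourier, Ac_D1, Bc_D1 by auto.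
  set (c := Ac k1 k2 (g t) ^ 2 + Bc k1 k2 (g t) ^ 2).
  replace ((IZR k1 * Bc k1 k2 (g t)) ^ 2 + (- (IZR k1 * Ac k1 k2 (g t))) ^ 2)
    with (IZR k1 ^ 2 * c) by (unfold c; ring).
  assert (c0 : 0 <= c) by (unfold c; nra).
  unfold omit0. destruct (andb _ _) eqn:E.
  (* The omitted frequency has [k1 = 0], so it contributes nothing to the horizontal derivative. *)
  - apply andb_prop in E. destruct E as [E1 _]. apply Z.eqb_eq in E1. subst k1.
    change (@zero R_AbelianMonoid) with 0. simpl. lra.
  - rewrite !Cmod2_fourier, Ac_D1, Bc_D1 by auto. fold c.
    replace ((IZR k1 * Bc k1 k2 (g t)) ^ 2 + (- (IZR k1 * Ac k1 k2 (g t))) ^ 2)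
      with (IZR k1 ^ 2 * c) by (unfold c; ring).
    apply normk2_ge1 in E. set (n := normk2 k1 k2) in *.
    rewrite Rpower_plus, Rpower_1 by lra.
    pose proof (interpolation_weight n r s ltac:(lra) Hr Hs) as W.
    assert (kn : IZR k1 ^ 2 <= n) by (unfold n, normk2; nra).
    set (P := Rpower r (- s) * Rpower n s) in *.
    assert (P0 : 0 < P) by (apply Rmult_lt_0_compat; apply exp_pos).
    set (F := (2 * PI) ^ 2 * c).
    assert (F0 : 0 <= F) by (unfold F; pose proof PI_pos; nra).
    replace ((2 * PI) ^ 2 * (IZR k1 ^ 2 * c)) with (IZR k1 ^ 2 * F) by (unfold F; ring).
    replace (r * (/ n * (IZR k1 ^ 2 * F)) + Rpower r (- s) * ((2 * PI) ^ 2 * (Rpower n s * n * c)))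
      with ((r * / n) * (IZR k1 ^ 2 * F) + P * (n * F)) by (unfold P, F; ring).
    assert (0 <= IZR k1 ^ 2 * F) by (apply Rmult_le_pos; [apply pow2_ge_0 | exact F0]).
    assert (P * (IZR k1 ^ 2 * F) <= P * (n * F)).
    { apply Rmult_le_compat_l; [lra|]. apply Rmult_le_compat_r; auto. }
    nra.
Qed.

(** * Growth *)

Lemma growth rho psi g c0 s L T : flow_pair rho psi -> psi = inv_lap (D1 rho) ->
  (forall x y, rho 0 x (- y) = - rho 0 x y) -> smooth_family g -> D1 g = D1 rho -> 0 < c0 -> 0 < s ->
  (forall t, 0 <= t -> c0 <= I2 (fun x y => D1 rho t x y * D1 rho t x y)) ->
  0 <= L -> ~ (forall t, T <= t -> 0 < t -> forall N, hdot_sum (s + 1) (g t) N <= L * Rpower t s).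
Proof.
  intros H Epsi Hodd Hg Eg Hc0 Hs Hlow HL HH.
  pose proof H as [Hr _].
  (* With the cut-off [lam * t], where [lam^s = X], the high-frequency term becomes
     [L / X <= c0 / 2] for every [t], leaving [c0 / 2] to the dissipation. The [+ 1] keeps [X]
     positive when [L = 0]. *)
  set (X := 2 * L / c0 + 1).
  assert (X0 : 1 <= X).
  { unfold X. assert (0 <= 2 * L / c0); [|lra].
    apply Rmult_le_pos; [lra | left; now apply Rinv_0_lt_compat]. }
  set (lam := Rpower X (/ s)).
  assert (lam0 : 0 < lam) by apply exp_pos.
  assert (lamX : Rpower lam (- s) = / X).
  { unfold lam. rewrite Rpower_mult. replace (/ s * - s) with (Ropp 1) by (field; lra).
    rewrite Rpower_Ropp, Rpower_1; lra. }
  set (c := c0 / (2 * lam)).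
  assert (cp : 0 < c) by (apply Rdiv_lt_0_compat; lra).
  assert (dis : forall t, Rmax T 1 <= t ->
     c * / t <= I2 (fun x y => D1 rho t x y * psi t x y)).
  { intros t Ht. pose proof (Rmax_l T 1). pose proof (Rmax_r T 1).
    assert (t0 : 0 < t) by lra.
    pose proof (interpolation g t (lam * t) s (L * Rpower t s) Hg) as I.
    rewrite Eg, <- Epsi in I. specialize (I ltac:(nra) Hs (HH t ltac:(lra) t0)).
    specialize (Hlow t ltac:(lra)).
    assert (E : Rpower (lam * t) (- s) * (L * Rpower t s) = L / X).
    { rewrite <- Rpower_mult_distr, lamX by lra.
      replace (/ X * Rpower t (- s) * (L * Rpower t s))
        with (L / X * (Rpower t (- s) * Rpower t s)) by (field; lra).
      rewrite <- Rpower_plus. replace (- s + s) with 0 by ring. rewrite Rpower_O by lra. ring. }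
    rewrite E in I.
    assert (LX : L / X <= c0 / 2).
    { apply Rmult_le_reg_r with X; [lra|]. unfold Rdiv at 1.
      rewrite Rmult_assoc, Rinv_l by lra. unfold X.
      replace (c0 / 2 * (2 * L / c0 + 1)) with (L + c0 / 2) by (field; lra). lra. }
    set (d := I2 (fun x y => D1 rho t x y * psi t x y)) in *.
    apply Rmult_le_reg_r with (lam * t); [nra|].
    replace (c * / t * (lam * t)) with (c0 / 2) by (unfold c; field; lra). lra. }
  destruct (potential_bounded rho psi H) as [B HB].
  set (T1 := Rmax T 1). assert (T1p : 1 <= T1) by apply Rmax_r.
  (* From [T1] to this time the logarithm grows by [(2 B + 1) / c], so the potential energy would
     drop by [2 B + 1], more than its bound [B] allows. *)
  set (t := T1 * exp ((2 * B + 1) / c)).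
  pose proof (smooth_family_cont3 _ Hr) as cr.
  assert (B0 : 0 <= B) by (specialize (HB 0 ltac:(lra)); pose proof (Rabs_pos
    (potential rho 0)); lra).
  assert (q0 : 0 <= (2 * B + 1) / c).
  { apply Rmult_le_pos; [lra | left; now apply Rinv_0_lt_compat]. }
  assert (tT : T1 <= t).
  { unfold t. pose proof (exp_ineq1_le ((2 * B + 1) / c)). nra. }
  (* [ln] of a positive clamp, to have a function continuous on the whole line *)
  assert (M : potential rho t + c * ln t <= potential rho T1 + c * ln T1).
  { set (lnc := fun z => ln (Rmax z 1)).
    assert (clnc : cont1 lnc).
    { intros z. unfold lnc.
      apply (continuous_comp (fun z => Rmax z 1) ln).
      - apply continuous_ext with (fun z => (z + 1 + Rabs (z - 1)) / 2).
        + intros w. unfold Rmax, Rabs. destruct (Rcase_abs (w - 1)), (Rle_dec w 1); lra.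
        + cont.
      - apply (ex_derive_continuous ln). eexists. apply is_derive_ln.
        pose proof (Rmax_r z 1). lra. }
    assert (M : potential rho t + c * lnc t <= potential rho T1 + c * lnc T1).
    { apply (nonincreasing_of_derive (fun z => potential rho z + c * lnc z)
        (fun z => - I2 (fun x y => D1 rho z x y * psi z x y) + c * / z) T1 t tT).
      - unfold potential. solve_cont.
      - intros z Hz. split.
        + apply (is_derive_plus (V := R_NormedModule)).
          * apply (potential_derive rho psi z H Hodd). lra.
          * apply is_derive_scal.
            apply is_derive_ext_loc with ln; [|apply is_derive_ln; lra].
            generalize (open_gt 1 z ltac:(lra)). apply filter_imp. intros w Hw.
            unfold lnc. now rewrite Rmax_left by lra.
        + specialize (dis z ltac:(fold T1; lra)). lra. }
    unfold lnc in M. rewrite !Rmax_left in M by lra. exact M. }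
  assert (E : ln t = ln T1 + (2 * B + 1) / c).
  { unfold t. rewrite ln_mult, ln_exp; [reflexivity | lra | apply exp_pos]. }
  rewrite E in M.
  replace (c * (ln T1 + (2 * B + 1) / c)) with (c * ln T1 + (2 * B + 1)) in M by (field; lra).
  pose proof (HB t ltac:(lra)) as h1. pose proof (HB T1 ltac:(lra)) as h2.
  apply Rabs_le_between in h1. apply Rabs_le_between in h2. lra.
Qed.

(** * The perturbation *)

Lemma Cn_family_const n f : Cn n f <-> Cn_family n (fun _ => f).
Proof.
  assert (C0 : forall f, cont2 f <-> cont3 (fun _ => f)).
  { intros h; split; intros H; [solve_cont | apply (cont3_cont2 (fun _ => h) 0 H)]. }
  revert f; induction n as [|n IH]; intros f; simpl; rewrite <- cont2_continuity, (C0 f).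
  - tauto.
  - change (D1 (fun _ => f)) with (fun _ : R => d1 f).
    change (D2 (fun _ => f)) with (fun _ : R => d2 f).
    rewrite (IH (d1 f)), (IH (d2 f)).
    split; intros [a [b c]]; split; [exact a | split; [intros _; exact b | exact c] |
      exact a | split; [exact (b 0) | exact c]].
Qed.

Lemma smooth_family_const f : smooth_torus f <-> smooth_family (fun _ => f).
Proof.
  split; intros [Hp H]; split; auto.
  - intros n. now apply Cn_family_const.
  - exact (Hp 0).
  - intros n. now apply Cn_family_const.
Qed.

(** A class closed under both partial derivatives, so smoothness follows by induction on the order
    and derivatives are computed on the coefficients. *)
Definition trig (a b c m n : R) (x y : R) : R :=
  (a + b * cos x + c * sin x) * (m * cos y + n * sin y).

Lemma is_derive_trig1 a b c m n x y :
  is_derive (fun z => trig a b c m n z y) x (trig 0 c (- b) m n x y).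
Proof. unfold trig. auto_derive; auto. ring. Qed.

Lemma is_derive_trig2 a b c m n x y :
  is_derive (fun z => trig a b c m n x z) y (trig a b c n (- m) x y).
Proof. unfold trig. auto_derive; auto. ring. Qed.

Lemma D1_trig a b c m n : D1 (fun _ => trig a b c m n) = fun _ => trig 0 c (- b) m n.
Proof.
  extensionality t; extensionality x; extensionality y.
  apply is_derive_unique, is_derive_trig1.
Qed.

Lemma D2_trig a b c m n : D2 (fun _ => trig a b c m n) = fun _ => trig a b c n (- m).
Proof.
  extensionality t; extensionality x; extensionality y.
  apply is_derive_unique, is_derive_trig2.
Qed.

Lemma smooth_family_trig a b c m n : smooth_family (fun _ => trig a b c m n).
Proof.
  split.
  - intros _ x y. unfold trig. pose proof (cos_sin_Zperiod x 1) as [cx sx].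
    pose proof (cos_sin_Zperiod y 1) as [cy sy]. rewrite !Rmult_1_r in *.
    now rewrite cx, sx, cy, sy.
  - intros k. revert a b c m n. induction k as [|k IH]; intros a b c m n.
    + split; auto. unfold trig; solve_cont.
    + split; [unfold trig; solve_cont|]. split; [|split].
      * intros _ x y. split; eexists; [apply is_derive_trig1 | apply is_derive_trig2].
      * rewrite D1_trig. apply IH.
      * rewrite D2_trig. apply IH.
Qed.

(** This is [(1 + cos x1) sin x2]: zero on [x1 = PI] and [2 sin x2] on [x1 = 0]. *)
Definition bump : R -> R -> R := trig 1 1 0 0 1.

Lemma smooth_family_bump : smooth_family (fun _ => bump). Proof. apply smooth_family_trig. Qed.

Lemma coefficient_scal (c : R) (f : R -> R -> R) k1 k2 : cont2 f ->
  Ac k1 k2 (fun x y => c * f x y) = c * Ac k1 k2 f /\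
  Bc k1 k2 (fun x y => c * f x y) = c * Bc k1 k2 f.
Proof.
  intros Hf. pose proof (cont2_cosk k1 k2). pose proof (cont2_sink k1 k2). unfold Ac, Bc. split.
  - rewrite (I2_ext _ (fun x y => c * (f x y * cosk k1 k2 x y))) by (intros; ring).
    rewrite I2_scal by solve_cont. ring.
  - rewrite (I2_ext _ (fun x y => c * (f x y * sink k1 k2 x y))) by (intros; ring).
    rewrite I2_scal by solve_cont. ring.
Qed.

(** No integral is evaluated. From [D2 (D2 F) = - F] and [D1 (D1 (D1 F)) = - D1 F], a nonzero
    coefficient needs [k2^2 = 1] and [k1 (k1^2 - 1) = 0]. *)
Lemma bump_coefficients k1 k2 :
  (-1 <= k1 <= 1)%Z /\ (-1 <= k2 <= 1)%Z \/ (Ac k1 k2 bump = 0 /\ Bc k1 k2 bump = 0).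
Proof.
  set (F := fun _ : R => bump). assert (HF : smooth_family F) by apply smooth_family_bump.
  assert (e2 : forall x y, D2 (D2 F) 0 x y = -1 * bump x y).
  { intros x y. unfold F, bump. rewrite !D2_trig. unfold trig. ring. }
  assert (e1 : forall x y, D1 (D1 (D1 F)) 0 x y = -1 * D1 F 0 x y).
  { intros x y. unfold F, bump. rewrite !D1_trig. unfold trig. ring. }
  pose proof (smooth_family_cont2 F 0 HF) as c0. pose proof (smooth_family_D1 _ HF) as H1.
  pose proof (smooth_family_D2 _ HF) as H2.
  pose proof (smooth_family_D1 _ H1) as H11.
  assert (E2 : D2 (D2 F) 0 = fun x y => -1 * bump x y) by
    (extensionality x; extensionality y; auto).
  assert (E1 : D1 (D1 (D1 F)) 0 = fun x y => -1 * D1 F 0 x y)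
    by (extensionality x; extensionality y; auto).
  destruct (coefficient_scal (-1) bump k1 k2 c0) as [a2 b2].
  destruct (coefficient_scal (-1) (D1 F 0) k1 k2 (smooth_family_cont2 _ 0 H1)) as [a1 b1].
  rewrite <- E2 in a2, b2. rewrite <- E1 in a1, b1.
  rewrite Ac_D2, Bc_D2 in a2 by auto. rewrite Bc_D2, Ac_D2 in b2 by auto.
  rewrite (Ac_D1 k1 k2 _ 0 H11), (Bc_D1 k1 k2 _ 0 H1), (Ac_D1 k1 k2 _ 0 HF) in a1.
  rewrite (Bc_D1 k1 k2 _ 0 H11), (Ac_D1 k1 k2 _ 0 H1), (Bc_D1 k1 k2 _ 0 HF) in b1.
  change (F 0) with bump in *.
  set (A := Ac k1 k2 bump) in *. set (B := Bc k1 k2 bump) in *.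
  assert (nz : forall k, ~ (-1 <= k <= 1)%Z -> 1 < IZR k ^ 2).
  { intros k Hk. replace (IZR k ^ 2) with (IZR (k * k)) by (rewrite mult_IZR; ring).
    apply IZR_lt. nia. }
  destruct (classic (-1 <= k2 <= 1)%Z) as [h2|h2].
  - destruct (classic (-1 <= k1 <= 1)%Z) as [h1|h1]; [tauto|]. right.
    specialize (nz k1 h1). set (k := IZR k1) in *.
    assert (k0 : k * (k ^ 2 - 1) <> 0) by (intros Z; apply Rmult_integral in Z; destruct Z; nra).
    split.
    + assert (E : k * (k ^ 2 - 1) * A = 0) by lra. apply Rmult_integral in E. tauto.
    + assert (E : k * (k ^ 2 - 1) * B = 0) by lra. apply Rmult_integral in E. tauto.
  - right. specialize (nz k2 h2). set (k := IZR k2) in *.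
    assert (k0 : k ^ 2 - 1 <> 0) by lra.
    split.
    + assert (E : (k ^ 2 - 1) * A = 0) by lra. apply Rmult_integral in E. tauto.
    + assert (E : (k ^ 2 - 1) * B = 0) by lra. apply Rmult_integral in E. tauto.
Qed.

Lemma H_norm_scaled_bump k : 0 < k -> exists K, 0 <= K /\
  forall c e, 0 <= e -> c ^ 2 * K <= e ^ 2 ->
    Rbar_le (H_norm k (fun x y => c * bump x y)) (Finite e).
Proof.
  intros Hk. set (d := decay_const (fun _ => bump) 0).
  (* On the frequencies of [bump], [1 + |k|^2 <= 3] and [wt k1 * wt k2 >= 1/4]. The [4] allows a
     bound by the weights, whose double sum is at most [25]. *)
  set (K1 := 4 * Rpower 3 k * d ^ 2).
  assert (R3 : 0 < Rpower 3 k) by apply exp_pos.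
  assert (K10 : 0 <= K1) by (unfold K1; pose proof (pow2_ge_0 d); nra).
  exists ((2 * PI) ^ 2 * (25 * K1)). split.
  { apply Rmult_le_pos; [apply pow2_ge_0 | lra]. }
  intros c e He Hc. pose proof (smooth_family_cont2 _ 0 smooth_family_bump) as cb.
  assert (cb' : cont2 (fun x y => c * bump x y)) by solve_cont.
  assert (T : forall k1 k2, Rpower (1 + normk2 k1 k2) k *
     Cmod (fourier (fun x y => c * bump x y) k1 k2) ^ 2 <= c ^ 2 * K1 * wt k1 * wt k2).
  { intros k1 k2. rewrite Cmod2_fourier by auto.
    destruct (coefficient_scal c bump k1 k2 cb) as [-> ->].
    pose proof (wt_pos k1) as w1. pose proof (wt_pos k2) as w2.
    assert (c20 : 0 <= c ^ 2) by apply pow2_ge_0.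
    destruct (bump_coefficients k1 k2) as [[h1 h2] | [-> ->]].
    2:{ replace ((c * 0) ^ 2 + (c * 0) ^ 2) with 0 by ring. rewrite Rmult_0_r.
        apply Rmult_le_pos; [apply Rmult_le_pos; [now apply Rmult_le_pos | lra] | lra]. }
    destruct (coefficient_decay k1 k2 (fun _ => bump) 0 smooth_family_bump) as [a b].
    fold d in a, b.
    assert (sq : forall j, (-1 <= j <= 1)%Z -> 0 <= IZR j ^ 2 <= 1).
    { intros j Hj. assert (j = -1 \/ j = 0 \/ j = 1)%Z as [-> | [-> | ->]] by lia; split; simpl; lra. }
    assert (half : forall j, (-1 <= j <= 1)%Z -> / 2 <= wt j).
    { intros j Hj. specialize (sq j Hj). unfold wt. apply Rinv_le_contravar; lra. }
    pose proof (half k1 h1) as u1. pose proof (half k2 h2) as u2.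
    pose proof (wt_le1 k1) as v1. pose proof (wt_le1 k2) as v2.
    assert (d0 : 0 <= d) by apply (decay_const_pos (fun _ => bump) 0 smooth_family_bump).
    assert (ww : wt k1 * wt k2 <= 1) by nra.
    assert (ww' : / 4 <= wt k1 * wt k2) by nra.
    assert (a' : Rabs (Ac k1 k2 bump) <= d / 2).
    { eapply Rle_trans; [exact a|]. rewrite <- (Rmult_1_r (d / 2)) at 2.
      apply Rmult_le_compat_l; lra. }
    assert (b' : Rabs (Bc k1 k2 bump) <= d / 2).
    { eapply Rle_trans; [exact b|]. rewrite <- (Rmult_1_r (d / 2)) at 2.
      apply Rmult_le_compat_l; lra. }
    apply Rabs_le_between in a'. apply Rabs_le_between in b'.
    assert (AB : Ac k1 k2 bump ^ 2 + Bc k1 k2 bump ^ 2 <= d ^ 2) by nra.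
    assert (n3 : Rpower (1 + normk2 k1 k2) k <= Rpower 3 k).
    { apply Rle_Rpower_l; [lra|]. unfold normk2. specialize (sq k1 h1) as s1.
      specialize (sq k2 h2). lra. }
    replace ((c * Ac k1 k2 bump) ^ 2 + (c * Bc k1 k2 bump) ^ 2)
      with (c ^ 2 * (Ac k1 k2 bump ^ 2 + Bc k1 k2 bump ^ 2)) by ring.
    apply Rle_trans with (Rpower 3 k * (c ^ 2 * d ^ 2)).
    - apply Rmult_le_compat; [left; apply exp_pos | | exact n3 |].
      + apply Rmult_le_pos; [exact c20 | nra].
      + apply Rmult_le_compat_l; auto.
    - unfold K1.
      replace (c ^ 2 * (4 * Rpower 3 k * d ^ 2) * wt k1 * wt k2)
        with (Rpower 3 k * (c ^ 2 * d ^ 2) * (4 * (wt k1 * wt k2))) by ring.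
      rewrite <- (Rmult_1_r (Rpower 3 k * (c ^ 2 * d ^ 2))) at 1.
      apply Rmult_le_compat_l; [|lra]. apply Rmult_le_pos; [lra|].
      apply Rmult_le_pos; [lra | apply pow2_ge_0]. }
  set (u := fun N : nat => (2 * PI) ^ 2 * box_sum (G := R_AbelianMonoid) (fun k1 k2 =>
      Rpower (1 + normk2 k1 k2) k * Cmod (fourier (fun x y => c * bump x y) k1 k2) ^ 2) N).
  assert (B : forall N, u N <= e ^ 2).
  { intros N. unfold u. rewrite box_sum_rect. apply Rle_trans with (2 := Hc).
    replace (c ^ 2 * ((2 * PI) ^ 2 * (25 * K1))) with ((2 * PI) ^ 2 * (c ^ 2 * K1 * 25)) by ring.
    apply Rmult_le_compat_l; [apply pow2_ge_0|].
    apply Rle_trans with (zsum N (fun k1 => (c ^ 2 * K1 * zsum N wt) * wt k1)).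
    - apply zsum_le. intros k1.
      replace (c ^ 2 * K1 * zsum N wt * wt k1) with (c ^ 2 * K1 * wt k1 * zsum N wt) by ring.
      rewrite <- zsum_scal. apply zsum_le. intros k2. apply T.
    - rewrite zsum_scal. pose proof (zsum_wt_bound N) as W.
      assert (0 <= c ^ 2 * K1) by (apply Rmult_le_pos; [apply pow2_ge_0 | lra]).
      rewrite Rmult_assoc. apply Rmult_le_compat_l; [lra | nra]. }
  change (Rbar_le (Rbar_sqrt (Lim_seq u)) e).
  assert (L : Rbar_le (Lim_seq u) (e ^ 2)).
  { rewrite <- (Lim_seq_const (e ^ 2)). apply Lim_seq_le_loc. exists O. auto. }
  destruct (Lim_seq u) as [v| |]; simpl in *.
  - rewrite <- (sqrt_pow2 e) by auto. apply sqrt_le_1_alt. simpl. exact L.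
  - exact L.
  - exact He.
Qed.

(** * Conclusion *)

(** A maximum with [sin y0 = 0] would not be raised by the perturbation. At such points an odd
    periodic function vanishes, so the maximum is [0]; oddness then makes the value at [PI / 2]
    nonnegative, and [PI / 2] is a maximum too. *)
Lemma exists_max rho_s : smooth_torus rho_s -> odd_x2 rho_s ->
  exists y0, - PI <= y0 <= PI /\ sin y0 <> 0 /\ forall y, rho_s 0 y <= rho_s 0 y0.
Proof.
  intros H Hodd. pose proof PI_pos as HP. pose proof (proj1 H) as Hp.
  pose proof (smooth_family_cont2 _ 0 (proj1 (smooth_family_const rho_s) H)) as C. cbv beta in C.
  destruct (continuity_ab_maj (rho_s 0) (- PI) PI pi_le) as [y0 [Hmax Hy0]].
  { intros z _. apply continuity_pt_filterlim. apply (cont2_row rho_s 0 C). }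
  assert (Hmax' : forall y, rho_s 0 y <= rho_s 0 y0).
  { intros y. destruct (exists_shift y) as [n Hn].
    rewrite <- (periodZ (rho_s 0) (fun y => proj2 (Hp 0 y)) (- n) y). rewrite opp_IZR.
    replace (y + 2 * - IZR n * PI) with (y - 2 * IZR n * PI) by ring. apply Hmax, Hn. }
  destruct (Req_dec (sin y0) 0) as [E|E]; [|exists y0; auto].
  assert (Z : rho_s 0 y0 = 0).
  { assert (Z0 : rho_s 0 0 = 0) by (pose proof (Hodd 0 0) as O; rewrite Ropp_0 in O; lra).
    assert (ZP : rho_s 0 PI = 0 /\ rho_s 0 (- PI) = 0).
    { pose proof (proj2 (periodic_end rho_s Hp) 0) as P. pose proof (Hodd 0 PI). lra. }
    assert (y0 = 0 \/ y0 = PI \/ y0 = - PI) as [-> | [-> | ->]]; try tauto.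
    apply NNPP. intros N. destruct (Rlt_dec 0 y0).
    - assert (0 < sin y0) by (apply sin_gt_0; lra). lra.
    - assert (0 < sin (- y0)) by (apply sin_gt_0; lra). rewrite sin_neg in H0. lra. }
  exists (PI / 2). split; [lra|]. split; [rewrite sin_PI2; lra|].
  intros y. pose proof (Hmax' y). pose proof (Hmax' (- (PI / 2))) as h.
  rewrite Hodd in h. lra.
Qed.

Lemma rect_mono (a : Z -> Z -> R) N : (forall k1 k2, 0 <= a k1 k2) ->
  rect a N N <= rect a (S N) (S N).
Proof.
  intros H.
  assert (step : forall b M, (forall k, 0 <= b k) -> zsum M b <= zsum (S M) b).
  { intros b M Hb. cbn [zsum]. pose proof (Hb (Z.of_nat (S M))).
    pose proof (Hb (- Z.of_nat (S M))%Z). lra. }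
  unfold rect. apply Rle_trans with (zsum N (fun k1 => zsum (S N) (a k1))).
  - apply zsum_le. intros k1. apply step, H.
  - apply step. intros k1.
    apply Rle_trans with (zsum (S N) (fun _ => 0)); [|now apply zsum_le].
    generalize (S N). induction n; cbn [zsum]; lra.
Qed.

Lemma hdot_sum_le_norm s f v : Hdot_norm s f = Finite v -> forall N, hdot_sum s f N <= v ^ 2.
Proof.
  intros Hv.
  change (Rbar_sqrt (Lim_seq (hdot_sum s f)) = Finite v) in Hv.
  assert (pos : forall k1 k2, 0 <= omit0 (G := R_AbelianMonoid) (fun k1 k2 =>
    Rpower (normk2 k1 k2) s * Cmod (fourier f k1 k2) ^ 2) k1 k2).
  { intros k1 k2. unfold omit0. destruct (andb _ _); [apply Rle_refl|].
    apply Rmult_le_pos; [left; apply exp_pos | apply pow2_ge_0]. }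
  assert (mono : forall N, hdot_sum s f N <= hdot_sum s f (S N)).
  { intros N. unfold hdot_sum. rewrite !box_sum_rect.
    apply Rmult_le_compat_l; [apply pow2_ge_0 | now apply rect_mono]. }
  pose proof (Lim_seq_correct _ (ex_lim_seq_incr _ mono)) as L.
  assert (p0 : 0 <= hdot_sum s f 0).
  { unfold hdot_sum. rewrite box_sum_rect. apply Rmult_le_pos; [apply pow2_ge_0|].
    apply (pos 0%Z 0%Z). }
  destruct (Lim_seq (hdot_sum s f)) as [l| |] eqn:E; simpl in Hv; try discriminate.
  - pose proof (is_lim_seq_incr_compare _ _ L mono) as B. inversion Hv as [Hv'].
    intros N. rewrite pow2_sqrt; [apply B|]. apply Rle_trans with (1 := p0), B.
  (* [Rbar_sqrt] sends [m_infty] to the finite value [0], so this case is excluded by the sign of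
     the first partial sum. *)
  - exfalso. assert (Rbar_le (hdot_sum s f 0) m_infty); [|auto].
    apply (is_lim_seq_le (fun _ => hdot_sum s f 0) (hdot_sum s f)) with (3 := L).
    + intros n. induction n as [|n IHn]; [apply Rle_refl|]. apply Rle_trans with (1 := IHn), mono.
    + apply is_lim_seq_const.
Qed.

Lemma limsup_infty_p_infty (F : R -> Rbar) :
  (forall T L, 0 <= L -> ~ (forall t, T <= t -> Rbar_le (F t) (Finite L))) ->
  limsup_infty F = p_infty.
Proof.
  intros H. unfold limsup_infty, Rbar_glb. destruct (Rbar_ex_glb _) as [g [Hg0 Hg]]. simpl.
  assert (P : Rbar_le p_infty g).
  { apply Hg. intros y [T ->]. unfold Rbar_lub. destruct (Rbar_ex_lub _) as [l [Hl Hl0]]. simpl.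
    destruct l as [l| |]; [exfalso | exact I | exfalso].
    - apply (H T (Rabs l) (Rabs_pos l)). intros t Ht.
      apply Rbar_le_trans with (Finite l); [apply Hl; eauto | apply Rle_abs].
    - apply (H T 0 (Rle_refl 0)). intros t Ht.
      apply Rbar_le_trans with m_infty; [apply Hl; eauto | exact I]. }
  destruct g; simpl in P; tauto.
Qed.

Lemma sobolev_growth rho0 rho rho_s c0 s : global_smooth_IPM_solution rho0 rho ->
  smooth_torus rho_s -> stratified rho_s ->
  (forall x y, rho0 x (- y) = - rho0 x y) -> 0 < c0 -> 0 < s ->
  (forall t, 0 <= t -> c0 <= I2 (fun x y =>
     D1 (fun t => rho (Rmax t 0)) t x y * D1 (fun t => rho (Rmax t 0)) t x y)) ->
  limsup_infty (fun t => Rbar_mult (Finite (Rpower t (- (s / 2))))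
    (Hdot_norm (s + 1) (sub2 (rho t) rho_s))) = p_infty.
Proof.
  intros Hsol Hs [gs Hstrat] Hodd Hc0 Hs0 Hlow.
  set (r := fun t => rho (Rmax t 0)) in *.
  pose proof (solution_flow_pair _ _ Hsol) as H. fold r in H.
  pose proof (proj1 H) as Hr. pose proof (proj1 (smooth_family_const rho_s) Hs) as Hss.
  set (g := flin (-1) r (fun _ => rho_s)).
  assert (r00 : forall x y, r 0 x y = rho0 x y).
  { intros x y. unfold r. rewrite Rmax_left by lra. apply Hsol. }
  assert (Eg : D1 g = D1 r).
  { unfold g. rewrite (D1_flin _ r (fun _ => rho_s) (fun t => smooth_family_partials r t Hr)
      (fun t => smooth_family_partials _ t Hss)).
    extensionality t; extensionality x; extensionality y. unfold flin.
    replace (D1 (fun _ => rho_s) t x y) with 0; [ring|].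
    unfold D1, d1. rewrite (Derive_ext _ (fun _ => gs y)); [now rewrite Derive_const|].
    intros; apply Hstrat. }
  apply limsup_infty_p_infty. intros T L HL HH.
  apply (growth r (inv_lap (D1 r)) g c0 s (L ^ 2) T H eq_refl); auto.
  - intros x y. rewrite !r00. apply Hodd.
  - now apply smooth_family_flin.
  - apply pow2_ge_0.
  - intros t Ht t0 N. specialize (HH t Ht).
    assert (E : sub2 (rho t) rho_s = g t).
    { extensionality x; extensionality y. unfold sub2, g, flin, r.
      rewrite Rmax_left by lra. ring. }
    rewrite E in HH.
    assert (p0 : 0 < Rpower t (- (s / 2))) by apply exp_pos.
    destruct (Hdot_norm (s + 1) (g t)) as [v| |] eqn:Ev.
    + pose proof (hdot_sum_le_norm _ _ _ Ev N) as B. simpl in HH.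
      assert (v0 : 0 <= v).
      { unfold Hdot_norm in Ev. destruct (Lim_seq _) as [l| |]; simpl in Ev; inversion Ev;
          [apply sqrt_pos | lra]. }
      apply Rle_trans with (1 := B).
      assert (Es : Rpower t s = Rpower t (s / 2) * Rpower t (s / 2)).
      { rewrite <- Rpower_plus. f_equal. field. }
      assert (E1 : Rpower t (- (s / 2)) * Rpower t (s / 2) = 1).
      { rewrite <- Rpower_plus. replace (- (s / 2) + s / 2) with 0 by ring. now apply Rpower_O. }
      assert (p1 : 0 < Rpower t (s / 2)) by apply exp_pos.
      set (P := Rpower t (s / 2)) in *. set (M := Rpower t (- (s / 2))) in *.
      assert (vL : v <= L * P).
      { replace v with (M * v * P); [apply Rmult_le_compat_r; lra|].
        replace (M * v * P) with (M * P * v) by ring. rewrite E1. ring. }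
      rewrite Es. replace (L ^ 2 * (P * P)) with ((L * P) ^ 2) by ring.
      apply pow_incr. lra.
    (* An infinite norm times the positive weight is [p_infty], which already contradicts the bound
       by [L]. *)
    + exfalso. unfold Rbar_mult, Rbar_mult' in HH.
      destruct (Rle_dec 0 (Rpower t (- (s / 2)))) as [h|h]; [|lra].
      destruct (Rle_lt_or_eq_dec 0 _ h) as [h'|h']; [exact HH | lra].
    + exfalso. unfold Hdot_norm in Ev. destruct (Lim_seq _); simpl in Ev; discriminate.
Qed.

Theorem theorem1p4 :
  forall rho_s : R -> R -> R,
    smooth_torus rho_s -> stratified rho_s -> odd_x2 rho_s ->
  forall eps k : R, 0 < eps -> 0 < k ->
  exists rho0 : R -> R -> R,
    smooth_torus rho0 /\
    Rbar_le (H_norm k (sub2 rho0 rho_s)) (Finite eps) /\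
    (forall rho : R -> R -> R -> R,
       global_smooth_IPM_solution rho0 rho ->
       forall s : R, 0 < s ->
         limsup_infty (fun t =>
           Rbar_mult (Finite (Rpower t (- (s / 2))))
             (Hdot_norm (s + 1) (sub2 (rho t) rho_s))) = p_infty).
Proof.
  intros rho_s Hs Hstrat Hodd eps k He Hk. pose proof PI_pos as HP.
  pose proof (proj1 (smooth_family_const rho_s) Hs) as Hss.
  destruct (exists_max rho_s Hs Hodd) as [y0 [Hy0 [Hsin Hmax]]].
  destruct (H_norm_scaled_bump k Hk) as [K [K0 HK]].
  (* The sign makes [c * sin y0] positive, and dividing by [1 + K] gives [c^2 K <= eps^2] for every
     [K >= 0]. *)
  set (c := (if Rlt_dec 0 (sin y0) then 1 else -1) * (eps / (1 + K))).
  assert (e0 : 0 < eps / (1 + K)) by (apply Rdiv_lt_0_compat; lra).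
  assert (cs : 0 < c * sin y0) by (unfold c; destruct (Rlt_dec 0 (sin y0)); nra).
  assert (c2K : c ^ 2 * K <= eps ^ 2).
  { replace (c ^ 2) with ((eps / (1 + K)) ^ 2) by (unfold c; destruct (Rlt_dec 0 (sin y0)); ring).
    set (z := eps / (1 + K)) in *. assert (E : eps = z * (1 + K)) by (unfold z; field; lra).
    rewrite E. nra. }
  set (rho0 := fun x y => rho_s x y + c * bump x y).
  assert (H0 : smooth_family (fun _ => rho0)) by (apply
    (smooth_family_flin c _ _ Hss smooth_family_bump)).
  destruct Hstrat as [gs Hg].
  assert (strat : forall x y, rho_s x y = rho_s 0 y) by (intros; now rewrite !Hg).
  assert (bump_val : forall x y, bump x y = (1 + cos x) * sin y).
  { intros; unfold bump, trig; ring. }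
  exists rho0. split; [now apply smooth_family_const|]. split.
  { replace (sub2 rho0 rho_s) with (fun x y => c * bump x y).
    - apply HK; [lra | exact c2K].
    - extensionality x; extensionality y. unfold sub2, rho0. ring. }
  intros rho Hsol s Hs0.
  assert (oddr : forall x y, rho0 x (- y) = - rho0 x y).
  { intros x y. unfold rho0. rewrite Hodd, !bump_val, sin_neg. ring. }
  assert (evenr : forall x y, rho0 (- x) y = rho0 x y).
  { intros x y. unfold rho0. rewrite !bump_val, cos_neg, strat, (strat x). reflexivity. }
  set (M := rho_s 0 y0). pose proof (cont1_excess M) as ce.
  pose proof (smooth_family_cont2 _ 0 H0) as cr0. cbv beta in cr0.
  set (A := I2 (fun x y => excess M (rho0 x y) ^ 2)).
  assert (A0 : 0 < A).
  { assert (nn : 0 <= A) by (apply I2_ge0; [solve_cont | intros; apply pow2_ge_0]).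
    destruct nn as [nn|nn]; [exact nn|exfalso].
    (* At [(0, y0)] the datum is [M + 2 c sin y0 > M], so the squared excess cannot vanish there. *)
    assert (Z : excess M (rho0 0 y0) ^ 2 = 0).
    { apply (I2_zero (fun x y => excess M (rho0 x y) ^ 2)); auto; try lra.
      - solve_cont.
      - intros; apply pow2_ge_0. }
    unfold excess, rho0 in Z. rewrite bump_val, cos_0 in Z. fold M in Z.
    rewrite Rmax_left in Z; nra. }
  pose proof (solution_flow_pair _ _ Hsol) as H.
  set (r := fun t => rho (Rmax t 0)) in *.
  assert (r00 : forall x y, r 0 x y = rho0 x y).
  { intros x y. unfold r. rewrite Rmax_left by lra. apply Hsol. }
  apply (sobolev_growth rho0 rho rho_s (A / (16 * PI ^ 2)) s Hsol Hs); auto.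
  - now exists gs.
  - apply Rdiv_lt_0_compat; [exact A0 | nra].
  - intros t Ht. fold r.
    assert (B : A <= 16 * PI ^ 2 * I2 (fun x y => D1 r t x y * D1 r t x y)).
    { unfold A. rewrite (I2_ext _ (fun x y => excess M (r 0 x y) ^ 2))
        by (intros; now rewrite r00).
      apply (gradient_lower_bound r (inv_lap (D1 r)) M t H); auto.
      - intros x y. rewrite !r00. apply evenr.
      - intros y. rewrite r00. unfold rho0. rewrite bump_val, cos_PI, strat.
        specialize (Hmax y). unfold M. lra. }
    apply Rmult_le_reg_l with (16 * PI ^ 2); [nra|].
    replace (16 * PI ^ 2 * (A / (16 * PI ^ 2))) with A by (field; lra). exact B.
Qed.
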